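(* Let $p$ be an odd prime, $S$ a finite $p$-group of sectional rank $3$ and $\mathcal{F}$ a saturated fusion system on $S$. Let $E$ be an $\mathcal{F}$-essential subgroup of $S$ that is not $\mathcal{F}$-characteristic in $S$, set $T=\mathrm{core}_{\mathcal{F}}(E)$, $Z_S=\Omega_1(Z(S))$ and $Z_E=\langle Z_S\alpha:\alpha\in\mathrm{Aut}_{\mathcal{F}}(E)\rangle$. Then $Z_S=Z_E$ if and only if $Z_S\le T$.
   Context: Rank: minimal size of a generating set; a $p$-group has sectional rank $k$ if all its subgroups have rank at most $k$ and $k$ is minimal. For $P\le S$, $\mathrm{Aut}_{\mathcal{F}}(P)=\mathrm{Hom}_{\mathcal{F}}(P,P)$, $\mathrm{Out}_{\mathcal{F}}(P)=\mathrm{Aut}_{\mathcal{F}}(P)/\mathrm{Inn}(P)$, $P^{\mathcal{F}}=\{P\alpha:\alpha\in\mathrm{Hom}_{\mathcal{F}}(P,S)\}$. $E\le S$ is $\mathcal{F}$-essential if $C_S(P)\le P$ and $|N_S(E)|\ge|N_S(P)|$ for all $P\in E^{\mathcal{F}}$, and $\mathrm{Out}_{\mathcal{F}}(E)$ has a strongly $p$-embedded subgroup. $E$ is $\mathcal{F}$-characteristic in $S$ if normalized by $\mathrm{Aut}_{\mathcal{F}}(S)$. $\mathrm{core}_{\mathcal{F}}(E)$ is the largest subgroup of $E$ normalized by both $\mathrm{Aut}_{\mathcal{F}}(E)$ and $\mathrm{Aut}_{\mathcal{F}}(N_S(E))$. $\Omega_1(A)$ is the subgroup generated by elements of order $p$.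 *)

(* Defs.v *)
From mathcomp Require Import all_boot all_fingroup all_solvable.
Set Implicit Arguments. Unset Strict Implicit. Unset Printing Implicit Defensive.
Import GroupScope.

(* Fusion systems over a finite p-group S, all inside an ambient finGroupType gT.
   A fusion system F is encoded as a boolean predicate: [F P f] means that
   f (restricted to the subgroup P) is a morphism in Hom_F(P, S).
   Then Hom_F(P,Q) = { f | F P f, f @: P \subset Q }. *)

Section Fusion.
Variable gT : finGroupType.
Implicit Types (S P Q R : {group gT}).
Definition fsys := {group gT} -> pred {ffun gT -> gT}.

Definition conjf (g : gT) : {ffun gT -> gT} := [ffun x => x ^ g].

Definition is_fusion_system S (F : fsys) : Prop :=
  [/\
      (forall P f, F P f ->
         [/\ P \subset S, {in P &, {morph f : x y / x * y}},
             {in P &, injective f} & f @: P \subset S]),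
      (forall P f (f' : {ffun gT -> gT}), F P f -> {in P, f =1 f'} -> F P f'),
      (forall P g, P \subset S -> g \in S -> F P (conjf g)),
      (forall P Q f (f' : {ffun gT -> gT}), F P f -> F Q f' -> f @: P \subset Q ->
         F P [ffun x => f' (f x)]) &
      (forall P Q f, F P f -> (Q :=: f @: P) ->
         exists2 f' : {ffun gT -> gT}, F Q f' & {in P, forall x, f' (f x) = x})].

Variable (F : fsys) (S : {group gT}).

Definition Fconj P : {set {set gT}} := [set (f @: P) | f : {ffun gT -> gT} in F P].

Definition fully_normalized P :=
  forall f : {ffun gT -> gT}, F P f -> #|'N_S(f @: P)| <= #|'N_S(P)|.
Definition fully_centralized P :=
  forall f : {ffun gT -> gT}, F P f -> #|'C_S(f @: P)| <= #|'C_S(P)|.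

Definition AutF P : {set {perm gT}} := [set a in Aut P | F P [ffun x => a x]].
Definition AutS P : {set {perm gT}} := conj_aut P @* 'N_S(P).
Definition InnAut P : {set {perm gT}} := conj_aut P @* P.
Definition OutF P := (AutF P / InnAut P)%g.

(* N_f = { g in N_S(P) | f c_g f^-1 in Aut_S(f(P)) } *)
Definition Nphi P (f : {ffun gT -> gT}) : {set gT} :=
  [set g in 'N_S(P) | [exists h in 'N_S(f @: P),
     [forall x in P, f (x ^ g) == (f x) ^ h]]].

Definition saturated (p : nat) :=
  is_fusion_system S F /\
  [/\
      (forall P, P \subset S -> fully_normalized P ->
         fully_centralized P /\ p.-Sylow(AutF P) (AutS P)) &
      (forall P Q f, F P f -> (Q :=: f @: P) -> fully_centralized Q ->
         forall N : {group gT}, (N :=: Nphi P f) ->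
         exists2 f' : {ffun gT -> gT}, F N f' & {in P, f' =1 f})].

Definition F_characteristic (E : {set gT}) :=
  forall f : {ffun gT -> gT}, F S f -> f @: E = E.

Definition normalized_by_AutF (T : {set gT}) P :=
  forall f : {ffun gT -> gT}, F P f -> f @: P \subset P -> f @: T = T.
Definition core_cond (E T : {group gT}) :=
  [/\ T \subset E, normalized_by_AutF T E & normalized_by_AutF T 'N_S(E)%G].
Definition is_Fcore (E T : {group gT}) :=
  core_cond E T /\ forall T' : {group gT}, core_cond E T' -> T' \subset T.

Definition ZE (E : {group gT}) (Z : {set gT}) : {set gT} :=
  << \bigcup_(f : {ffun gT -> gT} | F E f && (f @: E \subset E)) (f @: Z) >>.

End Fusion.

Definition strongly_p_embedded (T : finGroupType) (p : nat) (G H : {set T}) :=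
  [&& H \proper G, p %| #|H| &
      [forall g in G :\: H, ~~ (p %| #|H :&: H :^ g|)]].

Definition has_strongly_p_embedded (T : finGroupType) (p : nat) (G : {set T}) :=
  exists H : {group T}, strongly_p_embedded p G H.

Definition F_essential (gT : finGroupType) (p : nat) (F : fsys gT) (S E : {group gT}) :=
  [/\ E \subset S, 'C_S(E) \subset E, fully_normalized F S E &
      has_strongly_p_embedded p (OutF F E)].

Definition rank_le (gT : finGroupType) (Q : {set gT}) (k : nat) :=
  exists X : {set gT}, #|X| <= k /\ <<X>> = Q.

Definition sectional_rank (gT : finGroupType) (S : {set gT}) (k : nat) :=
  (forall Q : {group gT}, Q \subset S -> rank_le Q k) /\
  (forall k', (forall Q : {group gT}, Q \subset S -> rank_le Q k') -> k <= k').

(* Main.v *)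
Require Import Defs.
From mathcomp Require Import all_boot all_fingroup all_solvable.
Set Implicit Arguments. Unset Strict Implicit. Unset Printing Implicit Defensive.
Import GroupScope.

(* Write [Z = Ohm_1 Z(S)] and [N = N_S(E)].  The key fact ([ess_stable_center]) is
   that if some [Aut_F(E)]-invariant [X] satisfies [Z <= X <= Z(N)], then [Aut_F(N)]
   normalizes [Z].  Otherwise, after replacing [E] by an F-conjugate, there is a fully
   normalized [Q >= N] of maximal order such that [Aut_F(Q)] moves [Z].  Then
   [Y = Ohm_1 Z(Q)] has order p^2, [Aut_F(Q)] permutes its lines transitively, and [Q]
   has an [Aut_F(Q)]-invariant elementary abelian subgroup [J > Y] of order p^3.
   Elements of [N] outside [E] cannot stabilize [Aut_F(E)]-invariant chains (they
   would yield a normal p-subgroup of [Out_F(E)]); hence the [Aut_F(E)]-images of [J]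
   if [J <= E], and [Ohm_1 Z(E)] together with [J] otherwise, generate a group [M] of
   order p^4 and exponent p with [|M'| = p].  A further element of [E] centralizing [M]
   modulo [M'] gives a section of rank 4.  In its absence, either some
   [Aut_F(Q)]-image of [E] has its normalizer outside [Q], which maximality forbids, or
   the p-th powers of elements of [Q] form an invariant line in [Y].

   If [Z = ZE], apply the key fact to [X = Z].  Conversely let [Z <= T] and suppose
   [Z <> ZE].  If [N] centralized [ZE], the key fact for [X = ZE] and a Frattini
   argument would make [Z] invariant under [Aut_F(E)].  So [N] does not centralize
   [ZE], whence ['C_N(ZE) = E]; with [W = Ohm_1 Z(T)] one gets ['C_N(W) <= T] and
   either [E] = ['C_N(W)] or [[W, N] = [W, E] = ZE], so [Aut_F(N)] normalizes [E];
   this forces [N = S], and then [E] is F-characteristic in [S]. *)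

(** * Coprime automorphisms of p-groups *)

(** A p'-automorphism trivial on [X1] and on [X2 / X1] is trivial on [X2], so the stabilizer of a
    chain is a p-group once [X2] detects the p'-automorphisms of [E]. For odd p a normal abelian [J]
    with ['Ohm_1('C_P(J)) <= J] detects them, and rank three grants this to every normal elementary
    abelian subgroup of order p^3. The other use of the rank is that no section is elementary
    abelian of order p^4. Maximality of [Q] makes [Q] the centralizer of [Y] in ['N_S(Q)], so an
    element of ['N_S(Q)] outside [Q] acts on [Y] as a transvection fixing [Z]. Hence [Y] is
    irreducible under [Aut_F(Q)], and any invariant subgroup built inside it (commutators with a
    fixed element, p-th powers, a derived subgroup) is 1 or [Y]. The obstacle is that [Aut_F(Q)]
    need not preserve [E], nor [Aut_F(E)] preserve [Y]. The link between them is [N <= Q], which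
    full normalization of [E] carries over to every [Aut_F(Q)]-image of [E]. *)

Section Automorphisms.
Variable gT : finGroupType.
Implicit Types (P K X Y : {group gT}) (a : {perm gT}).

Lemma autM P a : a \in Aut P -> {in P &, forall x y, a (x * y) = a x * a y}.
Proof. by move=> /Aut_morphic/morphicP. Qed.

Lemma autJ P a : a \in Aut P -> {in P &, forall x y, a (x ^ y) = a x ^ a y}.
Proof. by move=> Aa x y Px Py; rewrite -(autmE Aa) morphJ. Qed.

Lemma autV P a : a \in Aut P -> {in P, forall x, a x^-1 = (a x)^-1}.
Proof. by move=> Aa x Px; rewrite -(autmE Aa) morphV. Qed.

Lemma autX P a n : a \in Aut P -> {in P, forall x, a (x ^+ n) = (a x) ^+ n}.
Proof. by move=> Aa x Px; rewrite -(autmE Aa) morphX. Qed.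

Lemma autR P a : a \in Aut P -> {in P &, forall x y, a [~ x, y] = [~ a x, a y]}.
Proof. by move=> Aa x y Px Py; rewrite -(autmE Aa) morphR. Qed.

(** The iterates satisfy [(a ^+ n) e = e * c ^+ n], so at [n = #[a]] the order of the p-element [c]
    divides a number prime to p. *)
Lemma p'_aut_stab p P a e : p.-group P -> a \in Aut P -> p^'.-elt a ->
  e \in P -> a (e^-1 * a e) = e^-1 * a e -> a e = e.
Proof.
move=> pP Aa p'a Pe; set c := _ * _ => ac.
have Pae: a e \in P by rewrite Aut_closed.
have Pc: c \in P by rewrite groupM ?groupV.
have ae n : (a ^+ n) e = e * c ^+ n.
  elim: n => [|n IHn]; first by rewrite expg0 perm1 mulg1.
  rewrite expgSr permM IHn (autM Aa) ?groupX // (autX _ Aa) // ac expgS mulgA.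
  by rewrite /c mulKVg.
have /esym/eqP := ae #[a]; rewrite expg_order perm1.
have pc: p.-elt c := mem_p_elt pP Pc.
rewrite -[X in _ == X]mulg1 (inj_eq (mulgI e)) -order_dvdn => dvd_ca.
have : coprime #[c] #[a] by exact: pnat_coprime pc p'a.
rewrite /coprime (gcdn_idPl dvd_ca) order_eq1 => /eqP c1.
by rewrite -[RHS]mulg1 -c1 /c mulKVg.
Qed.

Lemma expMg_class2 p P x y : odd p -> P^`(1) \subset 'Z(P) ->
    x \in P -> y \in P -> [~ x, y] ^+ p = 1 ->
  (y * x) ^+ p = y ^+ p * x ^+ p.
Proof.
move=> odd_p cl2 Px Py Rxy1.
have Zxy: [~ x, y] \in 'Z(P) by rewrite (subsetP cl2) // mem_commg.
have cP z : z \in P -> commute z [~ x, y].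
  by move=> Pz; have [_ /centP/(_ z Pz)] := setIP Zxy.
rewrite expMg_Rmul; [| exact: cP..].
by rewrite bin2odd // expgM Rxy1 expg1n mulg1.
Qed.

(** Induction on the order: once [h ^+ p] is fixed, class two gives [c = h^-1 * a h] exponent p, so
    [c] lies in ['Ohm_1(P)], is fixed, and is 1 by coprimality. *)
Lemma p'_aut_Ohm1_class2 p P a : prime p -> odd p -> p.-group P ->
    P^`(1) \subset 'Z(P) -> a \in Aut P -> p^'.-elt a ->
    {in 'Ohm_1(P), forall x, a x = x} ->
  {in P, forall x, a x = x}.
Proof.
move=> p_pr odd_p pP cl2 Aa p'a fix1 h.
have [n] := ubnP #[h]; elim: n h => // n IHn h; rewrite ltnS => le_h_n Ph.
have [-> | nt_h] := eqVneq h 1; first by rewrite -(autmE Aa) morph1.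
have ahp: a (h ^+ p) = h ^+ p.
  apply: IHn; last exact: groupX.
  have [_ p_dv_h _] := pgroup_pdiv (mem_p_elt pP Ph) (etrans (congr1 negb (cycle_eq1 h)) nt_h).
  rewrite orderXdiv //; apply: leq_trans le_h_n.
  by rewrite ltn_Pdiv ?prime_gt1 ?order_gt0.
have Pah: a h \in P by rewrite Aut_closed.
have Pc: h^-1 * a h \in P by rewrite groupM ?groupV.
apply: (p'_aut_stab pP Aa p'a Ph); apply: fix1.
rewrite (OhmE 1 pP) mem_gen // inE Pc /= expn1; set c := _ * _ in Pc *.
have Zch: [~ c, h] \in 'Z(P) by rewrite (subsetP cl2) // mem_commg.
(* [[c, h]^p = [c, h^p]], and [h^p = a(h)^p] commutes with [h] and [a h]. *)
have Rch: [~ c, h] ^+ p = 1.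
  rewrite -commgX; last by have [_ /centP/(_ h Ph)] := setIP Zch.
  apply/eqP/commgP; apply: commute_sym; apply: commuteM.
    by apply: commuteV; apply: commute_sym; apply: commuteX.
  by rewrite -ahp (autX _ Aa) //; apply: commute_sym; apply: commuteX.
have := expMg_class2 odd_p cl2 Pc Ph Rch.
rewrite {1}/c mulKVg -(autX _ Aa) // ahp => /esym/eqP.
by rewrite -[X in _ == X]mulg1 (inj_eq (mulgI _)) => cp1; rewrite inE.
Qed.

(** Invariance of a set is phrased through the natural action ['P]: stabilizers are then groups, and
    one inclusion expresses invariance under a whole automizer. *)
Lemma perm_astabsP (a : {perm gT}) (K : {set gT}) :
  reflect {in K, forall x, a x \in K} (a \in 'N(K | 'P)).
Proof.
rewrite !inE; apply: (iffP subsetP) => aK x /aK; by rewrite inE.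
Qed.

Lemma perm_imset_astabs (a : {perm gT}) (K : {set gT}) :
  (a @: K == K) = (a \in 'N(K | 'P)).
Proof.
apply/eqP/perm_astabsP => [defK x Kx | aK]; first by rewrite -defK imset_f.
apply/eqP; rewrite eqEcard card_imset ?leqnn ?andbT; last exact: perm_inj.
by apply/subsetP=> _ /imsetP[x Kx ->]; apply: aK.
Qed.

Lemma Aut_char_astabs P K a : K \char P -> a \in Aut P -> a \in 'N(K | 'P).
Proof.
case/charP=> sKP chK Aa; rewrite -perm_imset_astabs.
have := chK [morphism of autm Aa] (injm_autm Aa) (im_autm Aa).
by rewrite morphimEsub //= => ->.
Qed.

(* The only use of a Thompson critical subgroup: it reduces this classical fact
   to class two. *)
Lemma p'_aut_Ohm1 p P a : prime p -> odd p -> p.-group P ->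
    a \in Aut P -> p^'.-elt a -> {in 'Ohm_1(P), forall x, a x = x} ->
  {in P, forall x, a x = x}.
Proof.
move=> p_pr odd_p pP Aa p'a fix1.
have [K critK] := Thompson_critical pP.
have [chK _ _ _] := critK.
have sKP := char_sub chK; have pK := pgroupS sKP pP.
have nKa := Aut_char_astabs chK Aa.
have fixK: {in K, forall x, a x = x}.
  move=> x Kx; rewrite -(restr_permE nKa Kx).
  apply: (p'_aut_Ohm1_class2 p_pr odd_p pK) => //.
  - by rewrite -nil_class2 (critical_class2 critK).
  - exact: Aut_restr_perm Aa.
  - exact: morph_p_elt nKa p'a.
  move=> y K1y; rewrite (restr_permE nKa); first by rewrite fix1 // (subsetP (OhmS 1 sKP)).
  exact: subsetP (Ohm_sub 1 K) y K1y.
(* The automorphisms centralizing a critical subgroup form a p-group, which contains no p'-element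
   other than 1. *)
have pC := critical_p_stab_Aut critK pP.
have: a \in 'C(K | [Aut P]).
  by rewrite astab_ract inE Aa; apply/astabP=> x Kx; apply: fixK.
move/(mem_p_elt pC) => pa.
by have /eqP := pnat_1 pa p'a; rewrite order_eq1 => /eqP-> x; rewrite perm1.
Qed.

End Automorphisms.

(** * Consequences of the rank bound *)

(** For [X \subset P] this says that the centralizer of [X] in [Aut P] is a p-group. *)
Definition p'_faithful (gT : finGroupType) (p : nat) (P X : {set gT}) :=
  forall a, a \in Aut P -> p^'.-elt a -> {in X, forall x, a x = x} ->
  {in P, forall x, a x = x}.

Section CommutatorImages.
Variable gT : finGroupType.
Implicit Types (P Z : {group gT}).

Definition comm_im (x : gT) (P : {set gT}) := [set [~ x, y] | y in P].

Lemma card_comm_im P x : #|comm_im x P| = #|P : 'C_P[x]|.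
Proof.
rewrite index_cent1 -(card_imset _ (mulgI x)); congr #|pred_of_set _|.
rewrite /comm_im -imset_comp /class_support.
by apply/eq_in_imset=> y _ /=; rewrite commgEl mulKVg.
Qed.

Lemma comm_im_group_set P x :
  comm_im x P \subset 'C(P) -> group_set (comm_im x P).
Proof.
move=> cP; apply/group_setP; split.
  by apply/imsetP; exists 1; rewrite ?group1 // commg1.
move=> _ _ /imsetP[y Py ->] /imsetP[z Pz ->].
have /(subsetP cP)/centP/(_ y Py) cyz : [~ x, z] \in comm_im x P by apply: imset_f.
apply/imsetP; exists (z * y); first exact: groupM.
by rewrite commgMJ; congr (_ * _); rewrite conjgE cyz mulKg.
Qed.

End CommutatorImages.

Section PGroups.
Variables (gT : finGroupType) (p : nat).
Hypotheses (p_pr : prime p) (odd_p : odd p).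
Implicit Types (P X Y J D M : {group gT}) (a : {perm gT}).

(** Fixing [J] pointwise, [a] preserves ['C_P(J)] and is trivial there because it is trivial on its
    ['Ohm_1]. As [e] and [a e] act alike on [J], the element [e^-1 * a e] lies in ['C_P(J)] and is
    fixed, hence is 1 by coprimality. *)
Lemma p'_faithful_normal P J : p.-group P -> J <| P -> abelian J ->
  'Ohm_1('C_P(J)) \subset J -> p'_faithful p P J.
Proof.
move=> pP nsJP abJ sO1J a Aa p'a fixJ.
have [sJP nJP] := andP nsJP.
have Daut: a \in 'N('C_P(J) | 'P).
  apply/perm_astabsP=> d /setIP[Pd /centP cJd].
  rewrite inE Aut_closed //=; apply/centP=> j Jj; rewrite -(fixJ _ Jj).
  have /commgP/eqP Rdj: commute d j by apply: cJd.
  by apply/commgP; rewrite -(autR Aa) ?(subsetP sJP j Jj) // Rdj -(autmE Aa) morph1.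
have sDP: 'C_P(J) \subset P := subsetIl _ _.
have fixD: {in 'C_P(J), forall x, a x = x}.
  move=> x Dx; rewrite -(restr_permE Daut Dx).
  apply: (p'_aut_Ohm1 p_pr odd_p (pgroupS sDP pP)) => //.
  - exact: Aut_restr_perm Aa.
  - exact: morph_p_elt Daut p'a.
  move=> y D1y; rewrite (restr_permE Daut) ?(subsetP (Ohm_sub 1 _) y D1y) //.
  by rewrite fixJ // (subsetP sO1J).
move=> e Pe; apply: (p'_aut_stab pP Aa p'a Pe); apply: fixD.
rewrite inE groupM ?groupV ?Aut_closed //=; apply/centP=> j Jj.
apply/commute_sym/commgP/conjg_fixP.
have Jk: j ^ e^-1 \in J by rewrite memJ_norm // groupV (subsetP nJP).
rewrite conjgM -{1}(fixJ _ Jk) -(autJ Aa) ?(subsetP sJP _ Jk) //.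
by rewrite -conjgM mulVg conjg1 fixJ.
Qed.

Lemma pgroup_index_dvd P n : p.-group P -> p ^ n < #|P| -> p ^ n.+1 %| #|P|.
Proof.
move=> /p_natP[k ->]; rewrite ltn_exp2l ?prime_gt1 // => lt_nk.
exact: dvdn_exp2l.
Qed.

Lemma abelem_join_cycle M Y z : exponent M %| p -> Y \subset M -> abelian Y ->
  z \in M -> z \in 'C(Y) -> p.-abelem (Y <*> <[z]>).
Proof.
move=> expM sYM abY Mz cYz; rewrite abelemE // abelianY abY cycle_abelian.
rewrite cycle_subG cYz (dvdn_trans _ expM) // exponentS //.
by rewrite join_subG sYM cycle_subG.
Qed.

End PGroups.

Section SectionalRank.
Variables (gT : finGroupType) (p : nat) (S : {group gT}).
Hypotheses (p_pr : prime p) (odd_p : odd p) (pS : p.-group S).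
Hypothesis rkS : forall Q : {group gT}, Q \subset S -> 'm(Q) <= 3.
Implicit Types (P X Y J D M : {group gT}) (a : {perm gT}).

Lemma abelem_section_index X D : X \subset S -> D <| X -> p.-abelem (X / D) ->
  #|X : D| <= p ^ 3.
Proof.
move=> sXS /andP[sDX nDX] abX; rewrite -card_quotient //.
rewrite (card_pgroup (abelem_pgroup abX)) leq_exp2l ?prime_gt1 //.
rewrite -rank_abelem // -grank_abelian ?(abelem_abelian abX) //.
exact: leq_trans (quotient_grank nDX) (rkS sXS).
Qed.

Lemma abelem_card X : X \subset S -> p.-abelem X -> #|X| <= p ^ 3.
Proof.
move=> sXS abX; rewrite (card_pgroup (abelem_pgroup abX)) leq_exp2l ?prime_gt1 //.
by rewrite -rank_abelem // -grank_abelian ?(abelem_abelian abX) ?rkS.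
Qed.

(* [M] is generated modulo [Y <= 'Z(M)] by elements of order p, and [Y] has order
   p^2; the rank bound then leaves little room. *)
Section CentralPlane.
Variables (M Y : {group gT}).
Hypotheses (sMS : M \subset S) (expM : exponent M %| p) (ltYM : Y \proper M).
Hypotheses (cYM : M \subset 'C(Y)) (oY : #|Y| = (p ^ 2)%N).
Hypothesis sM'Y : M^`(1) \subset Y.

Let sYM : Y \subset M := proper_sub ltYM.
Let pM : p.-group M := pgroupS sMS pS.
Let abY : abelian Y := subset_trans sYM cYM.

(** [Y <*> <[x]>] is elementary abelian of order p^3, the largest the rank allows; any [z] in [M]
    commuting with [x] would extend it, so it already contains [z]. *)
Lemma plane_cent1 x : x \in M :\: Y ->
  'C_M[x] = Y <*> <[x]> /\ #|'C_M[x]| = (p ^ 3)%N.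
Proof.
case/setDP=> Mx nYx.
have cYx: x \in 'C(Y) := subsetP cYM x Mx.
pose K := (Y <*> <[x]>)%G.
have abK: p.-abelem K := abelem_join_cycle p_pr expM sYM abY Mx cYx.
have sKM: K \subset M by rewrite join_subG sYM cycle_subG.
have oK: #|K| = (p ^ 3)%N.
  apply/eqP; rewrite eqn_leq abelem_card ?(subset_trans sKM) //=.
  apply: dvdn_leq => //; apply: (pgroup_index_dvd p_pr (pgroupS sKM pM)).
  rewrite -oY proper_card // properE joing_subl /=.
  by apply: contra nYx => /subsetP-> //; rewrite mem_gen // inE cycle_id orbT.
suffices defC: 'C_M[x] = K by rewrite defC.
apply/eqP; rewrite eqEsubset subsetI sKM join_subG cycle_subG cent1id.
rewrite sub_cent1 cYx !andbT; apply/subsetP=> z /setIP[Mz cxz].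
have cKz: z \in 'C(K).
  by rewrite centY inE (subsetP cYM) //= cent_cycle.
have abKz: p.-abelem (K <*> <[z]>).
  exact (abelem_join_cycle p_pr expM sKM (abelem_abelian abK) Mz cKz).
have sKzS: K <*> <[z]> \subset S.
  by rewrite (subset_trans _ sMS) // join_subG sKM cycle_subG.
have /eqP->: K :==: K <*> <[z]>.
  by rewrite eqEcard joing_subl oK abelem_card.
by rewrite mem_gen // inE cycle_id orbT.
Qed.

Lemma plane_comm_sub x : x \in M -> comm_im x M \subset Y.
Proof.
move=> Mx; apply/subsetP=> _ /imsetP[y My ->].
by rewrite (subsetP sM'Y) // mem_commg.
Qed.

Lemma plane_card_comm x : x \in M :\: Y -> (#|comm_im x M| * p ^ 3)%N = #|M|.
Proof.
move=> M_Yx; have [_ oC] := plane_cent1 M_Yx.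
by rewrite card_comm_im -oC mulnC Lagrange ?subsetIl.
Qed.

(* Otherwise, for [Z0 <= Y] of order [p], [M / Z0] would be extraspecial of order [p ^ 4]. *)
Lemma plane_card_neq5 : #|M| != (p ^ 5)%N.
Proof.
apply/eqP=> oM; have p_gt1 := prime_gt1 p_pr; have p_gt0 := prime_gt0 p_pr.
have imY x: x \in M :\: Y -> comm_im x M = Y.
  move=> M_Yx; apply/eqP; rewrite eqEcard oY plane_comm_sub; last by case/setDP: M_Yx.
  have /eqP := plane_card_comm M_Yx; rewrite oM (expnD p 2 3) eqn_pmul2r ?expn_gt0 ?p_gt0 //.
  by move=> /eqP->; rewrite leqnn.
have [Z0 sZ0Y oZ0]: exists2 Z0 : {group gT}, Z0 \subset Y & #|Z0| = p.
  have [|z Yz oz] := Cauchy p_pr (G := Y); first by rewrite oY dvdn_exp.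
  by exists <[z]>%G; rewrite ?cycle_subG.
have nZ0M: Z0 <| M.
  apply: sub_center_normal; apply: subset_trans sZ0Y _.
  by rewrite subsetI sYM centsC.
have nZM := normal_norm nZ0M.
have [_ [x0 Mx0 nYx0]] := properP ltYM.
have der: M^`(1) = Y.
  apply/eqP; rewrite eqEsubset sM'Y -{1}(imY x0) ?inE ?nYx0 //.
  by apply/subsetP=> _ /imsetP[y My ->]; rewrite mem_commg.
have defZ: 'Z(M / Z0) = Y / Z0.
  apply/eqP; rewrite eqEsubset; apply/andP; split; last first.
    by rewrite subsetI quotientS // quotient_cents // centsC.
  apply/subsetP=> w' /setIP[/morphimP[w nZw Mw ->] /centP cw].
  apply/mem_quotient/negPn/negP=> nYw.
  have /imY imYw: w \in M :\: Y by rewrite inE nYw.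
  have: Y \subset Z0.
    rewrite -imYw; apply/subsetP=> _ /imsetP[m Mm ->].
    have nZm := subsetP nZM m Mm.
    apply: coset_idr; first by rewrite groupR.
    by rewrite morphR //; apply/eqP/commgP/cw/mem_quotient.
  by move/subset_leq_card; rewrite oY oZ0 leqNgt -{1}(expn1 p) ltn_exp2l.
have pMZ: p.-group (M / Z0) by apply: quotient_pgroup.
have oYZ: #|Y / Z0| = p.
  by rewrite card_quotient ?(subset_trans sYM) // -divgS // oY oZ0 mulnK.
have espM: extraspecial (M / Z0).
  split; last by rewrite defZ oYZ.
  split; last by rewrite -(quotient_der 1) // der defZ.
  rewrite (Phi_joing pMZ) -(quotient_der 1) // der defZ.
  apply/joing_idPl; rewrite (MhoE 1 pMZ) gen_subG; apply/subsetP=> _ /imsetP[_ /morphimP[m nZm Mm ->] ->].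
  by rewrite -morphX // (exponentP expM) // morph1 group1.
have [n _] := card_extraspecial pMZ espM.
rewrite card_quotient // -divgS ?normal_sub // oM oZ0 (expnS p 4) mulKn //.
by move/eqP; rewrite eqn_exp2l // => /eqP/(congr1 odd); rewrite /= odd_double.
Qed.

(** [#|M| = #|[x, M]| * p ^ 3] with [[x, M] <= Y] leaves p^3, p^4 and p^5, the last being excluded.
    In order p^4 put [D = [x, M]]: ['C_M[x] / D] is central of index p in [M / D], so [M / D] is
    abelian and [M' = D]. *)
Lemma plane_card :
  #|M| = (p ^ 3)%N \/ #|M| = (p ^ 4)%N /\ #|M^`(1)| = p.
Proof.
have p_gt1 := prime_gt1 p_pr; have p_gt0 := prime_gt0 p_pr.
have [_ [x Mx nYx]] := properP ltYM.
have M_Yx: x \in M :\: Y by rewrite inE nYx.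
have leC: #|comm_im x M| <= p ^ 2 by rewrite -oY subset_leq_card ?plane_comm_sub.
have oM := plane_card_comm M_Yx; have n5 := plane_card_neq5.
have [k oMk] := p_natP pM; rewrite oMk in n5 oM *.
have k3: 3 <= k.
  by rewrite -(leq_exp2l _ _ p_gt1) -oM leq_pmull // card_gt0; apply/set0Pn; exists [~ x, x]; apply: imset_f.
have k5: k <= 5.
  by rewrite -(leq_exp2l _ _ p_gt1) -oM (expnD p 2 3) leq_pmul2r ?expn_gt0 ?p_gt0.
have {n5 k5 k3} : (k == 3) || (k == 4).
  by move: k3 k5 n5; rewrite eqn_exp2l //; case: k {oMk oM} => [|[|[|[|[|[|k]]]]]].
case/pred2P=> k34; rewrite k34 in oM oMk *; [by left | right; split=> //].
have cM: comm_im x M \subset 'C(M).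
  by rewrite (subset_trans (plane_comm_sub Mx)) // centsC.
pose D := Group (comm_im_group_set cM).
have oD: #|D| = p.
  by apply/eqP; have /eqP := oM; rewrite (expnD p 1 3) eqn_pmul2r ?expn_gt0 ?p_gt0.
suffices ->: M^`(1) = D by [].
have sDY: D \subset Y := plane_comm_sub Mx.
have sDM' : D \subset M^`(1).
  by apply/subsetP=> _ /imsetP[y My ->]; rewrite mem_commg.
have nDM: M \subset 'N(D) by rewrite (subset_trans _ (cent_sub D)) // centsC.
have sYZ: Y / D \subset 'Z(M / D).
  by rewrite subsetI quotientS // quotient_cents // centsC.
have Zx: coset D x \in 'Z(M / D).
  rewrite inE mem_quotient //; apply/centP=> _ /morphimP[m nDm Mm ->].
  have nDx := subsetP nDM x Mx.
  by apply/commgP; rewrite -morphR //; apply/eqP/coset_id/imset_f.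
have [defC oC] := plane_cent1 M_Yx.
have sCZ: 'C_M[x] / D \subset 'Z(M / D).
  rewrite defC quotientY ?(subset_trans _ nDM) ?cycle_subG // join_subG sYZ.
  by rewrite quotient_cycle ?cycle_subG // (subsetP nDM).
have sDC: D \subset 'C_M[x].
  by rewrite defC (subset_trans sDY) ?joing_subl.
have oMD: (#|M / D| = p ^ 3)%N.
  by rewrite card_quotient // -divgS ?(subset_trans sDM') ?der_sub // oMk oD (expnS p 3) mulKn.
have oCD: (#|'C_M[x] / D| = p ^ 2)%N.
  by rewrite card_quotient ?(subset_trans _ nDM) ?subsetIl // -divgS // oC oD (expnS p 2) mulKn.
apply/eqP; rewrite eqEsubset sDM' andbT; apply: (der1_min nDM).
apply: cyclic_center_factor_abelian.
have [/eqP Z1 | ] := boolP (#|(M / D) / 'Z(M / D)| == 1%N).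
  by rewrite (card1_trivg Z1) cyclic1.
move=> nZ1; apply: prime_cyclic.
have: #|(M / D) / 'Z(M / D)| %| p.
  rewrite card_quotient ?gFnorm // -(@dvdn_pmul2l #|'Z(M / D)|) ?cardG_gt0 // Lagrange ?center_sub //.
  by rewrite oMD (expnSr p 2) dvdn_pmul2r // -oCD cardSg.
by case/primeP: p_pr => _ /[apply]; rewrite (negPf nZ1) => /eqP->.
Qed.

End CentralPlane.

End SectionalRank.

Lemma order_p_central (gT : finGroupType) p (P X : {group gT}) :
  prime p -> p.-group P -> X <| P -> #|X| = p -> X \subset 'Z(P).
Proof.
move=> p_pr pP nsXP oX; apply: prime_meetG; rewrite ?oX //.
rewrite (meet_center_nil (pgroup_nil pP) nsXP) // -cardG_gt1 oX.
exact: prime_gt1.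
Qed.

Section NormalInPGroups.
Variables (gT : finGroupType) (p : nat).
Hypothesis p_pr : prime p.
Implicit Types (P X Y J : {group gT}) (a : {perm gT}).

Lemma index_p_comm P Y J : p.-group P -> Y <| P -> J <| P -> Y \subset J ->
  (#|J : Y| = p)%N -> [~: J, P] \subset Y.
Proof.
move=> pP /andP[sYP nYP] nsJP sYJ oJY; have sJP := normal_sub nsJP.
rewrite -quotient_cents2 ?(subset_trans sJP) //.
suffices: J / Y \subset 'Z(P / Y) by rewrite subsetI => /andP[].
apply: (order_p_central p_pr); first exact: quotient_pgroup.
  exact: quotient_normal.
by rewrite card_quotient ?(subset_trans sJP).
Qed.

Lemma Aut_astabs_gen P (X : {set gT}) a : a \in Aut P -> X \subset P ->
  a \in 'N(X | 'P) -> a \in 'N(<<X>> | 'P).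
Proof.
move=> Aa sXP; rewrite -!perm_imset_astabs => /eqP aX.
have sGP: <<X>> \subset P by rewrite gen_subG.
have := morphim_gen [morphism of autm Aa] sXP.
by rewrite !morphimEsub //= aX => ->.
Qed.

(* [restr_perm] turns a characteristic subgroup of a stable subgroup into a stable one. *)
Lemma Aut_char_astabs2 P X Y a : Y \char X -> X \subset P -> a \in Aut P ->
  a \in 'N(X | 'P) -> a \in 'N(Y | 'P).
Proof.
move=> chYX sXP Aa aX; apply/perm_astabsP=> y Yy.
rewrite -(restr_permE aX) ?(subsetP (char_sub chYX)) //.
by apply: (perm_astabsP _ _ (Aut_char_astabs chYX (Aut_restr_perm sXP Aa))).
Qed.

Lemma Aut_cent_astabs P X a : a \in Aut P -> X \subset P ->
  a \in 'N(X | 'P) -> a \in 'N('C_P(X) | 'P).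
Proof.
move=> Aa sXP aX; apply/perm_astabsP=> c /setIP[Pc cXc]; rewrite inE Aut_closed //=.
apply/centP=> x Xx; have aX' : a^-1 \in 'N(X | 'P) by rewrite groupV.
have Xax := perm_astabsP _ _ aX' x Xx.
apply/commgP; rewrite -(permKV a x) -(autR Aa) ?(subsetP sXP _ Xax) //.
have /commgP/eqP -> := centP cXc _ Xax.
by rewrite -(autmE Aa) morph1.
Qed.

Lemma Aut_comm_astabs P X Y a : a \in Aut P -> X \subset P -> Y \subset P ->
  a \in 'N(X | 'P) -> a \in 'N(Y | 'P) -> a \in 'N([~: X, Y] | 'P).
Proof.
move=> Aa sXP sYP; rewrite -!perm_imset_astabs => /eqP aX /eqP aY.
have := morphimR [morphism of autm Aa] sXP sYP.
by rewrite !morphimEsub ?comm_subG //= aX aY => ->.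
Qed.

End NormalInPGroups.

(** * Span of the images of an elementary abelian subgroup of order p^3 *)

Section OrbitSpan.
Variables (gT : finGroupType) (p : nat) (S : {group gT}).
Hypotheses (p_pr : prime p) (odd_p : odd p) (pS : p.-group S).
Hypothesis rkS : forall Q : {group gT}, Q \subset S -> 'm(Q) <= 3.
Variables (P Y J : {group gT}) (A : {group {perm gT}}).
Hypotheses (sPS : P \subset S) (sYP : Y \subset P) (cYP : P \subset 'C(Y)).
Hypotheses (oY : #|Y| = (p ^ 2)%N) (sYJ : Y \subset J).
Hypotheses (nsJP : J <| P) (abJ : p.-abelem J) (oJ : #|J| = (p ^ 3)%N).
Hypotheses (sA : A \subset Aut P) (AY : A \subset 'N(Y | 'P)).

(** [M] is spanned by the [A]-images of [J]. As [A] preserves [Y], each image satisfies [[a(J), P]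
    <= Y], so [M] has class at most two and exponent p, and [plane_card] applies. *)
Lemma orbit_span : exists M : {group gT},
  [/\ J \subset M, M \subset P, A \subset 'N(M | 'P),
      exponent M %| p & [~: M, P] \subset Y] /\
  (M :=: J \/ #|M| = (p ^ 4)%N /\ #|M^`(1)| = p).
Proof.
have pP := pgroupS sPS pS.
have sJP := normal_sub nsJP.
have nsYP : Y <| P.
  by rewrite /normal sYP (subset_trans cYP) ?cent_sub.
have RJ: [~: J, P] \subset Y.
  apply: (index_p_comm p_pr pP nsYP nsJP sYJ).
  by rewrite -divgS // oJ oY (expnS p 2) mulnK // expn_gt0 prime_gt0.
pose X := \bigcup_(a in A) a @: J.
have sXP: X \subset P.
  apply/bigcupsP=> a Aa; apply/subsetP=> _ /imsetP[x Jx ->].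
  by rewrite Aut_closed ?(subsetP sA) ?(subsetP sJP).
have memX a x : a \in A -> x \in J -> a x \in X.
  by move=> Aa Jx; apply/bigcupP; exists a; rewrite ?imset_f.
have sJX: J \subset X by apply/subsetP=> x Jx; rewrite -[x]perm1 memX.
exists <<X>>%G; have sJM: J \subset <<X>> := subset_trans sJX (subset_gen X).
have sMP: <<X>> \subset P by rewrite gen_subG.
have AM: A \subset 'N(<<X>> | 'P).
  apply/subsetP=> a Aa; apply: Aut_astabs_gen (subsetP sA a Aa) sXP _.
  apply/perm_astabsP=> _ /bigcupP[b Ab /imsetP[x Jx ->]].
  by rewrite -permM memX // groupM.
have RM: [~: <<X>>, P] \subset Y.
  have nYP := normal_norm nsYP.
  rewrite -quotient_cents2 ?(subset_trans sMP) //.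
  rewrite quotient_gen ?(subset_trans sXP) // gen_subG quotient_cents2r //.
  rewrite gen_subG; apply/subsetP=> _ /imset2P[_ y /bigcupP[a Aa /imsetP[x Jx ->]] Py ->].
  have AutPa := subsetP sA a Aa.
  have Py' : a^-1 y \in P by rewrite Aut_closed ?groupV.
  rewrite -(permKV a y) -(autR AutPa) ?(subsetP sJP x Jx) //.
  apply: (perm_astabsP _ _ (subsetP AY a Aa)).
  by rewrite (subsetP RJ) // mem_commg.
have sYM := subset_trans sYJ sJM.
have cYM := subset_trans sMP cYP.
have sM'Y: <<X>>^`(1) \subset Y := subset_trans (commgS _ sMP) RM.
have pM := pgroupS sMP pP.
have expM: exponent <<X>> %| p.
  have ->: <<X>> = 'Ohm_1(<<X>>).
    apply/eqP; rewrite eqEsubset Ohm_sub andbT gen_subG.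
    apply/subsetP=> _ /bigcupP[a Aa /imsetP[x Jx ->]].
    have /= -> := OhmE 1 pM; rewrite mem_gen // !inE mem_gen ?memX //=.
    rewrite -(autX _ (subsetP sA a Aa)) ?(subsetP sJP) // expn1.
    have [_ -> //] := abelemP p_pr abJ.
    by rewrite -(autmE (subsetP sA a Aa)) morph1.
  apply: exponent_Ohm1_class2 => //.
  by rewrite nil_class2 (subset_trans sM'Y) // subsetI sYM centsC.
split=> //.
have ltYM: Y \proper <<X>>.
  rewrite properEcard sYM (leq_trans _ (subset_leq_card sJM)) //.
  by rewrite oY oJ ltn_exp2l // prime_gt1.
have [oM|] := plane_card p_pr pS rkS (subset_trans sMP sPS) expM ltYM cYM oY sM'Y; last by right.
by left; apply/esym/eqP; rewrite eqEcard sJM oJ oM /=.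
Qed.

(** In the case of order p^4, [M'] would be an [A]-invariant line of [Y]. *)
Lemma orbit_span_irr :
    (forall X : {group gT}, X \subset Y -> #|X| = p -> ~ A \subset 'N(X | 'P)) ->
  A \subset 'N(J | 'P).
Proof.
move=> irr; have [M [[sJM sMP AM _ RM]]] := orbit_span.
case=> [<- //| [_ oM']]; case: (irr M^`(1)%G) => //.
  exact: subset_trans (commgS _ sMP) RM.
apply/subsetP=> a Aa; have AutPa := subsetP sA a Aa.
by apply: Aut_char_astabs2 (der_char 1 M) sMP AutPa (subsetP AM a Aa).
Qed.

End OrbitSpan.

(** * Fusion systems and saturation *)

(** Automorphism groups live in [{perm gT}]; extending a partial injection to a permutation lets the
    automizer of [P] be carried to that of its image by conjugation. *)
Lemma inj_perm_ext (T : finType) (P : {set T}) (f : T -> T) :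
  {in P &, injective f} -> exists b : {perm T}, {in P, b =1 f}.
Proof.
move=> injf; pose s1 := enum (~: P); pose s2 := enum (~: (f @: P)).
have sz: size s1 = size s2.
  by rewrite -!cardE; apply/(@addnI #|P|); rewrite -{2}(card_in_imset injf) !cardsC.
have i1 x: x \notin P -> index x s1 < size s2.
  by rewrite -sz index_mem mem_enum inE.
(* Off [P], match the enumerations of the two complements, which have the same length. *)
pose g x := if x \in P then f x else nth x s2 (index x s1).
have gP x: x \notin P -> nth x s2 (index x s1) \notin f @: P.
  by move=> nPx; have := mem_nth x (i1 x nPx); rewrite mem_enum inE.
have injg: injective g.
  move=> x y; rewrite /g.
  case: ifPn => Px; case: ifPn => Py.
  - exact: injf.
  - by move=> fxy; case/negP: (gP y Py); rewrite -fxy imset_f.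
  - by move=> fxy; case/negP: (gP x Px); rewrite fxy imset_f.
  rewrite (set_nth_default x y) ?i1 // => /eqP; rewrite nth_uniq ?enum_uniq ?i1 // => /eqP.
  have m z : z \notin P -> z \in s1 by rewrite mem_enum inE.
  by move/(congr1 (nth x s1)); rewrite !nth_index ?m.
by exists (perm injg) => x Px; rewrite permE /g Px.
Qed.

(** Generation makes this a group for every [P]; for [P \subset S] it adds nothing ([autFE]). *)
Definition autF (gT : finGroupType) (F : fsys gT) (P : {group gT}) :=
  <<AutF F P>>%G.

Section FusionSystems.
Variables (gT : finGroupType) (S : {group gT}) (F : fsys gT).
Hypothesis fusF : is_fusion_system S F.
Implicit Types (P Q R X E : {group gT}) (f : {ffun gT -> gT}) (a b : {perm gT}).

Lemma fsys_hom P f : F P f -> [/\ P \subset S, {in P &, {morph f : x y / x * y}},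
  {in P &, injective f} & f @: P \subset S].
Proof. by case: fusF => + _ _ _ _; apply. Qed.

Lemma fsys_sub P f : F P f -> P \subset S. Proof. by case/fsys_hom. Qed.

Lemma fsys_eq P f f' : F P f -> {in P, f =1 f'} -> F P f'.
Proof. by case: fusF => _ + _ _ _; apply. Qed.

Lemma fsys_conj P g : P \subset S -> g \in S -> F P (conjf g).
Proof. by case: fusF => _ _ + _ _; apply. Qed.

Lemma fsys_comp P Q f f' : F P f -> F Q f' -> f @: P \subset Q ->
  F P [ffun x => f' (f x)].
Proof. by case: fusF => _ _ _ + _; apply. Qed.

Lemma fsys_inv P Q f : F P f -> Q :=: f @: P ->
  exists2 f' : {ffun gT -> gT}, F Q f' & {in P, forall x, f' (f x) = x}.
Proof. by case: fusF => _ _ _ _; apply. Qed.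

Lemma fsys_res P Q f : F P f -> Q \subset P -> F Q f.
Proof.
move=> Ff sQP; have sPS := fsys_sub Ff.
have F1 := fsys_conj (subset_trans sQP sPS) (group1 S).
apply: (fsys_eq (fsys_comp F1 Ff _)).
  by apply/subsetP=> _ /imsetP[x Qx ->]; rewrite ffunE conjg1 (subsetP sQP).
by move=> x Qx; rewrite !ffunE conjg1.
Qed.

Definition fsys_morphism P f (Ff : F P f) : {morphism P >-> gT} :=
  let: And4 _ fM _ _ := fsys_hom Ff in Morphism fM.

Lemma fsys_morphismE P f (Ff : F P f) : fsys_morphism Ff =1 f.
Proof. by rewrite /fsys_morphism; case: (fsys_hom Ff). Qed.

Lemma fsys_injm P f (Ff : F P f) : 'injm (fsys_morphism Ff).
Proof.
apply/injmP=> x y Px Py; rewrite !fsys_morphismE.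
by have [_ _ injf _] := fsys_hom Ff; apply: injf.
Qed.

Lemma fsys_imset P f (Ff : F P f) (X : {set gT}) : X \subset P ->
  f @: X = fsys_morphism Ff @* X.
Proof.
by move=> sXP; rewrite morphimEsub //; apply: eq_imset => x; rewrite fsys_morphismE.
Qed.

Lemma fsys_image P f X : F P f -> X \subset P -> {Q : {group gT} | Q :=: f @: X}.
Proof. by move=> Ff sXP; exists (fsys_morphism Ff @* X)%G; rewrite (fsys_imset Ff). Qed.

Lemma fsys_card P f (X : {set gT}) : F P f -> X \subset P -> #|f @: X| = #|X|.
Proof.
move=> Ff /subsetP sXP; have [_ _ injf _] := fsys_hom Ff.
by apply: card_in_imset => x y /sXP Px /sXP; apply: injf.
Qed.

Lemma AutF_group_set P : P \subset S -> group_set (AutF F P).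
Proof.
move=> sPS; apply/group_setP; split.
  apply/setIdP; split; first exact: group1.
  apply: (fsys_eq (fsys_conj sPS (group1 S))) => x _.
  by rewrite !ffunE conjg1 perm1.
move=> a b /setIdP[Aa Fa] /setIdP[Ab Fb]; apply/setIdP; split; first exact: groupM.
apply: (fsys_eq (fsys_comp Fa Fb _)) => [|x _]; last by rewrite !ffunE permM.
by apply/subsetP=> _ /imsetP[x Px ->]; rewrite ffunE Aut_closed.
Qed.

Lemma autFE P : P \subset S -> autF F P :=: AutF F P.
Proof. by move/AutF_group_set=> gP; rewrite /= -[AutF F P]/(gval (Group gP)) genGid. Qed.

Lemma mem_autF P a : P \subset S ->
  (a \in autF F P) = (a \in Aut P) && F P [ffun x => a x].
Proof. by move=> sPS; rewrite autFE //; apply/setIdP/andP. Qed.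

Lemma autF_sub P : autF F P \subset Aut P.
Proof. by rewrite gen_subG; apply/subsetP=> a /setIdP[]. Qed.

Lemma autF_hom P f : F P f -> f @: P \subset P ->
  exists2 a, a \in autF F P & {in P, a =1 f}.
Proof.
move=> Ff fP; have sPS := fsys_sub Ff.
have im: fsys_morphism Ff @* P = P.
  apply/eqP; rewrite eqEcard card_injm ?fsys_injm // leqnn andbT.
  by rewrite -(fsys_imset Ff).
have fE: {in P, aut (fsys_injm Ff) im =1 f}.
  by move=> x Px; rewrite autE // fsys_morphismE.
exists (aut (fsys_injm Ff) im) => //.
rewrite mem_autF // Aut_aut; apply: (fsys_eq Ff) => x Px.
by rewrite ffunE fE.
Qed.

Lemma autF_conj P x : P \subset S -> x \in 'N_S(P) -> conj_aut P x \in autF F P.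
Proof.
move=> sPS /setIP[Sx nPx]; rewrite mem_autF // Aut_aut /=.
by apply: (fsys_eq (fsys_conj sPS Sx)) => y Py; rewrite !ffunE norm_conj_autE.
Qed.

Lemma AutS_sub P : P \subset S -> AutS S P \subset autF F P.
Proof.
move=> sPS; apply/subsetP=> _ /morphimP[x nPx Nx ->].
exact: autF_conj.
Qed.

Lemma InnAut_normal P : P \subset S -> InnAut P <| autF F P.
Proof.
move=> sPS; rewrite /normal (subset_trans _ (AutS_sub sPS)) /=; last first.
  by apply: morphimS; rewrite subsetI sPS normG.
apply/subsetP=> a Ga; have Aa := subsetP (autF_sub P) a Ga.
rewrite inE; apply/subsetP=> _ /imsetP[_ /morphimP[x nPx Px ->] ->].
have Pax: a x \in P by rewrite Aut_closed.
apply/morphimP; exists (a x) => //; first exact: subsetP (normG P) _ Pax.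
apply: (@eq_Aut _ P) => [||y Py]; [by rewrite groupJ // Aut_aut | exact: Aut_aut |].
 rewrite /= conjgE !permM.
have Pay: a^-1 y \in P by rewrite Aut_closed ?groupV.
rewrite !norm_conj_autE ?(subsetP (normG P)) //.
by rewrite (autJ Aa) // permKV.
Qed.

Lemma autF_stable_conj P (X : {set gT}) x : P \subset S -> X \subset P ->
  autF F P \subset 'N(X | 'P) -> x \in 'N_S(P) -> x \in 'N(X).
Proof.
move=> sPS sXP stX Nx; rewrite inE; apply/subsetP=> _ /imsetP[y Xy ->].
have [_ nPx] := setIP Nx.
rewrite -(norm_conj_autE nPx) ?(subsetP sXP) //.
exact: perm_astabsP (subsetP stX _ (autF_conj sPS Nx)) y Xy.
Qed.

Lemma stable_normalized P (X : {set gT}) : P \subset S -> X \subset P ->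
  normalized_by_AutF F X P <-> autF F P \subset 'N(X | 'P).
Proof.
move=> sPS sXP; split=> [nX | stX f Ff fP].
  apply/subsetP=> a; rewrite mem_autF // => /andP[Aa Fa].
  rewrite -perm_imset_astabs; apply/eqP; rewrite -[RHS](nX _ Fa).
    by apply: eq_imset => x; rewrite ffunE.
  by apply/subsetP=> _ /imsetP[x Px ->]; rewrite ffunE Aut_closed.
have [a Ga af] := autF_hom Ff fP.
have /eqP {2}<- : a @: X == X by rewrite perm_imset_astabs (subsetP stX).
by apply: eq_in_imset => x Xx; rewrite af ?(subsetP sXP).
Qed.

End FusionSystems.

Section Transport.
Variables (gT : finGroupType) (S : {group gT}) (F : fsys gT).
Hypothesis fusF : is_fusion_system S F.
Implicit Types (P Q R X E : {group gT}) (f : {ffun gT -> gT}) (a b : {perm gT}).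

Lemma autF_transport_sub P Q f b : F P f -> Q :=: f @: P -> {in P, b =1 f} ->
  autF F P :^ b \subset autF F Q.
Proof.
move=> Ff defQ bf; have sPS := fsys_sub fusF Ff.
have [_ fM _ fPS] := fsys_hom fusF Ff.
have sQS: Q \subset S by rewrite defQ.
apply/subsetP=> _ /imsetP[a Ga ->].
have [Aa Fa] := andP (etrans (esym (mem_autF fusF a sPS)) Ga).
have abE x : x \in P -> (a ^ b) (f x) = f (a x).
  by move=> Px; rewrite -bf // conjgE !permM permK bf // Aut_closed.
rewrite (mem_autF fusF) //; apply/andP; split.
  rewrite inE; apply/andP; split.
    (* Elements of [Aut Q] must be the identity off [Q]; this holds for [a ^ b] because [b] carries
       the complement of [P] to that of [Q]. *)
    apply/subsetP=> y; rewrite inE; apply: contraR => nQy.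
    have nPb: b^-1 y \notin P.
      apply: contra nQy => Pb; rewrite defQ; apply/imsetP; exists (b^-1 y) => //.
      by rewrite -bf // permKV.
    by rewrite conjgE !permM (out_Aut Aa nPb) permKV.
  apply/morphicP=> x y; rewrite defQ => /imsetP[u Pu ->] /imsetP[v Pv ->].
  by rewrite -fM // !abE ?groupM // (autM Aa) // fM ?Aut_closed.
have [f' Ff' f'K] := fsys_inv fusF Ff defQ.
have f'Q: f' @: Q \subset P.
  by rewrite defQ; apply/subsetP=> _ /imsetP[_ /imsetP[x Px ->] ->]; rewrite f'K.
have F1 := fsys_comp fusF Ff' Fa f'Q.
apply: (fsys_eq fusF (fsys_comp fusF F1 Ff _)).
  apply/subsetP=> _ /imsetP[x Qx ->]; rewrite !ffunE Aut_closed //.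
  by rewrite (subsetP f'Q) ?imset_f.
move=> x; rewrite defQ => /imsetP[y Py ->].
by rewrite !ffunE f'K // abE.
Qed.

Lemma InnAut_transport P Q f b : F P f -> Q :=: f @: P -> {in P, b =1 f} ->
  InnAut P :^ b \subset InnAut Q.
Proof.
move=> Ff defQ bf; apply/subsetP=> _ /imsetP[_ /morphimP[x nPx Px ->] ->].
have [_ fM _ fPS] := fsys_hom fusF Ff.
have Qfx: f x \in Q by rewrite defQ imset_f.
have nQfx := subsetP (normG Q) _ Qfx.
apply/morphimP; exists (f x) => //.
apply: (@eq_Aut _ Q) => [||y]; [|exact: Aut_aut|].
  apply: (subsetP (autF_sub F Q)); apply: (subsetP (autF_transport_sub Ff defQ bf)).
  rewrite memJ_conjg (subsetP (normal_sub (InnAut_normal fusF (fsys_sub fusF Ff)))) //.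
  exact: mem_morphim.
move=> Qy; have: y \in f @: P by rewrite -defQ.
case/imsetP=> u Pu def_y.
rewrite /= [RHS]norm_conj_autE // def_y.
rewrite -bf // conjgE !permM permK norm_conj_autE // !bf ?groupJ //.
by rewrite -(fsys_morphismE fusF Ff) morphJ // !fsys_morphismE.
Qed.

Lemma autF_transport P Q f b : F P f -> Q :=: f @: P -> {in P, b =1 f} ->
  autF F P :^ b = autF F Q.
Proof.
move=> Ff defQ bf; apply/eqP; rewrite eqEsubset (autF_transport_sub Ff defQ) //=.
have [f' Ff' f'K] := fsys_inv fusF Ff defQ.
have defP: P :=: f' @: Q.
  rewrite defQ -imset_comp -[LHS](imset_id P).
  by apply: eq_in_imset => x Px /=; rewrite f'K.
rewrite -sub_conjgV (autF_transport_sub Ff' defP) // => y.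
rewrite defQ => /imsetP[x Px ->]; rewrite f'K // -bf // permK //.
Qed.

End Transport.

Section Saturation.
Variables (gT : finGroupType) (p : nat) (S : {group gT}) (F : fsys gT).
Hypothesis satF : saturated F S p.
Implicit Types (P Q R X E : {group gT}) (f : {ffun gT -> gT}) (a b : {perm gT}).

Let fusF : is_fusion_system S F := satF.1.

Lemma sat_centralized P : P \subset S -> fully_normalized F S P ->
  fully_centralized F S P.
Proof. by case: satF => _ [+ _] => /[apply] /[apply] -[]. Qed.

Lemma sat_Sylow P : P \subset S -> fully_normalized F S P ->
  p.-Sylow(autF F P) (AutS S P).
Proof.
case: satF => _ [sat1 _] sPS fnP; have [_] := sat1 P sPS fnP.
by rewrite (autFE fusF).
Qed.

(** The extension axiom speaks of a group equal to [Nphi S P f], so such a group has to be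
    exhibited. *)
Lemma Nphi_group_set P f : F P f -> group_set (Nphi S P f).
Proof.
move=> Ff; have [sPS fM _ _] := fsys_hom fusF Ff.
have [Q defQ] := fsys_image fusF Ff (subxx P).
apply/group_setP; rewrite /Nphi -defQ; split=> [|g1 g2].
  apply/setIdP; split; first exact: group1.
  apply/exists_inP; exists 1; first exact: group1.
  by apply/forall_inP=> x _; rewrite !conjg1.
case/setIdP=> N1 /exists_inP[h1 H1 /forall_inP e1].
case/setIdP=> N2 /exists_inP[h2 H2 /forall_inP e2].
apply/setIdP; split; first exact: groupM.
apply/exists_inP; exists (h1 * h2); first exact: groupM.
apply/forall_inP=> x Px; rewrite !conjgM (eqP (e2 _ _)) ?(eqP (e1 _ _)) //.
by rewrite memJ_norm //; case/setIP: N1.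
Qed.

Lemma sat_extend P Q X f : F P f -> Q :=: f @: P -> fully_normalized F S Q ->
    X \subset 'N_S(P) ->
    (forall x, x \in X ->
      exists2 h, h \in 'N_S(Q) & {in P, forall y, f (y ^ x) = f y ^ h}) ->
  exists2 f', F X f' & {in P, f' =1 f}.
Proof.
move=> Ff defQ fnQ sXN ext; have [_ [_ sat2]] := satF.
have [_ _ _ fPS] := fsys_hom fusF Ff.
have sQS: Q \subset S by rewrite defQ.
pose N := Group (Nphi_group_set Ff).
have [f' Ff' f'f] := sat2 P Q f Ff defQ (sat_centralized sQS fnQ) N erefl.
exists f' => //; apply: (fsys_res fusF Ff'); apply/subsetP=> x Xx.
apply/setIdP; split; first exact: subsetP sXN x Xx.
have [h Nh fh] := ext x Xx; apply/exists_inP; exists h; first by rewrite -defQ.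
by apply/forall_inP=> y Py; rewrite fh.
Qed.

Lemma fully_normalized_exists P : P \subset S ->
  exists f Q, [/\ F P f, Q :=: f @: P & fully_normalized F S Q].
Proof.
move=> sPS; have F1 := fsys_conj fusF sPS (group1 S).
pose m (f : {ffun gT -> gT}) := #|'N_S(f @: P)|.
have [f Ff max_f] := @arg_maxnP _ (conjf (1 : gT)) (F P) m F1.
have [Q defQ] := fsys_image fusF Ff (subxx P).
exists f, Q; split=> // g Fg.
have sfP : f @: P \subset Q by rewrite defQ.
have := max_f _ (fsys_comp fusF Ff Fg sfP); rewrite /m -defQ.
congr (#|'N_S(_)| <= _); rewrite defQ -imset_comp.
by apply: eq_imset => x; rewrite ffunE.
Qed.

Hypothesis pS : p.-group S.

Lemma AutS_pgroup P : p.-group (AutS S P).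
Proof. by rewrite morphim_pgroup // (pgroupS (subsetIl _ _) pS). Qed.

(** Through [f], [AutS S P] becomes a p-subgroup of the automizer of [Q], in which [AutS S Q] is
    Sylow. Following [f] by some [chi] conjugating it into [AutS S Q] makes the [Nphi] of the
    composite all of ['N_S(P)]. *)
Lemma normalizer_map P Q f : F P f -> Q :=: f @: P -> fully_normalized F S Q ->
  exists2 f', F 'N_S(P)%G f' & f' @: P = Q.
Proof.
move=> Ff defQ fnQ; have [sPS _ injf fPS] := fsys_hom fusF Ff.
have sQS: Q \subset S by rewrite defQ.
have [b bf] := inj_perm_ext injf.
have sylQ := sat_Sylow sQS fnQ.
pose B := conj_aut P @* 'N_S(P).
have sBQ: (B :^ b)%G \subset autF F Q.
  by rewrite -(autF_transport fusF Ff defQ bf) conjSg (AutS_sub fusF).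
have pB : p.-group (B :^ b)%G by rewrite pgroupJ AutS_pgroup.
have [chi Qchi sBchi] := Sylow_Jsub (P := (conj_aut Q @* 'N_S(Q))%G) sylQ sBQ pB.
have [Achi Fchi] := andP (etrans (esym (mem_autF fusF chi sQS)) Qchi).
have sfQ: f @: P \subset Q by rewrite defQ.
have Ff2 := fsys_comp fusF Ff Fchi sfQ.
set f2 := [ffun x => _] in Ff2.
have f2E: {in P, forall x, f2 x = (b * chi) x} by move=> x Px; rewrite !ffunE permM bf.
have defQ2: Q :=: f2 @: P.
  have /eqP <-: chi @: Q == Q.
    by rewrite perm_imset_astabs; apply/perm_astabsP=> x; apply: Aut_closed.
  by rewrite defQ -imset_comp; apply: eq_imset => x; rewrite !ffunE.
suffices ext x: x \in 'N_S(P) ->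
    exists2 h, h \in 'N_S(Q) & {in P, forall y, f2 (y ^ x) = f2 y ^ h}.
  have [f' Ff' f'f] := sat_extend Ff2 defQ2 fnQ (subxx 'N_S(P)) ext.
  by exists f' => //; rewrite defQ2; apply: eq_in_imset.
move=> Nx; have [Sx nPx] := setIP Nx.
have: (conj_aut P x ^ b) ^ chi \in AutS S Q.
  by rewrite (subsetP sBchi) // !memJ_conjg mem_morphim.
case/morphimP=> h nQh Nh def_h; exists h => // y Py.
have Pyx: y ^ x \in P by rewrite memJ_norm.
have Qf2y: f2 y \in Q by rewrite defQ2 imset_f.
rewrite -(norm_conj_autE nQh Qf2y) -[conj_aut Q h]def_h !f2E // -conjgM.
by rewrite conjgE !permM -!(permM b chi) permK norm_conj_autE.
Qed.

End Saturation.

(** * Essential subgroups *)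

(** An element of [G] commuting with an element of order p of [H] lies in [H]. From [h] in [H] this
    reaches in turn [z] in [K] central in [K <*> <[h]>], then [y] in ['Z(K)], then all of [K]; being
    normal, [K] also meets [H :^ g] in [y ^ g]. *)
Lemma strongly_p_embedded_Op (gT : finGroupType) p (G H K : {group gT}) :
  prime p -> strongly_p_embedded p G H -> K <| G -> p.-group K -> K :=: 1.
Proof.
move=> p_pr /and3P[/properP[sHG [g Gg nHg]] p_dv_H /forall_inP seH] /andP[sKG nKG] pK.
have TI x y : y \in G -> x \in H -> #[x] = p -> x ^ y = x -> y \in H.
  move=> Gy Hx ox xy; apply/negPn/negP=> nHy.
  have /negP[] := seH y (introT setDP (conj Gy nHy)).
  by rewrite -ox order_dvdG // inE Hx -xy memJ_conjg.
have cJ (x y : gT) : commute x y -> x ^ y = x by move=> /commgP/conjg_fixP.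
apply/eqP/negPn/negP=> ntK.
have [h Hh oh] := Cauchy p_pr p_dv_H; have Gh := subsetP sHG h Hh.
have nKh : <[h]> \subset 'N(K) by rewrite cycle_subG (subsetP nKG).
have pKh : p.-group (K <*> <[h]>).
  by rewrite norm_joinEr // pgroupM pK /pgroup -orderE oh pnat_id.
have nsK : K <| K <*> <[h]> by rewrite normalYl.
have ntKZ := meet_center_nil (pgroup_nil pKh) nsK ntK.
have pKZ : p.-group (K :&: 'Z(K <*> <[h]>)) := pgroupS (subsetIl _ _) pK.
have [_ p_dv_KZ _] := pgroup_pdiv pKZ ntKZ.
have [z /setIP[Kz /centerP[_ cz]] oz] := Cauchy p_pr p_dv_KZ.
have Hz : z \in H.
  apply: (TI h z _ Hh oh); first exact: subsetP sKG z Kz.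
  by apply/cJ/commute_sym/cz; rewrite mem_gen // inE cycle_id orbT.
have ntZ : 'Z(K) != 1 by rewrite center_nil_eq1 ?(pgroup_nil pK).
have [_ p_dv_Z _] := pgroup_pdiv (pgroupS (center_sub K) pK) ntZ.
have [y /centerP[Ky cy] oy] := Cauchy p_pr p_dv_Z.
have Hy : y \in H.
  apply: (TI z y _ Hz oz); first exact: subsetP sKG y Ky.
  exact/cJ/commute_sym/cy.
have sKH : K \subset H.
  apply/subsetP=> k Kk; apply: (TI y k _ Hy oy); first exact: subsetP sKG k Kk.
  exact/cJ/cy.
have /negP[] := seH g (introT setDP (conj Gg nHg)).
rewrite -oy -(orderJ y g) order_dvdG // inE memJ_conjg Hy andbT.
by rewrite (subsetP sKH) // memJ_norm // (subsetP nKG).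
Qed.

(* ['O_p(Out_F(E)) = 1], with the quotient by [InnAut E] unfolded. *)
Definition Op_inner (gT : finGroupType) (p : nat) (F : fsys gT) (E : {group gT}) :=
  forall K : {group {perm gT}}, K <| autF F E -> p.-group K -> K \subset InnAut E.

Section Essential.
Variables (gT : finGroupType) (p : nat) (S : {group gT}) (F : fsys gT).
Hypotheses (p_pr : prime p) (pS : p.-group S) (satF : saturated F S p).
Implicit Types (P Q R X E : {group gT}) (f : {ffun gT -> gT}) (a b : {perm gT}).

Let fusF : is_fusion_system S F := satF.1.

Lemma essential_Op_inner E : F_essential p F S E -> Op_inner p F E.
Proof.
case=> sES _ _ [H seH] K nsKA pK.
have /andP[_ nIA] := InnAut_normal fusF sES.
have seH' : strongly_p_embedded p (autF F E / InnAut E) H.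
  by rewrite /= (autFE fusF sES : <<_>> = _).
have K1 := strongly_p_embedded_Op p_pr seH' (quotient_normal _ nsKA) (quotient_pgroup _ pK).
have nIK := subset_trans (normal_sub nsKA) nIA.
by rewrite -(quotient_sub1 nIK) /= K1.
Qed.

(** Otherwise [InnAut E] would contain the Sylow subgroup [AutS S E], so the outer automizer would
    be a p'-group, leaving no room for a subgroup of order divisible by p. *)
Lemma essential_normalizer E : F_essential p F S E -> ~~ ('N_S(E) \subset E).
Proof.
case=> sES _ fnE [H /and3P[/proper_sub sHO p_dv_H _]]; apply/negP=> sNE.
have sylE := sat_Sylow satF sES fnE.
have sAI: AutS S E \subset InnAut E by rewrite morphimS.
have /andP[sIA nIA] := InnAut_normal fusF sES.
have p_dv_O: p %| #|autF F E / InnAut E|.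
  by apply: dvdn_trans p_dv_H _; rewrite cardSg //= (autFE fusF sES : <<_>> = _).
have: p^'.-nat #|autF F E / InnAut E|.
  rewrite card_quotient //; case/and3P: sylE => _ _.
  by apply: pnat_dvd; rewrite indexgS.
by move/pnatP => /(_ (cardG_gt0 _) p p_pr p_dv_O); rewrite !inE eqxx.
Qed.

Lemma Op_inner_transport P Q f : F P f -> Q :=: f @: P ->
  Op_inner p F P -> Op_inner p F Q.
Proof.
move=> Ff defQ opP K nsKQ pK; have [_ _ injf _] := fsys_hom fusF Ff.
have [b bf] := inj_perm_ext injf.
apply: subset_trans (InnAut_transport fusF Ff defQ bf).
rewrite -sub_conjgV; apply: (opP (K :^ b^-1)%G); last by rewrite pgroupJ.
by rewrite -(normalJ _ _ b) conjsgKV (autF_transport fusF Ff defQ bf).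
Qed.

(* The automorphisms in [autF F E] that centralize [X1] and [X2 / X1] form a
   normal subgroup, which is a p-group. *)
Lemma chain_stabilizer E X1 X2 n :
    E \subset S -> 'C_S(E) \subset E -> Op_inner p F E ->
    X1 \subset X2 -> X2 \subset E -> p'_faithful p E X2 ->
    autF F E \subset 'N(X1 | 'P) -> autF F E \subset 'N(X2 | 'P) ->
    n \in 'N_S(E) -> n \in 'C(X1) -> {in X2, forall x, [~ x, n] \in X1} ->
  n \in E.
Proof.
move=> sES cEE opE sX12 sX2E faX2 st1 st2 Nn cX1n cX2n.
have pE := pgroupS sES pS; have sAA := autF_sub F E.
pose K := [set a in autF F E | [forall x in X1, a x == x] &&
                               [forall x in X2, x^-1 * a x \in X1]].
have KP a : reflect [/\ a \in autF F E, {in X1, forall x, a x = x}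
                      & {in X2, forall x, x^-1 * a x \in X1}] (a \in K).
  apply: (iffP setIdP) => [[Ga /andP[/forall_inP h1 /forall_inP h2]] | [Ga h1 h2]].
    by split=> // x Xx; apply/eqP/h1.
  by split=> //; apply/andP; split; apply/forall_inP=> x Xx; [apply/eqP/h1 | apply: h2].
have gK : group_set K.
  apply/group_setP; split.
    by apply/KP; split=> [|x _|x _]; rewrite ?group1 ?perm1 ?mulVg.
  move=> a b /KP[Ga a1 a2] /KP[Gb b1 b2]; apply/KP; split; first exact: groupM.
    by move=> x Xx; rewrite permM a1 // b1.
  move=> x Xx; have Xax := perm_astabsP _ _ (subsetP st2 a Ga) x Xx.
  by rewrite permM -(mulKVg (a x) (b _)) mulgA groupM ?a2 ?b2.
pose KG := Group gK.
have nsK : KG <| autF F E.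
  apply/andP; split; first by apply/subsetP=> a /KP[].
  apply/subsetP=> b Gb; rewrite inE; apply/subsetP=> _ /imsetP[a /KP[Ga a1 a2] ->].
  have Gb' : b^-1 \in autF F E by rewrite groupV.
  apply/KP; split; first by rewrite groupJ.
    move=> x Xx; rewrite conjgE !permM a1 ?permKV //.
    exact: perm_astabsP (subsetP st1 _ Gb') x Xx.
  move=> x Xx; have Xb'x := perm_astabsP _ _ (subsetP st2 _ Gb') x Xx.
  rewrite conjgE !permM -{1}(permKV b x); set y := b^-1 x in Xb'x *.
  have Ab := subsetP sAA b Gb; have Ey := subsetP sX2E y Xb'x.
  have Eay : a y \in E by rewrite Aut_closed ?(subsetP sAA).
  rewrite -(autV Ab) // -(autM Ab) ?groupV //.
  by apply: (perm_astabsP _ _ (subsetP st1 b Gb)); apply: a2.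
have pK : p.-group KG.
  apply/pgroupP=> q q_pr /(Cauchy q_pr)[a /KP[Ga a1 a2] oa].
  have Aa := subsetP sAA a Ga; apply/negPn/negP=> /= npq.
  have p'a : p^'.-elt a by rewrite /p_elt oa pnatE.
  have fixX2 : {in X2, forall x, a x = x}.
    move=> x Xx; apply: (p'_aut_stab pE Aa p'a); first exact: subsetP sX2E x Xx.
    by rewrite a1 // a2.
  have a_1 : a = 1.
    by apply: (eq_Aut Aa (group1 _)) => x Ex; rewrite perm1 (faX2 a).
  by rewrite -oa a_1 order1 in q_pr.
have [Sn nEn] := setIP Nn.
have Kn : conj_aut E n \in KG.
  apply/KP; split; first exact: (autF_conj fusF).
    move=> x Xx; have Ex := subsetP sX2E x (subsetP sX12 x Xx).
    by rewrite norm_conj_autE //; apply/conjg_fixP/commgP/commute_sym/(centP cX1n).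
  move=> x Xx; rewrite norm_conj_autE ?(subsetP sX2E) //.
  by rewrite -commgEl cX2n.
(* [n] and some [e] in [E] induce the same automorphism of [E], so [n * e^-1] centralizes [E]. *)
have /morphimP[e nEe Ee def_n] := subsetP (opE KG nsK pK) _ Kn.
have Ene : n * e^-1 \in E.
  apply: (subsetP cEE); rewrite inE groupM ?groupV ?(subsetP sES e) //=.
  rewrite -ker_conj_aut; apply/kerP; first by rewrite groupM ?groupV.
  by rewrite morphM ?groupV // morphV //= def_n mulgV.
by move: Ene; rewrite groupMr ?groupV.
Qed.

End Essential.

(* The part of being essential that the argument needs: it passes to F-conjugates
   ([essential_like_image]) without transporting strongly p-embedded subgroups. *)
Definition essential_like (gT : finGroupType) (p : nat) (F : fsys gT)
    (S E : {group gT}) :=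
  [/\ E \subset S, 'C_S(E) \subset E, fully_normalized F S E,
      Op_inner p F E & ~~ ('N_S(E) \subset E)].

(** * Choice of a maximal subgroup whose morphisms move the center *)

Section Reduction.
Variables (gT : finGroupType) (p : nat) (S : {group gT}) (F : fsys gT).
Hypotheses (p_pr : prime p) (pS : p.-group S) (satF : saturated F S p).
Implicit Types (P Q R X E : {group gT}) (f g : {ffun gT -> gT}) (a b : {perm gT}).

Let fusF : is_fusion_system S F := satF.1.
Local Notation Z := 'Ohm_1('Z(S)).

Lemma Ohm1Z_sub : Z \subset S.
Proof. exact: subset_trans (Ohm_sub 1 _) (center_sub S). Qed.

Lemma Ohm1Z_fix f : F S f -> f @: Z = Z.
Proof.
move=> Ff; have [_ _ _ fS] := fsys_hom fusF Ff.
apply: ((stable_normalized fusF (subxx S) Ohm1Z_sub).2 _ f Ff fS).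
apply/subsetP=> a /(subsetP (autF_sub F S)).
by apply: Aut_char_astabs; rewrite (char_trans (Ohm_char 1 _)) ?center_char.
Qed.

Lemma imset_fcomp f g (X : {set gT}) : [ffun x => g (f x)] @: X = g @: (f @: X).
Proof. by rewrite -imset_comp; apply: eq_imset => x; rewrite ffunE. Qed.

Lemma imset_cancel f g (X : {set gT}) : {in X, forall x, g (f x) = x} ->
  g @: (f @: X) = X.
Proof.
by move=> gK; rewrite -imset_comp -[RHS]imset_id; apply: eq_in_imset.
Qed.

(** Full normalization bounds the normalizer of [f(E)] by that of [E], so [f] maps one onto the
    other; the rest is transported by conjugating automizers along [f]. *)
Lemma essential_like_image E X f : essential_like p F S E ->
    F 'N_S(E)%G f -> f @: Z = Z ->
    Z \subset X -> X \subset 'Z('N_S(E)) -> autF F E \subset 'N(X | 'P) ->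
  exists E' X', [/\ essential_like p F S E', f @: 'N_S(E) = 'N_S(E'),
    Z \subset X', X' \subset 'Z('N_S(E')) & autF F E' \subset 'N(X' | 'P)].
Proof.
case=> sES cEE fnE opE nNE Ff fZ sZX sXZ stX.
have nsEN : E <| 'N_S(E) by rewrite normalSG.
have sEN := normal_sub nsEN.
have sXN : X \subset 'N_S(E) := subset_trans sXZ (center_sub _).
have sZNE : 'Z('N_S(E)) \subset 'Z(E).
  rewrite subsetI (subset_trans _ (centS sEN)) ?subsetIr // andbT.
  apply: subset_trans cEE; rewrite subsetI (subset_trans (center_sub _)) ?subsetIl //=.
  by rewrite (subset_trans _ (centS sEN)) ?subsetIr.
have sXE : X \subset E := subset_trans sXZ (subset_trans sZNE (center_sub E)).
pose m := fsys_morphism fusF Ff.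
have fE (Y : {group gT}) : Y \subset 'N_S(E) -> f @: Y = m @* Y.
  by move=> sYN; rewrite (fsys_imset fusF Ff).
have injm := fsys_injm fusF Ff.
pose E' := (m @* E)%G; pose X' := (m @* X)%G.
have FfE := fsys_res fusF Ff sEN.
have defX' : X' :=: f @: X by rewrite fE.
have defE' : E' :=: f @: E by rewrite fE.
have sfN : f @: 'N_S(E) \subset S by have [] := fsys_hom fusF Ff.
have sE'S : E' \subset S by rewrite defE' (subset_trans _ sfN) ?imsetS.
have defN : f @: 'N_S(E) = 'N_S(E').
  apply/eqP; rewrite eqEcard subsetI sfN (fE 'N_S(E)%G) //=.
  rewrite morphim_norms ?subsetIr // card_injm //.
  by rewrite (defE' : m @* E = _) fnE.
have defN' : m @* 'N_S(E) = 'N_S(E') by rewrite -defN (fE 'N_S(E)%G).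
exists E', X'; split=> //.
- split=> //.
  (* Full centralization: ['C_S(E')] is no larger than ['C_S(E) = 'Z(E)], which has the order of
     ['Z(E')]. *)
  + suffices <- : 'Z(E') = 'C_S(E') by apply: center_sub.
    apply/eqP; rewrite eqEcard setSI //=.
    rewrite -injm_center // card_injm ?(subset_trans (center_sub E)) //.
    rewrite (defE' : m @* E = _); apply: leq_trans (sat_centralized satF sES fnE FfE) _.
    by rewrite subset_leq_card // subsetI cEE subsetIr.
  + move=> g Fg; have sfE : f @: E \subset E' by rewrite defE'.
    have := fnE _ (fsys_comp fusF FfE Fg sfE).
    by rewrite imset_fcomp -defE' -defN' card_injm.
  + exact: (Op_inner_transport satF FfE defE' opE).
  rewrite -defN'; apply: contra nNE => /subset_leq_card.
  rewrite !card_injm // => leNE.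
  by have /eqP <- : E :==: 'N_S(E) by rewrite eqEcard sEN.
- by rewrite -fZ defX' imsetS.
- by rewrite -defN' -injm_center // morphimS.
have [_ _ injf _] := fsys_hom fusF FfE.
have [b bf] := inj_perm_ext injf.
rewrite -(autF_transport fusF FfE defE' bf); apply/subsetP=> _ /imsetP[a Ga ->].
have X'E x : x \in X -> f x \in X' by move=> Xx; rewrite defX' imset_f.
apply/perm_astabsP=> y; rewrite {1}defX' => /imsetP[x Xx ->].
have Xax := perm_astabsP _ _ (subsetP stX a Ga) x Xx.
rewrite -bf ?(subsetP sXE) // conjgE !permM permK bf ?(subsetP sXE) //.
by rewrite X'E.
Qed.

(** Maximality is taken over subgroups [R] that receive an F-image of [N] fixing [Z] and carry an
    F-morphism, not necessarily an automorphism, moving [Z]. Passing to a fully normalized conjugate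
    [Q] of [R] turns that morphism into an automorphism of [Q]. *)
Lemma maximal_mover E X : essential_like p F S E ->
    Z \subset X -> X \subset 'Z('N_S(E)) -> autF F E \subset 'N(X | 'P) ->
    ~~ (autF F 'N_S(E) \subset 'N(Z | 'P)) ->
  exists E' X' Q, [/\ essential_like p F S E', Z \subset X',
      X' \subset 'Z('N_S(E')) & autF F E' \subset 'N(X' | 'P)] /\
    [/\ 'N_S(E') \subset Q, Q \subset S, fully_normalized F S Q,
        ~~ (autF F Q \subset 'N(Z | 'P))
      & forall R f, R \subset S -> F R f -> #|Q| < #|R| -> 'N_S(E') \subset R ->
        f @: Z = Z].
Proof.
move=> essE sZX sXZ stX /subsetPn[a0 Ga0 nZa0].
pose N := 'N_S(E)%G; have sNS : N \subset S by apply: subsetIl.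
have sZN : Z \subset N := subset_trans sZX (subset_trans sXZ (center_sub _)).
pose Mv R := [&& R \subset S,
  [exists f : {ffun gT -> gT}, [&& F N f, f @: Z == Z & f @: N \subset R]] &
  [exists f : {ffun gT -> gT}, F R f && (f @: Z != Z)]].
have MvP R f g : R \subset S -> F N f -> f @: Z = Z -> f @: N \subset R ->
    F R g -> g @: Z <> Z -> Mv R.
  move=> sRS Ff fZ fN Fg gZ; apply/and3P; split=> //; apply/existsP.
    by exists f; rewrite Ff fZ eqxx.
  by exists g; rewrite Fg; apply/eqP.
have MvN : Mv N.
  have /andP[Aa0 Fa0] := etrans (esym (mem_autF fusF a0 sNS)) Ga0.
  have cj1 (Y : {set gT}) : conjf (1 : gT) @: Y = Y.
    by rewrite -[RHS]imset_id; apply: eq_imset => x; rewrite ffunE conjg1.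
  apply: (MvP N (conjf 1) [ffun x => a0 x]); rewrite ?cj1 //.
    exact: fsys_conj fusF _ _ _ (group1 S).
  move=> a0Z; case/negP: nZa0; rewrite -perm_imset_astabs -{2}a0Z.
  by apply/eqP/eq_imset => x; rewrite ffunE.
case: (@arg_maxnP _ N Mv (fun R : {group gT} => #|R|) MvN) => R.
case/and3P=> sRS /existsP[be /and3P[Fbe /eqP beZ beN]] /existsP[phi /andP[Fphi /eqP phiZ]] maxR.
have sZR : Z \subset R by rewrite -beZ (subset_trans _ beN) ?imsetS.
have ltRS : R \proper S.
  rewrite properEneq sRS andbT; apply/eqP=> defR; case: phiZ.
  by apply: Ohm1Z_fix; rewrite -(val_inj defR : R = S).
have [th [Q [Fth defQ fnQ]]] := fully_normalized_exists satF sRS.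
have sQS : Q \subset S by rewrite defQ; have [] := fsys_hom fusF Fth.
have [psi Fpsi psiR] := normalizer_map satF pS Fth defQ fnQ.
have [R' defR'] := fsys_image fusF Fphi (subxx R).
have sR'S : R' \subset S by rewrite defR'; have [] := fsys_hom fusF Fphi.
have [phi' Fphi' phi'K] := fsys_inv fusF Fphi defR'.
have sphi'R : phi' @: R' \subset R by rewrite defR' (imset_cancel phi'K).
have Fth' := fsys_comp fusF Fphi' Fth sphi'R.
have defQ' : Q :=: [ffun x => th (phi' x)] @: R'.
  by rewrite imset_fcomp defR' (imset_cancel phi'K).
have [chi Fchi chiR'] := normalizer_map satF pS Fth' defQ' fnQ.
have oR' : #|R'| = #|R| by rewrite defR' (fsys_card fusF Fphi).
have ltR'S : R' \proper S by rewrite properEcard sR'S oR' proper_card.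
have ltN P : P \proper S -> #|P| < #|'N_S(P)|.
  by move=> ltP; apply/proper_card/nilpotent_proper_norm => //; apply: pgroup_nil pS.
have sRN : R \subset 'N_S(R) by rewrite subsetI sRS normG.
have sR'N : R' \subset 'N_S(R') by rewrite subsetI sR'S normG.
(* ['N_S(R)] is larger than [R] and still receives [N], so by maximality its morphisms fix [Z]. *)
have psiZ : psi @: Z = Z.
  apply/eqP/negPn/negP=> /eqP npsi.
  have /maxR /= : Mv 'N_S(R)%G.
    apply: MvP Fbe beZ _ Fpsi npsi; first exact: subsetIl.
    exact: subset_trans beN sRN.
  by rewrite leqNgt ltN.
have sphiR' : phi @: R \subset R' by rewrite defR'.
have Fchi_R' := fsys_res fusF Fchi sR'N.
have Fcp := fsys_comp fusF Fphi Fchi_R' sphiR'.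
set cp := [ffun x => _] in Fcp.
have cpR : cp @: R = Q by rewrite imset_fcomp -defR' chiR'.
(* If [cp] fixed [Z], the inverse of [chi] would send [Z] to [phi @: Z]; it is defined on the image
   of ['N_S(R')], which is larger than [R]. *)
have [cpZ | ncpZ] := eqVneq (cp @: Z) Z.
  have [R2 defR2] := fsys_image fusF Fchi (subxx 'N_S(R')).
  have [chi' Fchi' chi'K] := fsys_inv fusF Fchi defR2.
  have sR2S : R2 \subset S by rewrite defR2; have [] := fsys_hom fusF Fchi.
  have /maxR /= : Mv R2.
    apply: (MvP R2 [ffun x => cp (be x)] chi') => //.
    - exact: (fsys_comp fusF Fbe Fcp beN).
    - by rewrite imset_fcomp beZ cpZ.
    - rewrite imset_fcomp (subset_trans (imsetS _ beN)) // cpR -chiR' defR2.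
      exact: imsetS.
    suffices -> : chi' @: Z = phi @: Z by [].
    rewrite -{1}cpZ imset_fcomp; apply: imset_cancel => _ /imsetP[z Zz ->].
    by apply: chi'K; apply: (subsetP sR'N); rewrite defR' imset_f ?(subsetP sZR).
  by rewrite leqNgt defR2 (fsys_card fusF Fchi) // -oR' ltN.
have FpsiR := fsys_res fusF Fpsi sRN.
have [psi' Fpsi' psi'K] := fsys_inv fusF FpsiR (esym psiR).
have psi'Q : psi' @: Q = R by rewrite -psiR (imset_cancel psi'K).
have spsi'Q : psi' @: Q \subset R by rewrite psi'Q.
(* [psi] and [cp] both map [R] onto [Q], but only [cp] moves [Z]: back along [psi] and forth along
   [cp] is the required automorphism of [Q]. *)
have Fg := fsys_comp fusF Fpsi' Fcp spsi'Q.
have gQ : [ffun x => cp (psi' x)] @: Q \subset Q by rewrite imset_fcomp psi'Q cpR.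
have [a Ga aE] := autF_hom fusF Fg gQ.
have sZQ : Z \subset Q by rewrite -psiZ -psiR imsetS.
have Fbe' := fsys_comp fusF Fbe FpsiR beN.
set be' := [ffun x => _] in Fbe'.
have be'Z : be' @: Z = Z by rewrite imset_fcomp beZ.
have be'N : be' @: N \subset Q by rewrite imset_fcomp -psiR imsetS.
have [E' [X' [essE' defN' sZX' sX'Z stX']]] :=
  essential_like_image essE Fbe' be'Z sZX sXZ stX.
exists E', X', Q; split=> //; split=> //.
- by rewrite -defN'.
- apply/subsetPn; exists a => //; rewrite -perm_imset_astabs.
  have -> : a @: Z = cp @: (psi' @: Z).
    rewrite -imset_fcomp; apply: eq_in_imset => x Zx.
    by rewrite aE ?(subsetP sZQ).
  suffices -> : psi' @: Z = Z by [].
  rewrite -{1}psiZ; apply: imset_cancel => x Zx.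
  by apply: psi'K; apply: (subsetP sZR).
move=> P f sPS Ff ltQP sNP; apply/eqP/negPn/negP=> /eqP nfZ.
have /maxR /= : Mv P by apply: MvP Fbe' be'Z _ Ff nfZ; rewrite // /N defN'.
have <- : #|Q| = #|R| by rewrite -psiR (fsys_card fusF Fpsi).
by rewrite leqNgt ltQP.
Qed.

End Reduction.

(** * Rank three, the Frattini argument and invariant chains *)

Section RankThree.
Variables (gT : finGroupType) (p : nat) (S : {group gT}).
Hypotheses (p_pr : prime p) (odd_p : odd p) (pS : p.-group S).
Hypothesis rkS : forall Q : {group gT}, Q \subset S -> 'm(Q) <= 3.
Implicit Types (P J : {group gT}).

Lemma Ohm1_cent_rank3 P J : P \subset S -> J \subset P -> p.-abelem J ->
  #|J| = (p ^ 3)%N -> 'Ohm_1('C_P(J)) \subset J.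
Proof.
move=> sPS sJP abJ oJ; have pP := pgroupS sPS pS.
rewrite (OhmE 1 (pgroupS (subsetIl P _) pP)) gen_subG expn1.
apply/subsetP=> x; rewrite inE => /andP[/setIP[Px cJx]]; rewrite inE => xp1.
have px : p.-elt x := mem_p_elt pP Px.
have abx : p.-abelem <[x]> by rewrite cycle_abelem ?px // order_dvdn.
have cJX : <[x]> \subset 'C(J) by rewrite cycle_subG.
have abJx : p.-abelem (J <*> <[x]>).
  by rewrite (cprod_abelem p (cprodEY cJX)) abJ.
have sJxS : J <*> <[x]> \subset S.
  by rewrite join_subG cycle_subG (subset_trans sJP) ?(subsetP sPS).
have /eqP -> : J :==: J <*> <[x]>.
  by rewrite eqEcard joing_subl oJ (abelem_card p_pr rkS).
by rewrite mem_gen // inE cycle_id orbT.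
Qed.

Lemma p'_faithful_rank3 P J : P \subset S -> J <| P -> p.-abelem J ->
  #|J| = (p ^ 3)%N -> p'_faithful p P J.
Proof.
move=> sPS nsJP abJ oJ; apply: p'_faithful_normal => //.
- exact: pgroupS pS.
- exact: abelem_abelian abJ.
by apply: Ohm1_cent_rank3 => //; apply: normal_sub.
Qed.

End RankThree.

Section Frattini.
Variables (gT : finGroupType) (p : nat) (S : {group gT}) (F : fsys gT).
Hypotheses (pS : p.-group S) (satF : saturated F S p).
Implicit Types (P Q : {group gT}).
Let fusF : is_fusion_system S F := satF.1.

(** Frattini argument for [K = 'C_A(V | 'P)]. Elements of [K] fix [Z] pointwise; an element of [A]
    normalizing the Sylow subgroup [K :&: AutS S P] of [K] extends by saturation to the centralizer
    of [V] in ['N_S(P)], where the hypothesis applies. *)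
Lemma frattini_stable P (V Z : {set gT}) : P \subset S -> fully_normalized F S P ->
    V \subset P -> autF F P \subset 'N(V | 'P) -> Z \subset V ->
    (forall a f, a \in autF F P -> F ('C_('N_S(P))(V))%G f -> {in P, f =1 a} ->
       f @: Z = Z) ->
  autF F P \subset 'N(Z | 'P).
Proof.
move=> sPS fnP sVP stV sZV ext; set A := autF F P.
pose K := ('C_A(V | 'P))%G.
have nsKA : K <| A.
  have /andP[_ nCN] := astab_normal 'P V.
  by rewrite /normal subsetIl normsI ?normG // (subset_trans stV).
have sylP := sat_Sylow satF sPS fnP.
have sylK := Sylow_setI_normal (P := (conj_aut P @* 'N_S(P))%G) nsKA sylP.
rewrite -/A -(Frattini_arg nsKA sylK) mul_subG //.
  apply/subsetP=> a /setIP[_ /astabP fixV]; apply/perm_astabsP=> x Zx.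
  by have := fixV x (subsetP sZV x Zx); rewrite /= /aperm => ->.
apply/subsetP=> a /setIP[Aa nKa].
have [Auta Fa] := andP (etrans (esym (mem_autF fusF a sPS)) Aa).
pose f0 := [ffun x => a x].
have defP : P :=: f0 @: P.
  have : a @: P == P by rewrite perm_imset_astabs; apply/perm_astabsP=> x; apply: Aut_closed.
  by move/eqP=> {1}<-; apply: eq_imset => x; rewrite ffunE.
suffices ext0 x : x \in 'C_('N_S(P))(V) ->
    exists2 h, h \in 'N_S(P) & {in P, forall y, f0 (y ^ x) = f0 y ^ h}.
  have [f Ff fE] := sat_extend (X := ('C_('N_S(P))(V))%G) satF Fa defP fnP (subsetIl _ _) ext0.
  rewrite -perm_imset_astabs; apply/eqP; rewrite -[RHS](ext a f Aa Ff).
    by apply: eq_in_imset => x Zx; rewrite fE ?ffunE // (subsetP sVP) ?(subsetP sZV).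
  by move=> x Px; rewrite fE // ffunE.
case/setIP=> Nx cVx; have [Sx nPx] := setIP Nx.
have Kx : conj_aut P x \in K :&: (conj_aut P @* 'N_S(P))%G.
  rewrite inE mem_morphim // andbT inE (autF_conj fusF) //=.
  apply/astabP=> v Vv; rewrite /= /aperm norm_conj_autE ?(subsetP sVP) //.
  exact/conjg_fixP/commgP/commute_sym/(centP cVx).
have /setIP[_ /morphimP[h nPh Nh def_h]] : conj_aut P x ^ a \in K :&: (conj_aut P @* 'N_S(P))%G.
  by rewrite memJ_norm.
exists h => // y Py.
rewrite !ffunE -(norm_conj_autE nPh) ?Aut_closed // -[conj_aut P h]def_h.
by rewrite conjgE !permM permK norm_conj_autE.
Qed.

End Frattini.

Section EssentialRankThree.
Variables (gT : finGroupType) (p : nat) (S : {group gT}) (F : fsys gT).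
Hypotheses (p_pr : prime p) (odd_p : odd p) (pS : p.-group S) (satF : saturated F S p).
Hypothesis rkS : forall Q : {group gT}, Q \subset S -> 'm(Q) <= 3.
Variable E : {group gT}.
Hypothesis essE : essential_like p F S E.
Implicit Types (P R J X Y V : {group gT}) (f : {ffun gT -> gT}) (a b : {perm gT}).

Let fusF : is_fusion_system S F := satF.1.
Local Notation N := 'N_S(E).

Lemma ess_sub : E \subset S. Proof. by case: essE. Qed.

Lemma ess_sub_normalizer : E \subset N.
Proof. by rewrite subsetI ess_sub normG. Qed.

Lemma ess_center_normalizer : 'Z(N) \subset 'Z(E).
Proof.
have [_ cEE _ _ _] := essE; have sEN := ess_sub_normalizer.
have sZC : 'Z(N) \subset 'C(E) by rewrite (subset_trans (subsetIr _ _)) ?centS.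
rewrite subsetI sZC andbT (subset_trans _ cEE) // subsetI sZC.
by rewrite (subset_trans (center_sub _)) ?subsetIl.
Qed.

Lemma autF_char_stable P X : X \char P -> autF F P \subset 'N(X | 'P).
Proof.
by move=> chX; apply/subsetP=> a /(subsetP (autF_sub F P)); apply: Aut_char_astabs.
Qed.

Lemma ess_chain X1 X2 n :
    X1 \subset X2 -> X2 \subset E -> p'_faithful p E X2 ->
    autF F E \subset 'N(X1 | 'P) -> autF F E \subset 'N(X2 | 'P) ->
    n \in N -> n \in 'C(X1) -> {in X2, forall x, [~ x, n] \in X1} ->
  n \in E.
Proof. by case: essE => sES cEE _ opE _; exact: chain_stabilizer. Qed.

Lemma ess_chain_contra X1 X2 :
    X1 \subset X2 -> X2 \subset E -> p'_faithful p E X2 ->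
    autF F E \subset 'N(X1 | 'P) -> autF F E \subset 'N(X2 | 'P) ->
    N \subset 'C(X1) -> [~: X2, N] \subset X1 -> False.
Proof.
move=> sX12 sX2E fa st1 st2 cX1 cX2; have [_ _ _ _ /subsetPn[n Nn /negP[]]] := essE.
apply: (ess_chain sX12) => //; first exact: subsetP cX1 n Nn.
by move=> x Xx; rewrite (subsetP cX2) // mem_commg.
Qed.


(** Every element of order p of [E] centralizes [J], hence lies in [J] by the rank bound; so [J] is
    characteristic. *)
Lemma ess_rank3_center J : p.-abelem J -> #|J| = (p ^ 3)%N -> J \subset 'Z(E) ->
  [/\ 'Ohm_1(E) = J, J <| E, autF F E \subset 'N(J | 'P) & p'_faithful p E J].
Proof.
move=> abJ oJ sJZ; have sES := ess_sub; have pE := pgroupS sES pS.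
have sJE : J \subset E := subset_trans sJZ (center_sub E).
have nsJ : J <| E := sub_center_normal sJZ.
have cJ : 'C_E(J) = E.
  by apply/setIidPl; rewrite centsC (subset_trans sJZ) ?subsetIr.
have defJ : 'Ohm_1(E) = J.
  apply/eqP; rewrite eqEsubset -{1}cJ (Ohm1_cent_rank3 p_pr pS rkS) //=.
  by rewrite -(Ohm1_id abJ) OhmS.
split=> //; last exact: (p'_faithful_rank3 p_pr odd_p pS rkS).
by rewrite -defJ; apply: autF_char_stable; apply: Ohm_char.
Qed.

(** A [J] of order p^3 would be ['Ohm_1(E)], and [N], which centralizes it, would stabilize the
    constant chain [J <= J]. *)
Lemma ess_no_central_rank3 J : p.-abelem J -> J \subset 'Z(N) -> #|J| <= p ^ 2.
Proof.
move=> abJ sJZ; rewrite leqNgt; apply/negP=> ltJ.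
have sJZE := subset_trans sJZ ess_center_normalizer.
have sJE := subset_trans sJZE (center_sub E).
have oJ : #|J| = (p ^ 3)%N.
  apply/eqP; rewrite eqn_leq (abelem_card p_pr rkS) ?(subset_trans sJE) ?ess_sub //=.
  by rewrite dvdn_leq // (pgroup_index_dvd p_pr (abelem_pgroup abJ)).
have [_ _ stJ faJ] := ess_rank3_center abJ oJ sJZE.
have cJN : N \subset 'C(J) by rewrite centsC (subset_trans sJZ) ?subsetIr.
apply: (@ess_chain_contra J J) => //.
by have /commG1P -> := etrans (centsC J N) cJN; apply: sub1G.
Qed.

Lemma ess_no_plane_Ohm1 Y : Y \subset 'Z(N) -> 'Ohm_1(E) <> Y.
Proof.
move=> sYZ O1; have sYZE := subset_trans sYZ ess_center_normalizer.
have cYN : N \subset 'C(Y) by rewrite centsC (subset_trans sYZ) ?subsetIr.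
have nsY : Y <| E := sub_center_normal sYZE.
have stY : autF F E \subset 'N(Y | 'P).
  by rewrite -O1; apply: autF_char_stable; apply: Ohm_char.
have faY : p'_faithful p E Y.
  apply: (p'_faithful_normal p_pr odd_p (pgroupS ess_sub pS) nsY).
    exact: abelianS sYZE (center_abelian E).
  by rewrite -O1 OhmS ?subsetIl.
apply: (@ess_chain_contra Y Y) => //; first exact: normal_sub.
by have /commG1P -> := etrans (centsC Y N) cYN; apply: sub1G.
Qed.

Lemma ess_chain_rank3 Y J n : Y \subset J -> J <| E -> p.-abelem J ->
    #|J| = (p ^ 3)%N -> #|J : Y| = p -> Y <| N ->
    autF F E \subset 'N(Y | 'P) -> autF F E \subset 'N(J | 'P) ->
    n \in N -> n \in 'C(Y) -> n \in E.
Proof.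
move=> sYJ nsJE abJ oJ iYJ nsYN stY stJ Nn cYn.
have sES := ess_sub; have sJE := normal_sub nsJE.
have pN : p.-group N := pgroupS (subsetIl _ _) pS.
have nsJN : J <| N.
  rewrite /normal (subset_trans sJE ess_sub_normalizer).
  by apply/subsetP=> x; apply: (autF_stable_conj fusF sES).
have RJ := index_p_comm p_pr pN nsYN nsJN sYJ iYJ.
apply: (ess_chain sYJ sJE) => //; first exact: (p'_faithful_rank3 p_pr odd_p pS rkS).
by move=> x Jx; rewrite (subsetP RJ) // mem_commg.
Qed.

(** Take a maximal normal elementary abelian [J >= Y] of [E]. If [J = Y], the constant chain at [Y]
    suffices; otherwise [J] has order p^3, irreducibility of [Y] makes it invariant, and ['C_N(Y)]
    stabilizes [Y < J]. *)
Lemma ess_irr_plane Y : Y \subset 'Z(E) -> p.-abelem Y -> #|Y| = (p ^ 2)%N ->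
    autF F E \subset 'N(Y | 'P) ->
    (forall X, X \subset Y -> #|X| = p -> ~ autF F E \subset 'N(X | 'P)) ->
  'C_N(Y) = E.
Proof.
move=> sYZ abY oY stY irr; have sES := ess_sub; have pE := pgroupS sES pS.
have sYE := subset_trans sYZ (center_sub E).
have cYE : E \subset 'C(Y) by rewrite centsC (subset_trans sYZ) ?subsetIr.
have nsYE : Y <| E := sub_center_normal sYZ.
have nsYN : Y <| N.
  rewrite /normal (subset_trans sYE ess_sub_normalizer).
  by apply/subsetP=> x; apply: (autF_stable_conj fusF sES).
apply/eqP; rewrite eqEsubset subsetI ess_sub_normalizer cYE !andbT.
apply/subsetP=> n /setIP[Nn cYn].
have [J maxJ sYJ] := @maxgroup_exists _ [pred Z : {group gT} | (Z <| E) && p.-abelem Z] Y (introT andP (conj nsYE abY)).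
have O1J := Ohm1_cent_max_normal_abelem odd_p pE maxJ.
have /andP[nsJE abJ] := maxgroupp maxJ; have sJE := normal_sub nsJE.
have [defY | neqYJ] := eqVneq (Y : {set gT}) J.
  have faY : p'_faithful p E Y.
    apply: (p'_faithful_normal p_pr odd_p pE nsYE (abelem_abelian abY)).
    by rewrite defY O1J.
  apply: (@ess_chain Y Y) => // x Yx.
  by have /commgP/eqP -> : commute x n := commute_sym (centP cYn x Yx); apply: group1.
have oJ : #|J| = (p ^ 3)%N.
  apply/eqP; rewrite eqn_leq (abelem_card p_pr rkS) ?(subset_trans sJE) //=.
  rewrite dvdn_leq // (pgroup_index_dvd p_pr (abelem_pgroup abJ)) // -oY.
  by rewrite proper_card // properEneq neqYJ.
have stJ : autF F E \subset 'N(J | 'P).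
  by apply: (orbit_span_irr p_pr odd_p pS rkS (P := E) (Y := Y)) => //; apply: autF_sub.
apply: (ess_chain_rank3 sYJ) => //.
by rewrite -divgS // oJ oY (expnS p 2) mulnK // expn_gt0 prime_gt0.
Qed.

End EssentialRankThree.

(** * A maximal subgroup whose automizer moves [Ohm_1 Z(S)] *)

Section Mover.
Variables (gT : finGroupType) (p : nat) (S : {group gT}) (F : fsys gT).
Hypotheses (p_pr : prime p) (odd_p : odd p) (pS : p.-group S) (satF : saturated F S p).
Hypothesis rkS : forall Q : {group gT}, Q \subset S -> 'm(Q) <= 3.
Variables E Q : {group gT}.
Hypothesis essE : essential_like p F S E.
Implicit Types (P R J X V : {group gT}) (f : {ffun gT -> gT}) (a b : {perm gT}).

Let fusF : is_fusion_system S F := satF.1.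
Local Notation N := 'N_S(E).
Local Notation R := 'N_S(Q).
Local Notation A := (autF F Q).
Local Notation Z := 'Ohm_1('Z(S)).
Local Notation Y := 'Ohm_1('Z(Q)).

Hypotheses (sNQ : N \subset Q) (sQS : Q \subset S) (fnQ : fully_normalized F S Q).
Hypothesis mvQ : ~~ (A \subset 'N(Z | 'P)).
Hypothesis maxQ : forall (P : {group gT}) f, P \subset S -> F P f ->
  #|Q| < #|P| -> N \subset P -> f @: Z = Z.

Let p_gt0 : 0 < p := prime_gt0 p_pr.
Let sES : E \subset S := ess_sub essE.
Let sEN : E \subset N := ess_sub_normalizer essE.
Let pQ : p.-group Q := pgroupS sQS pS.
Let sEQ : E \subset Q := subset_trans sEN sNQ.
Let sRS : R \subset S := subsetIl _ _.
Let pR : p.-group R := pgroupS sRS pS.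

Lemma mover_plane_normalizer : Y \subset 'Z(N).
Proof.
have [_ cEE _ _ _] := essE.
have cYQ : Y \subset 'C(Q) := subset_trans (Ohm_sub 1 _) (subsetIr _ _).
have sYQ : Y \subset Q := subset_trans (Ohm_sub 1 _) (center_sub Q).
rewrite subsetI (subset_trans _ sEN) /=; first exact: subset_trans cYQ (centS sNQ).
rewrite (subset_trans _ cEE) // subsetI (subset_trans sYQ) //.
exact: subset_trans cYQ (centS sEQ).
Qed.

Lemma mover_plane_sub : Y \subset E.
Proof.
apply: subset_trans mover_plane_normalizer _.
exact: subset_trans (ess_center_normalizer essE) (center_sub E).
Qed.

Lemma mover_plane_abelem : p.-abelem Y.
Proof. by rewrite Ohm1_abelem ?center_abelian // (pgroupS (center_sub Q)). Qed.

Lemma mover_plane_stable : A \subset 'N(Y | 'P).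
Proof.
by apply: autF_char_stable; rewrite (char_trans (Ohm_char 1 _)) ?center_char.
Qed.

Lemma mover_Z_plane : Z \subset Y.
Proof.
have sZS : Z \subset 'Z(S) := Ohm_sub 1 _.
have cZS : Z \subset 'C(S) := subset_trans sZS (subsetIr _ _).
have [_ cEE _ _ _] := essE.
have sZQ : Z \subset 'Z(Q).
  rewrite subsetI (subset_trans cZS (centS sQS)) andbT.
  rewrite (subset_trans _ sEQ) // (subset_trans _ cEE) // subsetI.
  by rewrite (subset_trans sZS (center_sub S)) (subset_trans cZS (centS sES)).
have abZ : p.-abelem Z by rewrite Ohm1_abelem ?center_abelian // (pgroupS (center_sub S)).
by rewrite -(Ohm1_id abZ) OhmS.
Qed.

(** [Y] is [A]-invariant and [Z] is not, so [1 < Z < Y]; being central in [N], [Y] has order at most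
    p^2. *)
Lemma mover_orders : #|Z| = p /\ #|Y| = (p ^ 2)%N.
Proof.
have leY := ess_no_central_rank3 p_pr odd_p pS satF rkS essE mover_plane_abelem mover_plane_normalizer.
have pY := abelem_pgroup mover_plane_abelem.
have pZ : p.-group Z := pgroupS mover_Z_plane pY.
have ltZY : Z \proper Y.
  rewrite properEneq mover_Z_plane andbT; apply: contraNneq mvQ => ->.
  exact: mover_plane_stable.
have ntS : S :!=: 1.
  apply: contraNneq mvQ => S1.
  have Q1 : Q :=: 1 by apply/trivgP; rewrite -S1.
  have -> : Z = Y by rewrite S1 Q1.
  exact: mover_plane_stable.
have ntZ : Z != 1 by rewrite Ohm1_eq1 center_nil_eq1 ?(pgroup_nil pS).
have ltZ : p ^ 0 < #|Z| by rewrite expn0 cardG_gt1.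
have geZ : p <= #|Z| by rewrite dvdn_leq // (pgroup_index_dvd p_pr pZ ltZ).
have ltY : p ^ 1 < #|Y| by rewrite expn1 (leq_ltn_trans geZ) ?proper_card.
have oY : #|Y| = (p ^ 2)%N.
  by apply/eqP; rewrite eqn_leq leY dvdn_leq // (pgroup_index_dvd p_pr pY ltY).
split=> //; apply/eqP; rewrite eqn_leq geZ andbT leqNgt; apply/negP=> gtZ.
have: p ^ 2 <= #|Z| by rewrite dvdn_leq // (pgroup_index_dvd p_pr pZ) // expn1.
by rewrite -oY leqNgt proper_card.
Qed.

(** A strictly larger ['C_R(Y)] would fall under [maxQ]: its morphisms would fix [Z], and the
    Frattini argument with [V = Y] would make [A] fix [Z]. *)
Lemma mover_cent_plane : 'C_R(Y) = Q.
Proof.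
have sYZ : Y \subset 'Z(Q) := Ohm_sub 1 _.
have sQC : Q \subset 'C_R(Y).
  rewrite subsetI subsetI sQS normG centsC.
  exact: subset_trans sYZ (subsetIr _ _).
apply/eqP; rewrite eq_sym eqEcard sQC leqNgt; apply/negP=> ltQ.
case/negP: mvQ; apply: (frattini_stable (V := Y) satF sQS fnQ).
- exact: subset_trans sYZ (center_sub Q).
- exact: mover_plane_stable.
- exact: mover_Z_plane.
move=> a f _ Ff _; apply: maxQ Ff ltQ _; last exact: subset_trans sNQ sQC.
by rewrite (subset_trans (subsetIl _ _)).
Qed.

Lemma mover_proper : exists r, [/\ r \in R, r \notin Q & r \notin 'C(Y)].
Proof.
have ltQS : Q \proper S.
  rewrite properEneq sQS andbT; apply: contraNneq mvQ => defQ.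
  have -> : Q = S by apply: val_inj.
  by apply: autF_char_stable; rewrite (char_trans (Ohm_char 1 _)) ?center_char.
have /properP[_ [r Rr nQr]] := nilpotent_proper_norm (pgroup_nil pS) ltQS.
exists r; split=> //; apply: contra nQr => cYr.
by rewrite -mover_cent_plane inE Rr.
Qed.

(** An invariant line [X] is normal, hence central, in [R]. As it differs from [Z], [R] would
    centralize [X * Z = Y], against [mover_proper]. *)
Lemma mover_irr X : X \subset Y -> #|X| = p -> ~ A \subset 'N(X | 'P).
Proof.
move=> sXY oX stX; have [oZ oY] := mover_orders.
have sYQ : Y \subset Q := subset_trans (Ohm_sub 1 _) (center_sub Q).
have sQR : Q \subset R by rewrite subsetI sQS normG.
have sXQ := subset_trans sXY sYQ.
have nsXR : X <| R.
  rewrite /normal (subset_trans sXQ) //.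
  by apply/subsetP=> x; apply: (autF_stable_conj fusF sQS).
have /subsetIP[_ cXR] := order_p_central p_pr pR nsXR oX.
have cZR : Z \subset 'C(R) :=
  subset_trans (subset_trans (Ohm_sub 1 _) (subsetIr _ _)) (centS sRS).
have [r [Rr _ /negP[]]] := mover_proper.
have neqXZ : (X : {set gT}) != Z by apply: contraNneq mvQ => <-.
have tiXZ : X :&: 'Ohm_1('Z(S)) = 1.
  apply: prime_TIg; rewrite ?oX //; apply: contra neqXZ => sXZ.
  by rewrite eqEcard sXZ oX oZ leqnn.
have defY : X * Z = Y.
  apply/eqP; rewrite eqEcard mul_subG ?mover_Z_plane //.
  by rewrite (TI_cardMg tiXZ) oX oZ oY mulnn leqnn.
by rewrite -defY centM inE !(subsetP _ r Rr) // centsC.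
Qed.

(** An element [r] of [R] outside [Q] acts on [Y] as a transvection fixing [Z], so its powers
    permute transitively the lines other than [Z]; some [a1] in [A] sends [Z] to one of these. *)
Lemma mover_transitive X : X \subset Y -> #|X| = p ->
  exists2 a, a \in A & a @: Z = X.
Proof.
move=> sXY oX; have [oZ oY] := mover_orders.
have sYQ : Y \subset Q := subset_trans (Ohm_sub 1 _) (center_sub Q).
have abY := abelem_abelian mover_plane_abelem.
have sQR : Q \subset R by rewrite subsetI sQS normG.
have sZQ := subset_trans mover_Z_plane sYQ.
have [defX | neqXZ] := eqVneq (X : {set gT}) Z.
  exists 1; rewrite ?group1 // defX -[RHS]imset_id.
  by apply: eq_imset => x; rewrite perm1.
have /subsetPn[a1 Aa1 nZa1] := mvQ.
have Auta1 := subsetP (autF_sub F Q) a1 Aa1.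
have [z0 Zz0 nZx] : exists2 z, z \in Z & a1 z \notin Z.
  apply/exists_inP; rewrite -negb_forall_in; apply: contra nZa1 => /forall_inP aZ.
  exact/perm_astabsP.
set x := a1 z0 in nZx.
have Yx : x \in Y.
  by apply: (perm_astabsP _ _ (subsetP mover_plane_stable a1 Aa1)); rewrite (subsetP mover_Z_plane).
have gen_p g (G0 : {group gT}) : #|G0| = p -> g \in G0 -> g != 1 -> G0 :=: <[g]>.
  move=> oG Gg ntg; apply/esym/eqP; rewrite eqEcard cycle_subG Gg oG -orderE.
  have : #[g] %| p by rewrite -oG order_dvdG.
  by case/primeP: p_pr => _ /[apply]; rewrite order_eq1 (negPf ntg) => /eqP->; rewrite leqnn.
have defY g : g \in Y -> g \notin Z -> Y = <[g]> <*> Z.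
  move=> Yg nZg; apply/esym/eqP; rewrite eqEcard join_subG cycle_subG Yg mover_Z_plane oY.
  have sgY : <[g]> <*> Z \subset Y by rewrite join_subG cycle_subG Yg mover_Z_plane.
  rewrite dvdn_leq // (pgroup_index_dvd p_pr (pgroupS sgY (abelem_pgroup mover_plane_abelem))) //.
  rewrite expn1 -{1}oZ proper_card // properE joing_subr /=.
  by apply: contra nZg => /subsetP-> //; rewrite mem_gen // inE cycle_id.
have [r [Rr _ ncYr]] := mover_proper.
have nsYR : Y <| R.
  rewrite /normal (subset_trans sYQ) //.
  by apply/subsetP=> u; apply: (autF_stable_conj fusF sQS) => //; apply: mover_plane_stable.
have cZR : Z \subset 'C(R) :=
  subset_trans (subset_trans (Ohm_sub 1 _) (subsetIr _ _)) (centS sRS).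
have nsZR : Z <| R.
  rewrite /normal (subset_trans sZQ) //.
  by rewrite cents_norm // centsC.
have Zxr : [~ x, r] \in Z.
  rewrite (subsetP (index_p_comm p_pr pR nsZR nsYR mover_Z_plane _)) ?mem_commg //.
  by rewrite -divgS ?mover_Z_plane // oY oZ (expnS p 1) expn1 mulnK.
have nt_xr : [~ x, r] != 1.
  apply: contra ncYr => /commgP cxr; rewrite (defY x) // centY inE cent_cycle.
  apply/andP; split; first exact/cent1P/commute_sym.
  by apply: (subsetP _ r Rr); rewrite centsC.
have [y Xy nZy] : exists2 y, y \in X & y \notin Z.
  apply/subsetPn; apply: contra neqXZ => sXZ.
  by rewrite eqEcard sXZ oX oZ leqnn.
have Yy := subsetP sXY y Xy.
have : x \in <[y]> <*> Z by rewrite -(defY y).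
rewrite cent_joinEr; last first.
  by apply: (centSS mover_Z_plane _ abY); rewrite cycle_subG.
case/mulsgP=> yk z' /cycleP[k ->] Zz' def_x.
(* [j] is the exponent for which [[~ x, r] ^+ j] cancels the component [z'] of [x] along [Z]. *)
have /cycleP[j def_z'] : z'^-1 \in <[[~ x, r]]>.
  by rewrite -(gen_p _ 'Ohm_1('Z(S))%G oZ Zxr nt_xr) groupV.
have xr : x ^ (r ^+ j) = y ^+ k.
  rewrite conjg_mulR commgX; last first.
    by apply/commute_sym/(centsP cZR).
  by rewrite -def_z' def_x mulgK.
have Nrj : r ^+ j \in R by rewrite groupX.
have nQrj : r ^+ j \in 'N(Q) by case/setIP: Nrj.
exists (a1 * conj_aut Q (r ^+ j)); first by rewrite groupM // (autF_conj fusF).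
have defZ : Z = <[z0]>.
  by apply: (gen_p _ 'Ohm_1('Z(S))%G) => //; apply: contraNneq nZx => z01; rewrite /x z01 -(autmE Auta1) morph1.
have Qz0 := subsetP sZQ z0 Zz0.
have yk_nt : y ^+ k != 1.
  by rewrite -xr conjg_eq1; apply: contraNneq nZx => ->; apply: group1.
rewrite (gen_p _ X oX (groupX k Xy) yk_nt) defZ.
apply/setP=> u; apply/imsetP/cycleP.
  case=> _ /cycleP[i ->] ->; exists i.
  rewrite permM (norm_conj_autE nQrj) ?Aut_closed ?groupX //.
  by rewrite (autX _ Auta1) // conjXg xr.
case=> i ->; exists (z0 ^+ i); first exact: mem_cycle.
rewrite permM (norm_conj_autE nQrj) ?Aut_closed ?groupX //.
by rewrite (autX _ Auta1) // conjXg xr.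
Qed.

End Mover.

Lemma comm_mod_cent1 (gT : finGroupType) (W : {group gT}) x q :
  x \in 'N(W) -> q \in 'N(W) ->
  ([~ x, q] \in W) = (coset W q \in 'C[coset W x]).
Proof.
move=> nWx nWq; have <- : (coset W [~ x, q] == 1) = ([~ x, q] \in W).
  by apply/eqP/idP => [|/coset_id //]; apply: coset_idr; apply: groupR.
by rewrite morphR //; apply/commgP/cent1P => /commute_sym.
Qed.

(* [q |-> [x, q]] is a homomorphism with elementary abelian image. *)
Lemma central_comm_cent1 (gT : finGroupType) p (H : {group gT}) x : x \in H ->
    (forall q, q \in H -> [~ x, q] \in 'C(H) /\ [~ x, q] ^+ p = 1) ->
  H^`(1) \subset 'C[x] /\ {in H, forall q, q ^+ p \in 'C[x]}.
Proof.
move=> Hx cx; have cJ q h : q \in H -> h \in H -> [~ x, q] ^ h = [~ x, q].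
  move=> Hq Hh; have [/centP/(_ h Hh) c _] := cx q Hq.
  exact/conjg_fixP/commgP.
split.
  rewrite gen_subG; apply/subsetP=> _ /imset2P[q1 q2 Hq1 Hq2 ->].
  apply/cent1P/commute_sym/commgP; apply/eqP/(mulIg [~ x, q2 * q1]).
  have [/centP c1 _] := cx q1 Hq1; have Rx2 := groupR Hx Hq2.
  have Hq21 : q2 * q1 \in H by rewrite groupM.
  have Hk : [~ q1, q2] \in H by rewrite groupR.
  rewrite mul1g -{1}(cJ (q2 * q1) [~ q1, q2]) //.
  by rewrite -commgMJ -commgC !commgMJ !cJ ?c1.
move=> q Hq; apply/cent1P/commute_sym/commgP.
have [/centP/(_ q Hq) cq Rp] := cx q Hq.
by rewrite commgX ?Rp //; apply: commute_sym.
Qed.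

Section MoverJ.
Variables (gT : finGroupType) (p : nat) (S : {group gT}) (F : fsys gT).
Hypotheses (p_pr : prime p) (odd_p : odd p) (pS : p.-group S) (satF : saturated F S p).
Hypothesis rkS : forall Q : {group gT}, Q \subset S -> 'm(Q) <= 3.
Variables E Q : {group gT}.
Hypothesis essE : essential_like p F S E.
Implicit Types (P R X V : {group gT}) (f : {ffun gT -> gT}) (a b : {perm gT}).

Let fusF : is_fusion_system S F := satF.1.
Local Notation N := 'N_S(E).
Local Notation R := 'N_S(Q).
Local Notation A := (autF F Q).
Local Notation Z := 'Ohm_1('Z(S)).
Local Notation Y := 'Ohm_1('Z(Q)).

Hypotheses (sNQ : N \subset Q) (sQS : Q \subset S) (fnQ : fully_normalized F S Q).
Hypothesis mvQ : ~~ (A \subset 'N(Z | 'P)).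
Hypothesis maxQ : forall (P : {group gT}) f, P \subset S -> F P f ->
  #|Q| < #|P| -> N \subset P -> f @: Z = Z.

Let sEN : E \subset N := ess_sub_normalizer essE.
Let pQ : p.-group Q := pgroupS sQS pS.
Let sEQ : E \subset Q := subset_trans sEN sNQ.
Let sRS : R \subset S := subsetIl _ _.
Let oY : #|Y| = (p ^ 2)%N.
Proof. by case: (mover_orders p_pr odd_p pS satF rkS essE sNQ sQS mvQ). Qed.
Let irr := mover_irr p_pr odd_p pS satF rkS essE sNQ sQS fnQ mvQ maxQ.
Let sYZN := mover_plane_normalizer essE sNQ sQS.
Let sYE := mover_plane_sub essE sNQ sQS.
Let sYZ : Y \subset 'Z(Q) := Ohm_sub 1 _.
Let sYQ : Y \subset Q := subset_trans sYZ (center_sub Q).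
Let cYQ : Q \subset 'C(Y).
Proof. by rewrite centsC (subset_trans sYZ) ?subsetIr. Qed.
Let nsYQ : Y <| Q := sub_center_normal sYZ.
Let abY : p.-abelem Y := mover_plane_abelem pS sQS.
Let stY : A \subset 'N(Y | 'P) := mover_plane_stable F Q.

Lemma mover_stable_sub X : X \subset Y -> A \subset 'N(X | 'P) -> X :!=: 1 -> X :=: Y.
Proof.
move=> sXY stX ntX; apply/eqP; rewrite eqEcard sXY oY dvdn_leq //.
have pX := pgroupS sXY (abelem_pgroup abY).
have gtX : p ^ 0 < #|X| by rewrite expn0 cardG_gt1.
apply: (pgroup_index_dvd p_pr pX); rewrite expn1 ltnNge; apply/negP=> leX.
have geX : p <= #|X| by rewrite dvdn_leq // (pgroup_index_dvd p_pr pX gtX).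
by case: (irr sXY _ stX); apply/eqP; rewrite eqn_leq leX.
Qed.

(** If a maximal normal elementary abelian [J >= Y] of [Q] were [Y], then ['Ohm_1(E)] would be [Y],
    because [E] centralizes [Y]; [ess_no_plane_Ohm1] forbids this. *)
Lemma mover_J : exists J : {group gT},
  [/\ Y \subset J, J <| Q, p.-abelem J, #|J| = (p ^ 3)%N & A \subset 'N(J | 'P)].
Proof.
have [J maxJ sYJ] := @maxgroup_exists _ [pred Z0 : {group gT} | (Z0 <| Q) && p.-abelem Z0]
  'Ohm_1('Z(Q))%G (introT andP (conj nsYQ abY)).
have O1J := Ohm1_cent_max_normal_abelem odd_p pQ maxJ.
have /andP[nsJQ abJ] := maxgroupp maxJ; have sJQ := normal_sub nsJQ.
have neqYJ : Y != J.
  apply/eqP=> defJ; apply: (ess_no_plane_Ohm1 p_pr odd_p pS satF essE (Y := 'Ohm_1('Z(Q))%G) sYZN).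
  apply/eqP; rewrite eqEsubset; apply/andP; split; last first.
    by rewrite -(Ohm1_id abY) OhmS.
  by rewrite /= defJ -O1J OhmS // subsetI sEQ -defJ (subset_trans sEQ).
have oJ : #|J| = (p ^ 3)%N.
  apply/eqP; rewrite eqn_leq (abelem_card p_pr rkS) ?(subset_trans sJQ) //=.
  rewrite dvdn_leq // (pgroup_index_dvd p_pr (abelem_pgroup abJ)) // -oY.
  by rewrite proper_card // properEneq neqYJ.
exists J; split=> //.
apply: (orbit_span_irr p_pr odd_p pS rkS sQS (Y := 'Ohm_1('Z(Q))%G)) => //.
exact: autF_sub.
Qed.

(** ['N_S(a(E))] contains [a(N)] and, by full normalization, is no larger. An element of [R] outside
    [Q] therefore normalizes no [A]-image of [E]. *)
Lemma mover_conj_normalizer a (E1 : {group gT}) : a \in A -> E1 :=: a @: E ->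
  'N_S(E1) \subset Q.
Proof.
move=> Aa defE1; have [_ _ fnE _ _] := essE.
have [Auta Fa] := andP (etrans (esym (mem_autF fusF a sQS)) Aa).
have FaE := fsys_res fusF Fa sEQ.
have eqE : [ffun x => a x] @: E = E1.
  by rewrite defE1; apply: eq_imset => x; rewrite ffunE.
have leN := fnE _ FaE; rewrite eqE in leN.
have saN : a @: N \subset Q.
  by apply/subsetP=> _ /imsetP[x Nx ->]; rewrite Aut_closed // (subsetP sNQ).
suffices /eqP <- : a @: N == 'N_S(E1) by [].
rewrite eqEcard card_imset ?leN ?andbT; last exact: perm_inj.
apply/subsetP=> _ /imsetP[x Nx ->]; have Qx := subsetP sNQ x Nx.
have Qax : a x \in Q by rewrite Aut_closed.
apply/setIP; split; first exact: subsetP sQS _ Qax.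
rewrite inE; apply/subsetP=> z /imsetP[y].
rewrite {1}defE1 => /imsetP[e Ee ->] ->.
rewrite -(autJ Auta) ?(subsetP sEQ e Ee) // defE1 imset_f // memJ_norm //.
by case/setIP: Nx.
Qed.

End MoverJ.

(** * Rank-three extensions of the center *)

Section PlaneExtension.
Variables (gT : finGroupType) (p : nat) (S : {group gT}).
Hypotheses (p_pr : prime p) (odd_p : odd p) (pS : p.-group S).
Hypothesis rkS : forall Q : {group gT}, Q \subset S -> 'm(Q) <= 3.
Variables (Q J : {group gT}) (A : {group {perm gT}}).
Local Notation Y := 'Ohm_1('Z(Q)).
Local Notation C := 'C_Q(J).
Hypotheses (sQS : Q \subset S) (sA : A \subset Aut Q) (oY : #|Y| = (p ^ 2)%N).
Hypothesis irrY : forall X : {group gT}, X \subset Y -> A \subset 'N(X | 'P) ->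
  X :!=: 1 -> X :=: Y.
Hypotheses (sYJ : Y \subset J) (nsJQ : J <| Q) (abJ : p.-abelem J).
Hypotheses (oJ : #|J| = (p ^ 3)%N) (stJ : A \subset 'N(J | 'P)).

Let p_gt1 : 1 < p := prime_gt1 p_pr.
Let p_gt0 : 0 < p := prime_gt0 p_pr.
Let pQ : p.-group Q := pgroupS sQS pS.
Let sJQ : J \subset Q := normal_sub nsJQ.
Let sYZ : Y \subset 'Z(Q) := Ohm_sub 1 _.
Let cYQ : Y \subset 'C(Q) := subset_trans sYZ (subsetIr _ _).
Let nsYQ : Y <| Q := sub_center_normal sYZ.
Let abY : p.-abelem Y := abelemS sYJ abJ.
Let cJJ : abelian J := abelem_abelian abJ.
Let sJC : J \subset C.
Proof. by rewrite subsetI sJQ. Qed.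
Let sCQ : C \subset Q := subsetIl _ _.

Lemma plane_ext_stable : A \subset 'N(Y | 'P).
Proof.
apply/subsetP=> a Aa; apply: Aut_char_astabs (subsetP sA a Aa).
by rewrite (char_trans (Ohm_char 1 _)) ?center_char.
Qed.

Lemma plane_ext_cent_stable : A \subset 'N(C | 'P).
Proof.
apply/subsetP=> a Aa.
exact: Aut_cent_astabs (subsetP sA a Aa) sJQ (subsetP stJ a Aa).
Qed.

Lemma plane_ext_index : #|J : Y| = p.
Proof. by rewrite -divgS // oJ oY (expnS p 2) mulnK // expn_gt0 p_gt0. Qed.

Lemma plane_ext_comm : [~: J, Q] \subset Y.
Proof. exact: (index_p_comm p_pr pQ nsYQ nsJQ sYJ plane_ext_index). Qed.

Lemma plane_ext_gen j : j \in J -> j \notin Y -> J :=: Y <*> <[j]>.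
Proof.
move=> Jj nYj; have sK : Y <*> <[j]> \subset J by rewrite join_subG sYJ cycle_subG.
apply/esym/eqP; rewrite eqEcard sK oJ dvdn_leq //.
apply: (pgroup_index_dvd p_pr (pgroupS sK (abelem_pgroup abJ))).
rewrite -oY proper_card // properE joing_subl.
by apply: contra nYj => /subsetP-> //; rewrite mem_gen // inE cycle_id orbT.
Qed.

Lemma plane_ext_comm_in j q : j \in J -> q \in Q -> [~ j, q] \in Y.
Proof. by move=> Jj Qq; rewrite (subsetP plane_ext_comm) ?mem_commg. Qed.

Lemma plane_ext_Ycent y q : y \in Y -> q \in Q -> commute y q.
Proof. by move=> Yy Qq; apply: (centP (subsetP cYQ y Yy)). Qed.

Lemma plane_ext_Ohm1C : 'Ohm_1(C) \subset J.
Proof. exact: (Ohm1_cent_rank3 p_pr pS rkS sQS sJQ abJ oJ). Qed.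

Lemma plane_ext_order_p c : c \in C -> c ^+ p = 1 -> c \in J.
Proof.
move=> Cc cp; apply: (subsetP plane_ext_Ohm1C).
rewrite (OhmE 1 (pgroupS sCQ pQ)) mem_gen //; apply/setIP; split=> //.
by rewrite inE expn1 cp.
Qed.

Lemma plane_ext_cent1 j : j \in J -> j \notin Y -> 'C_Q[j] = C.
Proof.
move=> Jj nYj; have -> : C = Q :&: ('C(Y) :&: 'C[j]).
  by rewrite (plane_ext_gen Jj nYj) centY cent_cycle.
by rewrite setIA (setIidPl (_ : Q \subset 'C(Y))) // centsC.
Qed.

Lemma plane_ext_centJ j : j \in J -> j \in 'C(Q) -> j \in Y.
Proof.
move=> Jj cj; rewrite (OhmE 1 (pgroupS (center_sub Q) pQ)) mem_gen //.
have [_ /(_ j Jj) jp] := abelemP p_pr abJ; apply/setIP; split.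
  by apply/setIP; split=> //; apply: subsetP sJQ j Jj.
by rewrite inE expn1 jp.
Qed.

(** Since [J = Y <*> <[j]>] with [Y] central, [[~ a j, q]] is a power of [[~ j, q]]; so the subgroup
    [[j, Q]] of [Y] is [A]-invariant and nontrivial. *)
Lemma plane_ext_comm_im j : j \in J -> j \notin Y -> comm_im j Q = Y.
Proof.
move=> Jj nYj; have sY : comm_im j Q \subset Y.
  by apply/subsetP=> _ /imsetP[q Qq ->]; apply: plane_ext_comm_in.
pose X := Group (comm_im_group_set (subset_trans sY cYQ)).
apply: (irrY (X := X)) => //.
  apply/subsetP=> a Aa; have Auta := subsetP sA a Aa.
  apply/perm_astabsP=> _ /imsetP[q Qq ->].
  rewrite (autR Auta) ?(subsetP sJQ j Jj) //.
  have Qaq : a q \in Q by rewrite Aut_closed.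
  have: a j \in J := perm_astabsP _ _ (subsetP stJ a Aa) j Jj.
  rewrite {1}(plane_ext_gen Jj nYj) cent_joinEr; last first.
    by rewrite (centSS _ sYJ cJJ) // cycle_subG.
  case/mulsgP=> y _ Yy /cycleP[i ->] ->.
  have cjq : commute j [~ j, a q].
    exact/commute_sym/(plane_ext_Ycent (plane_ext_comm_in Jj Qaq))/(subsetP sJQ).
  rewrite commMgJ (_ : [~ y, a q] = 1); last by apply/eqP/commgP/plane_ext_Ycent.
  by rewrite conj1g mul1g commXg // (groupX (G := X)) //; apply: imset_f.
apply: contraNneq nYj => X1; apply: plane_ext_centJ Jj _.
apply/centP=> q Qq; apply/commgP; have: [~ j, q] \in X by apply: imset_f.
by rewrite X1 inE.
Qed.

Lemma plane_ext_cent_index : #|Q : C| = (p ^ 2)%N.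
Proof.
have /subsetPn[j Jj nYj] : ~~ (J \subset Y).
  by apply/negP=> /subset_leq_card; rewrite oJ oY leqNgt ltn_exp2l.
by rewrite -(plane_ext_cent1 Jj nYj) -card_comm_im plane_ext_comm_im.
Qed.

Lemma plane_ext_quot : Q^`(1) \subset C /\ {in Q, forall q, q ^+ p \in C}.
Proof.
have /subsetPn[j Jj nYj] : ~~ (J \subset Y).
  by apply/negP=> /subset_leq_card; rewrite oJ oY leqNgt ltn_exp2l.
have [|dj pj] := @central_comm_cent1 _ p Q j (subsetP sJQ j Jj).
  move=> q Qq; have Yjq := plane_ext_comm_in Jj Qq.
  by rewrite (subsetP cYQ) //; split=> //; have [_ ->] := abelemP p_pr abY.
split=> [|q Qq]; rewrite -(plane_ext_cent1 Jj nYj); first by rewrite subsetI der_sub.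
by rewrite inE groupX // pj.
Qed.

Lemma plane_ext_expM x y : x \in C -> y \in C -> [~ x, y] \in J ->
  (y * x) ^+ p = y ^+ p * x ^+ p.
Proof.
move=> /setIP[_ cx] /setIP[_ cy] Jxy.
rewrite expMg_Rmul; [|exact: (centP cx) _ Jxy|exact: (centP cy) _ Jxy].
have [_ /(_ _ Jxy) R1] := abelemP p_pr abJ.
by rewrite bin2odd // expgM R1 expg1n mulg1.
Qed.

(** On [X] the p-th power map is a homomorphism with kernel inside [J], so its image is a nontrivial
    [A]-invariant subgroup of [Y]. *)
Lemma plane_ext_pow_onto (X : {group gT}) : X \subset C ->
    (forall x y, x \in X -> y \in X -> [~ x, y] \in J) ->
    {in X, forall x, x ^+ p \in Y} -> A \subset 'N(X | 'P) ->
    (exists2 x, x \in X & x \notin J) ->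
  forall y, y \in Y -> exists2 x, x \in X & x ^+ p = y.
Proof.
move=> sXC RX pX stX [x0 Xx0 nJx0].
have gP : group_set [set x ^+ p | x in X].
  apply/group_setP; split; first by apply/imsetP; exists 1; rewrite ?group1 ?expg1n.
  move=> _ _ /imsetP[x Xx ->] /imsetP[y Xy ->]; apply/imsetP; exists (x * y).
    exact: groupM.
  by rewrite plane_ext_expM ?(subsetP sXC) ?RX.
have /= defY : Group gP :=: Y; last first.
  by move=> y; rewrite -defY => /imsetP[x Xx ->]; exists x.
apply: irrY.
- by apply/subsetP=> _ /imsetP[x Xx ->]; apply: pX.
- apply/subsetP=> a Aa; apply/perm_astabsP=> _ /imsetP[x Xx ->].
  rewrite (autX _ (subsetP sA a Aa)) ?(subsetP sCQ) ?(subsetP sXC) //.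
  by apply: imset_f; apply: (perm_astabsP _ _ (subsetP stX a Aa)).
apply: contraNneq nJx0 => P1; apply: plane_ext_order_p; first exact: subsetP sXC x0 Xx0.
have : x0 ^+ p \in Group gP by apply: imset_f.
by rewrite P1 => /set1P.
Qed.

(** The elements of [C] that are central in [Q] modulo [J], restricted so that their p-th powers
    land in [Y], where [irrY] is available. *)
Definition plane_ext_top :=
  [set c in C | [forall q in Q, [~ c, q] \in J] && (c ^+ p \in Y)].
Local Notation C1 := plane_ext_top.

Lemma plane_ext_topP c : reflect
  [/\ c \in C, forall q, q \in Q -> [~ c, q] \in J & c ^+ p \in Y] (c \in C1).
Proof.
apply: (iffP setIdP) => [[Cc /andP[/forall_inP Jc Yc]] | [Cc Jc Yc]] //.
by split=> //; rewrite Yc andbT; apply/forall_inP.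
Qed.

Lemma plane_ext_top_group_set : group_set C1.
Proof.
apply/group_setP; split.
  apply/plane_ext_topP; rewrite group1 expg1n group1; split=> // q _.
  by rewrite comm1g group1.
move=> x y /plane_ext_topP[Cx Jx Yx] /plane_ext_topP[Cy Jy Yy].
have Qy := subsetP sCQ y Cy; apply/plane_ext_topP; split; first exact: groupM.
  move=> q Qq; rewrite commMgJ groupM ?Jy // memJ_norm ?Jx //.
  exact: subsetP (normal_norm nsJQ) y Qy.
by rewrite plane_ext_expM //; [exact: groupM | rewrite Jy // (subsetP sCQ)].
Qed.
Canonical plane_ext_top_group := Group plane_ext_top_group_set.

Lemma plane_ext_top_sub : C1 \subset C.
Proof. by apply/subsetP=> c /plane_ext_topP[]. Qed.

Lemma plane_ext_top_stable : A \subset 'N(C1 | 'P).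
Proof.
apply/subsetP=> a Aa; have Auta := subsetP sA a Aa; apply/perm_astabsP=> c.
case/plane_ext_topP=> Cc Jc Yc; have Qc := subsetP sCQ c Cc.
have aJ := perm_astabsP _ _ (subsetP stJ a Aa).
have aY := perm_astabsP _ _ (subsetP plane_ext_stable a Aa).
have Qa q : q \in Q -> a^-1 q \in Q by move=> Qq; rewrite Aut_closed ?groupV.
have aR q : q \in Q -> [~ a c, q] = a [~ c, a^-1 q].
  by move=> Qq; rewrite (autR Auta) ?Qa ?permKV.
apply/plane_ext_topP; split; last by rewrite -(autX _ Auta) ?aY.
  exact: perm_astabsP (subsetP plane_ext_cent_stable a Aa) c Cc.
by move=> q Qq; rewrite aR // aJ // Jc ?Qa.
Qed.

(* If [[c, Q] <= J] then each conjugate of [c] is [c * j] with [j \in J], so it has the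
   same p-th power: [c ^+ p] is central in [Q]. *)
Lemma plane_ext_top_nt : J \proper C -> exists2 c, c \in C1 & c \notin J.
Proof.
move=> /andP[_ nCJ]; have nJQ := normal_norm nsJQ.
have nsC : C <| Q.
  rewrite /normal sCQ; apply: normsI; first exact: normG.
  exact: subset_trans nJQ (cent_norm J).
have ntC : C / J != 1.
  by rewrite -subG1 quotient_sub1 // (subset_trans sCQ).
have ntCZ := meet_center_nil (pgroup_nil (quotient_pgroup J pQ)) (quotient_normal J nsC) ntC.
have pCZ : p.-group (C / J :&: 'Z(Q / J)).
  by rewrite (pgroupS (subsetIl _ _)) // quotient_pgroup // (pgroupS sCQ).
have [_ p_dv _] := pgroup_pdiv pCZ ntCZ.
have [c' /setIP[/morphimP[c nJc Cc ->] /setIP[_ /centP cc]] oc] := Cauchy p_pr p_dv.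
have Rc q : q \in Q -> [~ c, q] \in J.
  move=> Qq; have nJq := subsetP nJQ q Qq; apply: coset_idr; first by rewrite groupR.
  by rewrite morphR //; apply/eqP/commgP/cc/mem_quotient.
have nJc' : c \notin J.
  by apply/negP=> /coset_id c1; have := p_gt1; rewrite -oc /= c1 order1.
have Jcp : c ^+ p \in J.
  by apply: coset_idr; rewrite ?groupX // morphX // -oc expg_order.
exists c => //; apply/plane_ext_topP; split=> //; apply: plane_ext_centJ => //.
apply/centP=> q Qq; apply/commgP/conjg_fixP.
have Cj := subsetP sJC _ (Rc q Qq).
have cjc : [~ [~ c, q], c] = 1.
  by apply/eqP/commgP; case/setIP: Cc => _ /centP/(_ _ (Rc q Qq))/commute_sym.
rewrite conjXg -[c ^ q](mulKVg c) -commgEl plane_ext_expM // ?cjc //.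
by have [_ /(_ _ (Rc q Qq)) ->] := abelemP p_pr abJ; rewrite mulg1.
Qed.

Lemma plane_ext_mod_cent c q : c \in Q -> q \in Q ->
  [~ c, q] \in Y = (coset Y q \in 'C[coset Y c]).
Proof.
move=> Qc Qq; have nY := subsetP (normal_norm nsYQ).
exact: (comm_mod_cent1 (nY c Qc) (nY q Qq)).
Qed.

(** The analogue of [plane_ext_quot] one step higher: [J / Y] is central in [Q / Y]. *)
Lemma plane_ext_top_quot x : x \in C1 ->
  Q^`(1) / Y \subset 'C[coset Y x] /\ {in Q, forall q, [~ x, q ^+ p] \in Y}.
Proof.
move=> /plane_ext_topP[Cx Jx _]; have nYQ := normal_norm nsYQ.
have Qx := subsetP sCQ x Cx; have nYx := subsetP nYQ x Qx.
have [|dj pj] := @central_comm_cent1 _ p (Q / Y) (coset Y x) (mem_quotient Y Qx).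
  move=> _ /morphimP[q nYq Qq ->]; have Jxq := Jx q Qq.
  have nYr : [~ x, q] \in 'N(Y) by rewrite groupR.
  rewrite /= -morphR // -morphX //; split; last first.
    by have [_ /(_ _ Jxq) ->] := abelemP p_pr abJ; rewrite morph1.
  apply/centP=> _ /morphimP[h nYh Qh ->]; apply/commgP.
  by rewrite -morphR //; apply/eqP/coset_id/plane_ext_comm_in.
split; first by rewrite (quotient_der 1).
move=> q Qq; rewrite plane_ext_mod_cent ?groupX // morphX ?(subsetP nYQ) //.
by apply: pj; apply: mem_quotient.
Qed.

(** Otherwise the rank bound on [Q / D] forces [C = D <*> <[c]>], and an element of [C1] outside [J]
    commuting with [c] modulo [Y] shows that the p-th powers of [C2] fill [Y]. So [x] differs from
    an element of [C2] by an element of [J], which commutes with [c]. *)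
Lemma plane_ext_top_comm x c : J \proper C -> x \in C1 -> c \in C -> [~ x, c] \in Y.
Proof.
move=> ltJC C1x Cc; apply/negPn/negP=> nYxc.
have nYQ := normal_norm nsYQ; have sC1C := plane_ext_top_sub.
have sC1Q := subset_trans sC1C sCQ.
have p_gt0' := p_gt0.
pose D := (C :&: (coset Y @*^-1 'C(C1 / Y)))%G.
have DP q : reflect (q \in C /\ {in C1, forall x, [~ x, q] \in Y}) (q \in D).
  have Dcond : q \in C -> (q \in D) = (coset Y q \in 'C(C1 / Y)).
    move=> Cq; have Qq := subsetP sCQ q Cq.
    by rewrite in_setI Cq in_setI (subsetP nYQ q Qq) inE.
  apply: (iffP idP) => [Dq | [Cq Yq]].
    have Cq : q \in C by case/setIP: Dq.
    split=> // v C1v; have Qq := subsetP sCQ q Cq; have Qv := subsetP sC1Q v C1v.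
    rewrite plane_ext_mod_cent //; apply/cent1P.
    by rewrite Dcond // in Dq; apply: (centP Dq); apply: mem_quotient.
  rewrite Dcond //; apply/centP=> _ /morphimP[v nYv C1v ->].
  have Qq := subsetP sCQ q Cq; have Qv := subsetP sC1Q v C1v.
  by have := Yq v C1v; rewrite plane_ext_mod_cent // => /cent1P.
have sDC : D \subset C := subsetIl _ _.
have sDQ := subset_trans sDC sCQ.
have [dC pC] := plane_ext_quot.
have sQ'D : Q^`(1) \subset D.
  apply/subsetP=> q Q'q; have Qq := subsetP (der_sub 1 Q) q Q'q.
  apply/DP; split; first exact: subsetP dC q Q'q.
  move=> v C1v; rewrite plane_ext_mod_cent ?(subsetP sC1Q v C1v) //.
  by apply: (subsetP (plane_ext_top_quot C1v).1); apply: mem_quotient.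
have nsDQ : D <| Q := sub_der1_normal sQ'D sDQ.
have abD : p.-abelem (Q / D).
  apply/abelemP=> //; split; first exact: sub_der1_abelian.
  move=> _ /morphimP[q nDq Qq ->]; rewrite -morphX //; apply: coset_id.
  by apply/DP; split=> [|v C1v]; [apply: pC | apply: (plane_ext_top_quot C1v).2].
have leD := abelem_section_index p_pr rkS sQS nsDQ abD.
(* [#|Q : C|] is already p^2, so only a factor p is left. *)
have leCD : #|C : D| <= p.
  move: leD; rewrite -(Lagrange_index sCQ sDC) plane_ext_cent_index (expnSr p 2).
  by rewrite leq_pmul2l // expn_gt0 p_gt0'.
have nDc : c \notin D by apply/negP=> /DP[_ /(_ x C1x)]; apply/negP.
have defC : C = D <*> <[c]>.
  have sK : D <*> <[c]> \subset C by rewrite join_subG sDC cycle_subG.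
  have pK := pgroupS (subset_trans sK sCQ) pQ.
  apply/esym/eqP; rewrite eqEcard sK -(Lagrange sDC).
  apply: leq_trans (leq_mul (leqnn _) leCD) _.
  have [i oD] := p_natP (pgroupS sDQ pQ); rewrite [#|D|]oD -expnSr dvdn_leq //.
  apply: (pgroup_index_dvd p_pr pK); rewrite -oD proper_card // properE joing_subl.
  by apply: contra nDc => /subsetP-> //; rewrite mem_gen // inE cycle_id orbT.
have [Cx Jx Yx] := plane_ext_topP _ C1x; have Qc := subsetP sCQ c Cc.
have Jxc : [~ x, c] \in J := Jx c Qc.
have C1S v w : v \in C1 -> w \in C1 -> [~ v, w] \in J.
  by move=> /plane_ext_topP[_ Jv _] /(subsetP sC1Q); apply: Jv.
have C1p : {in C1, forall v, v ^+ p \in Y} by move=> v /plane_ext_topP[].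
have nJx : x \notin J.
  apply: contra nYxc => Jxx; have [_ /centP/(_ x Jxx)/commute_sym/commgP/eqP ->] := setIP Cc.
  exact: group1.
have onto1 := plane_ext_pow_onto sC1C C1S C1p plane_ext_top_stable (ex_intro2 _ _ x C1x nJx).
pose C2 := (C1 :&: (coset Y @*^-1 'C(C / Y)))%G.
have C2P v : reflect (v \in C1 /\ {in C, forall c', [~ v, c'] \in Y}) (v \in C2).
  have C2c : v \in C1 -> (v \in C2) = (coset Y v \in 'C(C / Y)).
    move=> C1v; have Qv := subsetP sC1Q v C1v.
    by rewrite in_setI C1v in_setI (subsetP nYQ v Qv) inE.
  apply: (iffP idP) => [C2v | [C1v Yv]].
    have C1v : v \in C1 by case/setIP: C2v.
    split=> // q Cq; have Qq := subsetP sCQ q Cq; have Qv := subsetP sC1Q v C1v.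
    rewrite plane_ext_mod_cent //; apply/cent1P.
    by rewrite C2c // in C2v; apply/commute_sym/(centP C2v)/mem_quotient.
  rewrite C2c //; apply/centP=> _ /morphimP[q nYq Cq ->].
  have Qq := subsetP sCQ q Cq; have Qv := subsetP sC1Q v C1v.
  by have := Yv q Cq; rewrite plane_ext_mod_cent // => /cent1P/commute_sym.
have sC21 : C2 \subset C1 := subsetIl _ _.
have stC := plane_ext_cent_stable.
have stC2 : A \subset 'N(C2 | 'P).
  apply/subsetP=> a Aa; have Auta := subsetP sA a Aa; apply/perm_astabsP=> v.
  case/C2P=> C1v Yv; have Qv := subsetP sC1Q v C1v.
  apply/C2P; split.
    exact: perm_astabsP (subsetP plane_ext_top_stable a Aa) v C1v.
  move=> q Cq; have Ca'q : a^-1 q \in C.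
    by apply: (perm_astabsP _ _ (subsetP stC a^-1 _)); rewrite ?groupV.
  rewrite -(permKV a q) -(autR Auta) ?(subsetP sCQ _ Ca'q) //.
  by apply: (perm_astabsP _ _ (subsetP plane_ext_stable a Aa)); apply: Yv.
(* Take [v] in [C1] with [v ^+ p] independent of [x ^+ p] and multiply it by the power of [x] that
   cancels [[~ v, c]] modulo [Y]; independence keeps the product out of [J]. *)
have [w C1w [nJw Ywc]] : exists2 w, w \in C1 & w \notin J /\ [~ w, c] \in Y.
  have /subsetPn[y Yy nxy] : ~~ (Y \subset <[x ^+ p]>).
    apply/negP=> /subset_leq_card; rewrite oY leqNgt -orderE => /negP[].
    have [_ /(_ _ Yx) xpp] := abelemP p_pr abY.
    have : #[x ^+ p] <= p ^ 1 by rewrite expn1 dvdn_leq // order_dvdn xpp.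
    by move/leq_ltn_trans; apply; rewrite ltn_exp2l.
  have [v C1v vp] := onto1 y Yy; have [Cv Jv _] := plane_ext_topP _ C1v.
  have : [~ v, c]^-1 \in J by rewrite groupV Jv.
  rewrite {1}(plane_ext_gen Jxc nYxc) cent_joinEr; last first.
    by rewrite (centSS _ sYJ cJJ) // cycle_subG.
  case/mulsgP=> y' _ Yy' /cycleP[m ->] def_vc.
  have C1xm : x ^+ m \in C1 by rewrite (groupX (G := plane_ext_top_group)).
  exists (v * x ^+ m); first exact: (groupM (G := plane_ext_top_group)).
  have cJ j z : j \in J -> z \in C -> j ^ z = j.
    by move=> Jj /setIP[_ /centP/(_ j Jj)/commute_sym] /commgP/conjg_fixP.
  have Cxm : x ^+ m \in C by rewrite groupX.
  split; last first.
    rewrite commMgJ (cJ _ _ (Jv c Qc) Cxm) commXg; last first.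
      by have [_ /centP/(_ _ Jxc)] := setIP Cx.
    have -> : [~ x, c] ^+ m = y'^-1 * [~ v, c]^-1 by rewrite def_vc mulKg.
    have cy : commute [~ v, c] y'^-1.
      by apply/commute_sym/plane_ext_Ycent; rewrite ?groupV // (subsetP sJQ) ?Jv.
    by rewrite mulgA cy mulgK groupV.
  apply: contra nxy => Jw; rewrite -vp.
  have [_ /(_ _ Jw)] := abelemP p_pr abJ.
  rewrite (plane_ext_expM Cxm Cv) ?C1S //.
  move/(canRL (mulgK _)); rewrite mul1g => ->.
  by rewrite groupV -!expgM mulnC expgM mem_cycle.
have C2w : w \in C2.
  apply/C2P; split=> // c'; have Qw := subsetP sC1Q w C1w.
  have : C / Y \subset 'C[coset Y w].
    rewrite defC quotientY ?(subset_trans _ nYQ) ?cycle_subG // join_subG.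
    rewrite quotient_cycle ?(subsetP nYQ) // cycle_subG -plane_ext_mod_cent // Ywc andbT.
    apply/subsetP=> _ /morphimP[q nYq Dq ->]; have [Cq Yq] := DP _ Dq.
    by rewrite -plane_ext_mod_cent ?(subsetP sCQ q Cq) // Yq.
  move=> cw Cc'; rewrite plane_ext_mod_cent ?(subsetP sCQ c' Cc') //.
  by apply: (subsetP cw); apply: mem_quotient.
have RC2 v1 v2 : v1 \in C2 -> v2 \in C2 -> [~ v1, v2] \in J.
  by move=> /(subsetP sC21) ? /(subsetP sC21); apply: C1S.
have pC2 : {in C2, forall v, v ^+ p \in Y} by move=> v /(subsetP sC21); apply: C1p.
have [v C2v vp] := plane_ext_pow_onto (subset_trans sC21 sC1C) RC2 pC2 stC2
  (ex_intro2 _ _ w C2w nJw) Yx.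
have [C1v Yv] := C2P _ C2v; have Cv := subsetP sC1C v C1v.
have Jxv : x * v^-1 \in J.
  apply: plane_ext_order_p; first by rewrite groupM ?groupV.
  by rewrite plane_ext_expM ?groupV // ?C1S ?groupV // expVgn vp mulgV.
case/negP: nYxc; rewrite -[x](mulgKV v) commMgJ.
have [_ /centP cc] := setIP Cc.
have /commgP/eqP -> := commute_sym (cc _ Jxv).
by rewrite conj1g mul1g Yv.
Qed.

(* Write [c0 = c^-1 * u(c)] with [u] moving [c ^+ p]: since [u] fixes [d] modulo [C]
   and acts trivially on [J / Y], it fixes [[c, d]] modulo [Y]. *)
Lemma plane_ext_pair u d (Z0 : {group gT}) : J \proper C -> u \in A -> d \in Q ->
    Z0 \subset Y -> {in Z0, forall z, u z = z} ->
    {in J, forall j, j^-1 * u j \in Y} -> {in Y, forall y, y^-1 * u y \in Z0} ->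
    (exists2 y, y \in Y & u y != y) -> {in J, forall j, [~ j, d] \in Z0} ->
  exists c, [/\ c \in C, c \notin J, c ^+ p \in Z0, [~ c, d] \in Y
               & {in C, forall c', [~ c, c'] \in Y}].
Proof.
move=> ltJC Au Qd sZ0Y fixZ0 uJ uY [y Yy uy] dZ0.
have Autu := subsetP sA u Au; have sC1C := plane_ext_top_sub.
have sC1Q := subset_trans sC1C sCQ.
have C1S v w : v \in C1 -> w \in C1 -> [~ v, w] \in J.
  by move=> /plane_ext_topP[_ Jv _] /(subsetP sC1Q); apply: Jv.
have C1p : {in C1, forall v, v ^+ p \in Y} by move=> v /plane_ext_topP[].
have [x C1x nJx] := plane_ext_top_nt ltJC.
have [c C1c cp] := plane_ext_pow_onto sC1C C1S C1p plane_ext_top_stable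
  (ex_intro2 _ _ x C1x nJx) Yy.
have Cc := subsetP sC1C c C1c; have Qc := subsetP sCQ c Cc.
have C1uc : u c \in C1 := perm_astabsP _ _ (subsetP plane_ext_top_stable u Au) c C1c.
have Cuc := subsetP sC1C _ C1uc; have Quc := subsetP sCQ _ Cuc.
have C1c' : c^-1 \in plane_ext_top_group by rewrite groupV.
have C1c0 : c^-1 * u c \in plane_ext_top_group by rewrite groupM.
have c0p : (c^-1 * u c) ^+ p = y^-1 * u y.
  rewrite (plane_ext_expM Cuc (groupVr Cc)) ?C1S //.
  by rewrite expVgn cp -(autX _ Autu) // cp.
exists (c^-1 * u c); split.
- exact: subsetP sC1C _ C1c0.
- apply: contra uy => Jc0; have [_ /(_ _ Jc0)] := abelemP p_pr abJ.
  by rewrite c0p => /(canRL (mulKVg _)) ->; rewrite mulg1.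
- by rewrite c0p uY.
- have cJ j z : j \in J -> z \in C -> j ^ z = j.
    by move=> Jj /setIP[_ /centP/(_ j Jj)/commute_sym] /commgP/conjg_fixP.
  have [_ Jc _] := plane_ext_topP _ C1c; have [_ Juc _] := plane_ext_topP _ C1uc.
  have [_ Jc' _] := plane_ext_topP _ C1c'.
  rewrite commMgJ (cJ _ _ (Jc' d Qd) Cuc).
  have -> : [~ c^-1, d] = [~ c, d]^-1.
    apply: (mulIg [~ c, d]); rewrite mulVg -{1}(cJ [~ c^-1, d] c) ?Jc' //.
    by rewrite -commMgJ mulVg comm1g.
  have Cd' : d^-1 * u d \in C.
    have Qud : u d \in Q by rewrite Aut_closed.
    have nCd : d \in 'N(C).
      rewrite inE; apply/subsetP=> _ /imsetP[z /setIP[Qz cz] ->].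
      rewrite inE groupJ //=; apply/centP=> j Jj.
      have Jjd : j ^ d^-1 \in J.
        by rewrite memJ_norm // groupV (subsetP (normal_norm nsJQ)).
      apply/commgP; rewrite -[j](conjgKV d) -conjRg.
      by have /commgP/eqP -> := centP cz _ Jjd; rewrite conj1g.
    suffices : u d * d^-1 \in C by rewrite -(memJ_norm _ nCd) conjgE mulgKV.
    rewrite inE groupM ?groupV //=; apply/centP=> j Jj; apply/commute_sym/commgP/conjg_fixP.
    have Juj : u^-1 j \in J.
      by apply: (perm_astabsP _ _ (subsetP stJ u^-1 _)); rewrite ?groupV.
    set j1 := u^-1 j in Juj; have def_j : j = u j1 by rewrite /j1 permKV.
    have Yj1 := uJ j1 Juj; rewrite -def_j in Yj1.
    have Rj : [~ j, u d] = [~ j, d].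
      rewrite {1}def_j -(autR Autu) ?(subsetP sJQ j1 Juj) // fixZ0 ?dZ0 //.
      rewrite -[j](mulKVg j1) commMgJ (_ : [~ j1^-1 * j, d] = 1).
        have [_ cYj] := setIP (subsetP sYZ _ Yj1).
        rewrite mulg1; apply/esym/conjg_fixP/commgP/commute_sym/(centP cYj).
        by rewrite groupR // (subsetP sJQ).
      by apply/eqP/commgP; apply: plane_ext_Ycent.
    rewrite conjgM; apply: (canLR (conjgK d)).
    by rewrite -[j ^ u d](mulKVg j) -commgEl Rj commgEl mulKVg.
  (* As [u d = d * k], [[~ u c, d]] is [u [~ c, d]] corrected by [[~ u c, k]], which lies in [Y]
     because [k] is in [C]. *)
  set k := d^-1 * u d in Cd'; have Yk : [~ u c, k] \in Y by apply: plane_ext_top_comm.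
  have -> : [~ u c, d] = [~ u c, k]^-1 * u [~ c, d].
    rewrite (autR Autu) // -[u d](mulKVg d) -/k (commgMJ _ d k) mulKg.
    by rewrite (cJ _ _ (Juc d Qd) Cd').
  have ce : commute [~ c, d]^-1 [~ u c, k]^-1.
    apply/commute_sym/plane_ext_Ycent; rewrite ?groupV //.
    exact: subsetP sJQ _ (Jc d Qd).
  by rewrite mulgA ce -mulgA groupM ?groupV ?uJ ?Jc.
move=> c' Cc'; exact: plane_ext_top_comm.
Qed.

End PlaneExtension.

(** * Groups of order p^4 and sections of rank four *)

Section RankFour.
Variables (gT : finGroupType) (p : nat) (S : {group gT}).
Hypotheses (p_pr : prime p) (odd_p : odd p) (pS : p.-group S).
Hypothesis rkS : forall Q : {group gT}, Q \subset S -> 'm(Q) <= 3.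
Implicit Types (V J Y M : {group gT}).

(** [V] and [J] commute modulo [Y], which is central in the join; so the join has class at most two
    and exponent p, and exceeding [V] it cannot have order p^3. *)
Lemma join_plane V J Y : V \subset S -> J \subset S -> p.-abelem V -> p.-abelem J ->
    #|V| = (p ^ 3)%N -> #|J| = (p ^ 3)%N -> #|Y| = (p ^ 2)%N ->
    Y \subset V -> Y \subset J -> [~: V, J] \subset Y -> ~~ (J \subset V) ->
  [/\ exponent (V <*> J) %| p, #|V <*> J| = (p ^ 4)%N, #|(V <*> J)^`(1)| = p
    & (V <*> J)^`(1) \subset Y].
Proof.
move=> sVS sJS abV abJ oV oJ oY sYV sYJ RVJ nsJV.
pose M := (V <*> J)%G.
have [cV cJ] := (abelem_abelian abV, abelem_abelian abJ).
have cYM : M \subset 'C(Y).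
  by rewrite join_subG (subset_trans cV) ?centS //= (subset_trans cJ) ?centS.
have sMS : M \subset S by rewrite join_subG sVS.
have pM := pgroupS sMS pS.
have nYM : M \subset 'N(Y) := subset_trans cYM (cent_sub Y).
have [nYV nYJ] : V \subset 'N(Y) /\ J \subset 'N(Y).
  by apply/andP; rewrite -join_subG.
have sM'Y : M^`(1) \subset Y.
  apply: der1_min => //; rewrite /= quotientY // abelianY !quotient_abelian //=.
  by rewrite quotient_cents2 // commGC.
have expM : exponent M %| p.
  have -> : M :=: 'Ohm_1(M).
    apply/eqP; rewrite eqEsubset Ohm_sub andbT join_subG.
    rewrite -{1}(Ohm1_id abV) -{1}(Ohm1_id abJ).
    by rewrite !OhmS ?joing_subl ?joing_subr.
  apply: exponent_Ohm1_class2 => //; rewrite nil_class2 (subset_trans sM'Y) //.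
  by rewrite subsetI (subset_trans sYV) ?joing_subl //= centsC.
have ltVM : V \proper M by rewrite properE joing_subl join_subG subxx.
have ltYM : Y \proper M by rewrite (sub_proper_trans sYV).
have [oM | [oM oM']] := plane_card p_pr pS rkS sMS expM ltYM cYM oY sM'Y; last by split.
by have := proper_card ltVM; rewrite oV oM ltnn.
Qed.

(** [M <*> <[c]>] modulo [M'] would be elementary abelian of order at least p^4. *)
Lemma rank4_contra M c : M \subset S -> #|M| = (p ^ 4)%N -> #|M^`(1)| = p ->
    exponent M %| p -> M^`(1) \subset 'C(M) -> c \in S -> c \in 'C(M^`(1)) -> c \notin M ->
    {in M, forall m, [~ m, c] \in M^`(1)} -> c ^+ p \in M^`(1) ->
  False.
Proof.
move=> sMS oM oM' expM cM' Sc cc nMc Rc cp; have p_gt1 := prime_gt1 p_pr.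
pose Z0 := M^`(1)%G; pose K := (M <*> <[c]>)%G.
have sKS : K \subset S by rewrite join_subG sMS cycle_subG.
have nZM : M \subset 'N(Z0) by rewrite /= gFnorm.
have nZc : c \in 'N(Z0) := subsetP (cent_sub _) c cc.
have nZK : K \subset 'N(Z0) by rewrite join_subG nZM cycle_subG.
have sZM : Z0 \subset M := der_sub 1 M.
have sMK : M \subset K := joing_subl _ _.
have nsZK : Z0 <| K by rewrite /normal (subset_trans sZM).
have abK : p.-abelem (K / Z0).
  have cMc : <[c]> / Z0 \subset 'C(M / Z0).
    rewrite quotient_cycle // cycle_subG; apply/centP=> _ /morphimP[m nZm Mm ->].
    apply/commute_sym/commgP; rewrite -morphR //.
    by apply/eqP/coset_id; apply: Rc.
  have defK : (M / Z0) \* (<[c]> / Z0) = K / Z0.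
    by rewrite cprodEY // quotientY // cycle_subG.
  rewrite (cprod_abelem p defK) quotient_cycle // cycle_abelem ?p_pr ?orbT //.
  rewrite order_dvdn -morphX //= (coset_id cp) eqxx andbT.
  rewrite abelemE // sub_der1_abelian //= (dvdn_trans _ expM) //.
  by apply/exponentP=> _ /morphimP[m nZm Mm ->]; rewrite -morphX // expg_exponent ?morph1.
have := abelem_section_index p_pr rkS sKS nsZK abK.
rewrite -divgS ?normal_sub //= oM' leqNgt => /negP[].
have pK := pgroupS sKS pS.
have : p ^ 5 <= #|K|.
  rewrite dvdn_leq // (pgroup_index_dvd p_pr pK) // -oM proper_card //.
  rewrite properE sMK /=; apply: contra nMc => /subsetP-> //.
  by rewrite mem_gen // inE cycle_id orbT.
move=> le5; rewrite (leq_trans (_ : p ^ 3 < p ^ 4)) ?ltn_exp2l //.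
by rewrite leq_divRL ?prime_gt0 // -expnSr.
Qed.

End RankFour.

(** Written as a preimage so that it is a group without side conditions; [cent_modP] gives the
    commutator form when [W] is normalized. *)
Definition cent_mod (gT : finGroupType) (P W X : {group gT}) :=
  (P :&: (coset W @*^-1 'C(X / W)))%G.

Lemma cent_modP (gT : finGroupType) (P W X : {group gT}) q :
    P \subset 'N(W) -> X \subset 'N(W) ->
  reflect (q \in P /\ {in X, forall x, [~ x, q] \in W}) (q \in cent_mod P W X).
Proof.
move=> nWP nWX; have memq : q \in P -> (q \in cent_mod P W X) = (coset W q \in 'C(X / W)).
  by move=> Pq; rewrite in_setI Pq in_setI (subsetP nWP q Pq) inE.
apply: (iffP idP) => [Kq | [Pq Wq]].
  have Pq : q \in P by case/setIP: Kq.
  split=> // x Xx; rewrite memq // in Kq.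
  rewrite (comm_mod_cent1 (subsetP nWX x Xx) (subsetP nWP q Pq)); apply/cent1P.
  by apply: (centP Kq); apply: mem_quotient.
rewrite memq //; apply/centP=> _ /morphimP[x nWx Xx ->].
by have := Wq x Xx; rewrite (comm_mod_cent1 nWx (subsetP nWP q Pq)) => /cent1P.
Qed.

(* The only position of a rank-three [M = p^(1+2) x p] in [E] compatible with the
   rank bound: otherwise [E / 'C_E(M)] would have order [p ^ 4]. *)
Section PlaneInGroup.
Variables (gT : finGroupType) (p : nat) (S : {group gT}).
Hypotheses (p_pr : prime p) (pS : p.-group S).
Hypothesis rkS : forall Q : {group gT}, Q \subset S -> 'm(Q) <= 3.
Variables (E M Y : {group gT}).
Hypotheses (sES : E \subset S) (sME : M \subset E) (expM : exponent M %| p).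
Hypotheses (ltYM : Y \proper M) (cYE : E \subset 'C(Y)) (oY : #|Y| = (p ^ 2)%N).
Hypotheses (RM : [~: M, E] \subset Y) (oM : #|M| = (p ^ 4)%N) (oM' : #|M^`(1)| = p).

Let p_gt1 : 1 < p := prime_gt1 p_pr.
Let p_gt0 : 0 < p := prime_gt0 p_pr.
Let pE : p.-group E := pgroupS sES pS.
Let sMS := subset_trans sME sES.
Let cYM := subset_trans sME cYE.
Let sYM := proper_sub ltYM.
Let sYE := subset_trans sYM sME.
Let sM'Y : M^`(1) \subset Y := subset_trans (commgS M sME) RM.
Let plane : forall x, x \in M :\: Y -> 'C_M[x] = Y <*> <[x]> /\ #|'C_M[x]| = (p ^ 3)%N
  := plane_cent1 p_pr pS rkS sMS expM ltYM cYM oY.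
Let RMe : forall x e, x \in M -> e \in E -> [~ x, e] \in Y.
Proof. by move=> x e Mx Ee; rewrite (subsetP RM) ?mem_commg. Qed.
Let Yexp : forall y, y \in Y -> y ^+ p = 1.
Proof. by move=> y Yy; apply: (exponentP expM); apply: (subsetP sYM). Qed.

(** [E / 'C_E(M)] is elementary abelian, so of order at most p^3, and the image of [M], of order
    [#|M : Y| = p ^ 2], lies in the part centralizing [M] modulo [M']. *)
Lemma plane_centralizer_index : #|E : cent_mod E M^`(1) M| <= p.
Proof.
pose D := ('C_E(M))%G; have sDE : D \subset E := subsetIl _ _.
have cMe x : x \in M -> E^`(1) \subset 'C[x] /\ {in E, forall e, e ^+ p \in 'C[x]}.
  move=> Mx; apply: central_comm_cent1; first exact: subsetP sME x Mx.
  move=> e Ee; have Yr := RMe Mx Ee; split; last exact: Yexp.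
  by apply: subsetP Yr; rewrite centsC.
have sE'D : E^`(1) \subset D.
  rewrite subsetI der_sub; apply/subsetP=> e E'e; apply/centP=> x Mx.
  exact/cent1P/(subsetP (cMe x Mx).1).
have nsDE : D <| E := sub_der1_normal sE'D sDE.
have abD : p.-abelem (E / D).
  apply/abelemP=> //; split; first exact: sub_der1_abelian.
  move=> _ /morphimP[e nDe Ee ->]; rewrite -morphX //; apply: coset_id.
  rewrite inE groupX //=; apply/centP=> x Mx.
  exact/cent1P/((cMe x Mx).2 e Ee).
have leD := abelem_section_index p_pr rkS sES nsDE abD.
have nDM : M \subset 'N(D) := subset_trans sME (normal_norm nsDE).
have sMDE : M <*> D \subset E by rewrite join_subG sME.
have MD : M :&: D = Y.
  apply/eqP; rewrite eqEsubset; apply/andP; split; last first.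
    by rewrite subsetI sYM subsetI sYE centsC.
  apply/subsetP=> x /setIP[Mx /setIP[_ cMx]]; apply/negPn/negP=> nYx.
  have [|_] := plane (x := x); first by rewrite inE nYx.
  rewrite (setIidPl _) ?sub_cent1 // oM => /eqP.
  by rewrite eqn_exp2l.
have nZE : E \subset 'N(M^`(1)%G).
  by rewrite (subset_trans _ (cent_sub _)) // (subset_trans cYE) ?centS.
have nZM := subset_trans sME nZE.
have sMD1 : M <*> D \subset cent_mod E M^`(1)%G M.
  rewrite join_subG; apply/andP; split; apply/subsetP=> x.
    move=> Mx; apply/cent_modP=> //; split; first exact: subsetP sME x Mx.
    by move=> y My; rewrite mem_commg.
  case/setIP=> Ex cx; apply/cent_modP=> //; split=> // y My.
  by have /commgP/eqP -> := commute_sym (centP cx y My); apply: group1.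
have iMD : (#|M <*> D : D| = p ^ 2)%N.
  have := mul_cardG M D; rewrite MD oY oM -norm_joinEl // => e.
  apply/eqP; rewrite -(@eqn_pmul2l (#|D| * p ^ 2)) ?muln_gt0 ?cardG_gt0 ?expn_gt0 ?p_gt0 //.
  rewrite mulnAC Lagrange ?joing_subr // -e -mulnA -expnD mulnC //.
rewrite -(leq_pmul2r (_ : 0 < p ^ 2)) ?expn_gt0 ?p_gt0 // -{1}iMD.
apply: leq_trans (leq_mul (dvdn_leq _ (indexgS E sMD1)) (leqnn _)) _.
  by rewrite indexg_gt0.
by rewrite Lagrange_index ?joing_subr // -expnS.
Qed.

(** If [E] does not centralize [M / M'], then [E = E1 <*> <[e]>], and commutation with [e] maps
    [M / Y], of order p^2, to [Y / M'], of order p. An element outside [Y] in the kernel is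
    centralized modulo [M'] by all of [E]. *)
Lemma plane_centralizer_nt : ~~ (cent_mod M M^`(1) E \subset Y) \/
  {in M & E, forall x e, [~ x, e] \in M^`(1)}.
Proof.
have nZE : E \subset 'N(M^`(1)%G).
  by rewrite (subset_trans _ (cent_sub _)) // (subset_trans cYE) ?centS.
have nZM := subset_trans sME nZE.
pose E1 := cent_mod E M^`(1)%G M.
have sE1E : E1 \subset E := subsetIl _ _.
have [sEE1 | /subsetPn[e Ee nE1e]] := boolP (E \subset E1).
  right=> x e Mx Ee; have /cent_modP[] // := subsetP sEE1 e Ee.
  by move=> _; apply.
left; apply/negP=> sM0Y.
have defE : E = E1 <*> <[e]> :> {set gT}.
  have sK : E1 <*> <[e]> \subset E by rewrite join_subG sE1E cycle_subG.
  have pK := pgroupS sK pE.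
  apply/esym/eqP; rewrite eqEcard sK -(Lagrange sE1E).
  apply: leq_trans (leq_mul (leqnn _) plane_centralizer_index) _.
  have [i oE1] := p_natP (pgroupS sE1E pE); rewrite [#|E1|]oE1 -expnSr dvdn_leq //.
  apply: (pgroup_index_dvd p_pr pK); rewrite -oE1 proper_card // properE joing_subl.
  by apply: contra nE1e => /subsetP-> //; rewrite mem_gen // inE cycle_id orbT.
have [x1 Mx1 nZx1] : exists2 x, x \in M & [~ x, e] \notin M^`(1).
  apply/exists_inP; rewrite -negb_forall_in; apply: contra nE1e => /forall_inP h.
  by apply/cent_modP.
have nYx1 : x1 \notin Y.
  apply: contra nZx1 => Yx1; have /commgP/eqP -> : commute x1 e.
    by apply: commute_sym; apply: (centsP cYE).
  exact: group1.
have [defC oC] : 'C_M[x1] = Y <*> <[x1]> /\ #|'C_M[x1]| = (p ^ 3)%N.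
  by apply: plane; rewrite inE nYx1.
have /subsetPn[x2 Mx2 nCx2] : ~~ (M \subset Y <*> <[x1]>).
  apply/negP=> /subset_leq_card; rewrite -defC oC oM leqNgt ltn_exp2l //.
have Yr1 := RMe Mx1 Ee; have Yr2 := RMe Mx2 Ee.
have abY : abelian Y := subset_trans sYE cYE.
have defY : Y = M^`(1) <*> <[[~ x1, e]]> :> {set gT}.
  have sK : M^`(1) <*> <[[~ x1, e]]> \subset Y by rewrite join_subG sM'Y cycle_subG.
  have pK := pgroupS (subset_trans sK sYE) pE.
  apply/esym/eqP; rewrite eqEcard sK oY dvdn_leq //.
  apply: (pgroup_index_dvd p_pr pK); rewrite expn1 -{1}oM' proper_card // properE joing_subl.
  by apply: contra nZx1 => /subsetP-> //; rewrite mem_gen // inE cycle_id orbT.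
have : [~ x2, e]^-1 \in Y by rewrite groupV.
rewrite {1}defY cent_joinEr; last first.
  by rewrite (centSS _ sM'Y abY) // cycle_subG.
case/mulsgP=> z _ Zz /cycleP[m ->] def_r.
have cY y g : y \in Y -> g \in E -> y ^ g = y.
  by move=> Yy Eg; apply/conjg_fixP/commgP/commute_sym; apply: (centsP cYE).
have Mx1m : x1 ^+ m \in M by rewrite groupX.
(* [m] cancels [[~ x2, e]] modulo [M']; [x2] outside [Y <*> <[x1]>] keeps [w] out of [Y]. *)
pose w := x2 * x1 ^+ m; have Mw : w \in M by rewrite groupM.
have Zwe : [~ w, e] \in M^`(1).
  rewrite commMgJ cY ?(subsetP sME) // commXg; last first.
    by apply: (centsP cYE) => //; apply: subsetP sME _ Mx1.
  have -> : [~ x1, e] ^+ m = z^-1 * [~ x2, e]^-1 by rewrite def_r mulKg.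
  have cz : commute [~ x2, e] z^-1.
    by apply: (centsP abY) => //; rewrite groupV (subsetP sM'Y).
  by rewrite mulgA cz mulgK groupV.
have nYw : w \notin Y.
  apply: contra nCx2 => Yw; have -> : x2 = w * x1 ^- m by rewrite mulgK.
  by rewrite groupM ?groupV ?groupX // mem_gen // inE ?Yw ?cycle_id ?orbT.
case/negP: nYw; apply: (subsetP sM0Y); apply/cent_modP=> //; split=> // g Eg.
have nZw := subsetP nZM w Mw; have nZg := subsetP nZE g Eg.
rewrite -groupV invg_comm comm_mod_cent1 //.
suffices /subsetP -> : E / M^`(1) \subset 'C[coset M^`(1)%G w] => //.
  exact: mem_quotient.
rewrite defE quotientY ?(subset_trans sE1E) ?cycle_subG ?(subsetP nZE) // join_subG.
rewrite quotient_cycle ?(subsetP nZE) // cycle_subG -comm_mod_cent1 ?(subsetP nZE e) // Zwe andbT.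
apply/subsetP=> _ /morphimP[h nZh E1h ->]; rewrite -comm_mod_cent1 //.
by have /cent_modP[] // := E1h; move=> _; apply.
Qed.

End PlaneInGroup.

(** * The two positions of [J] relative to [E] *)

Section MoverCases.
Variables (gT : finGroupType) (p : nat) (S : {group gT}) (F : fsys gT).
Hypotheses (p_pr : prime p) (odd_p : odd p) (pS : p.-group S) (satF : saturated F S p).
Hypothesis rkS : forall Q : {group gT}, Q \subset S -> 'm(Q) <= 3.
Variables E Q J : {group gT}.
Hypothesis essE : essential_like p F S E.
Implicit Types (P R X V : {group gT}) (f : {ffun gT -> gT}) (a b : {perm gT}).

Let fusF : is_fusion_system S F := satF.1.
Local Notation N := 'N_S(E).
Local Notation R := 'N_S(Q).
Local Notation A := (autF F Q).
Local Notation Z := 'Ohm_1('Z(S)).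
Local Notation Y := 'Ohm_1('Z(Q)).
Local Notation C := 'C_Q(J).

Hypotheses (sNQ : N \subset Q) (sQS : Q \subset S) (fnQ : fully_normalized F S Q).
Hypothesis mvQ : ~~ (A \subset 'N(Z | 'P)).
Hypothesis maxQ : forall (P : {group gT}) f, P \subset S -> F P f ->
  #|Q| < #|P| -> N \subset P -> f @: Z = Z.
Hypotheses (sYJ : Y \subset J) (nsJQ : J <| Q) (abJ : p.-abelem J).
Hypotheses (oJ : #|J| = (p ^ 3)%N) (stJ : A \subset 'N(J | 'P)).

Let p_gt1 : 1 < p := prime_gt1 p_pr.
Let p_gt0 : 0 < p := prime_gt0 p_pr.
Let sES : E \subset S := ess_sub essE.
Let sEN : E \subset N := ess_sub_normalizer essE.
Let pQ : p.-group Q := pgroupS sQS pS.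
Let sEQ : E \subset Q := subset_trans sEN sNQ.
Let pE : p.-group E := pgroupS sES pS.
Let sRS : R \subset S := subsetIl _ _.
Let pR : p.-group R := pgroupS sRS pS.
Let sA : A \subset Aut Q := autF_sub F Q.
Let oZ : #|Z| = p.
Proof. by case: (mover_orders p_pr odd_p pS satF rkS essE sNQ sQS mvQ). Qed.
Let oY : #|Y| = (p ^ 2)%N.
Proof. by case: (mover_orders p_pr odd_p pS satF rkS essE sNQ sQS mvQ). Qed.
Let irr := mover_irr p_pr odd_p pS satF rkS essE sNQ sQS fnQ mvQ maxQ.
Let trans := mover_transitive p_pr odd_p pS satF rkS essE sNQ sQS fnQ mvQ maxQ.
Let moving := mover_proper pS satF essE sNQ sQS fnQ mvQ maxQ.
Let stsub := mover_stable_sub p_pr odd_p pS satF rkS essE sNQ sQS fnQ mvQ maxQ.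
Let sYZN := mover_plane_normalizer essE sNQ sQS.
Let sYE := mover_plane_sub essE sNQ sQS.
Let sZY : Z \subset Y := mover_Z_plane pS essE sNQ sQS.
Let sYZ : Y \subset 'Z(Q) := Ohm_sub 1 _.
Let sYQ : Y \subset Q := subset_trans sYZ (center_sub Q).
Let cYQ : Q \subset 'C(Y).
Proof. by rewrite centsC (subset_trans sYZ) ?subsetIr. Qed.
Let abY : p.-abelem Y := abelemS sYJ abJ.
Let stY : A \subset 'N(Y | 'P) := mover_plane_stable F Q.
Let sJQ : J \subset Q := normal_sub nsJQ.
Let cJJ : abelian J := abelem_abelian abJ.
Let sJC : J \subset C.
Proof. by rewrite subsetI sJQ. Qed.
Let sCQ : C \subset Q := subsetIl _ _.
Let sQR : Q \subset R.
Proof. by rewrite subsetI sQS normG. Qed.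

Let genJ := plane_ext_gen p_pr oY sYJ abJ oJ.
Let cent1J := plane_ext_cent1 p_pr oY sYJ abJ oJ.
Let RJ : forall j q, j \in J -> q \in Q -> [~ j, q] \in Y
  := plane_ext_comm_in p_pr pS sQS oY sYJ nsJQ oJ.
Let iC : #|Q : C| = (p ^ 2)%N
  := plane_ext_cent_index p_pr pS sQS sA oY stsub sYJ nsJQ abJ oJ stJ.
Let stC := plane_ext_cent_stable sA nsJQ stJ.

Lemma mover_normal_stable X : X \subset Q -> A \subset 'N(X | 'P) -> X <| R.
Proof.
move=> sXQ stX; rewrite /normal (subset_trans sXQ) //.
by apply/subsetP=> x; apply: (autF_stable_conj fusF sQS).
Qed.

Lemma mover_j0 : exists2 j, j \in J & j \notin Y.
Proof.
by apply/subsetPn/negP=> /subset_leq_card; rewrite oY oJ leqNgt ltn_exp2l.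
Qed.

Lemma mover_J_normalizer : J \subset N.
Proof.
apply/subsetP=> j Jj; rewrite inE (subsetP sQS) ?(subsetP sJQ) //= inE.
apply/subsetP=> _ /imsetP[e Ee ->]; rewrite conjg_mulR groupM //.
by rewrite (subsetP sYE) // -groupV invg_comm RJ // (subsetP sEQ).
Qed.

Lemma mover_gen_p g X : #|X| = p -> g \in X -> g != 1 -> X :=: <[g]>.
Proof.
move=> oX Xg ntg; apply/esym/eqP; rewrite eqEcard cycle_subG Xg oX -orderE.
have : #[g] %| p by rewrite -oX order_dvdG.
by case/primeP: p_pr => _ /[apply]; rewrite order_eq1 (negPf ntg) => /eqP->; rewrite leqnn.
Qed.

(** [u] is conjugation by some [r] in [R] outside [Q], transported by an [al] in [A] carrying [Z] to
    [Z0]; [r] centralizes [Z], [Y / Z] and [J / Y], but not [Y]. *)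
Lemma mover_unipotent (Z0 : {group gT}) : Z0 \subset Y -> #|Z0| = p ->
  exists u, [/\ u \in A, {in Z0, forall z, u z = z},
    {in J, forall j, j^-1 * u j \in Y}, {in Y, forall y, y^-1 * u y \in Z0}
  & exists2 y, y \in Y & u y != y].
Proof.
move=> sZ0Y oZ0; have [al Aal alZ] := trans sZ0Y oZ0.
have [r [Rr nQr ncYr]] := moving; have [Sr nQr'] := setIP Rr.
have Al := subsetP sA al Aal.
have Aal' : al^-1 \in A by rewrite groupV.
pose u := conj_aut Q r ^ al.
have uE q : q \in Q -> u q = al ((al^-1 q) ^ r).
  move=> Qq; rewrite conjgE !permM norm_conj_autE //.
  by rewrite Aut_closed // groupV.
have Z0al z : z \in Z0 -> al^-1 z \in Z.
  by rewrite -alZ => /imsetP[x Zx ->]; rewrite permK.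
have mv X x : A \subset 'N(X | 'P) -> x \in X -> al^-1 x \in X.
  by move=> stX; apply: perm_astabsP (subsetP stX _ Aal') x.
have mvV X x : A \subset 'N(X | 'P) -> x \in X -> al x \in X.
  by move=> stX; apply: perm_astabsP (subsetP stX _ Aal) x.
have uR x : x \in Q -> x^-1 * u x = al [~ al^-1 x, r].
  move=> Qx; have Qx' : al^-1 x \in Q by rewrite Aut_closed // groupV.
  rewrite uE // commgEl -{1}(permKV al x) -(autV Al) //.
  by rewrite -(autM Al) ?groupV ?memJ_norm.
have nsYR := mover_normal_stable sYQ stY.
have nsJR := mover_normal_stable sJQ stJ.
have cZR : Z \subset 'C(R) :=
  subset_trans (subset_trans (Ohm_sub 1 _) (subsetIr _ _)) (centS sRS).
have nsZR : Z <| R.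
  rewrite /normal (subset_trans sZY (subset_trans sYQ sQR)).
  by rewrite cents_norm // centsC.
exists u; split.
- by rewrite groupJ // (autF_conj fusF).
- move=> z Z0z; rewrite uE ?(subsetP sYQ) ?(subsetP sZ0Y) //.
  have -> : (al^-1 z) ^ r = al^-1 z.
    by apply/conjg_fixP/commgP; apply: (centsP cZR) => //; apply: Z0al.
  by rewrite permKV.
- move=> j Jj; rewrite uR ?(subsetP sJQ) //; apply: mvV => //.
  have iJY := plane_ext_index p_pr oY sYJ oJ.
  by rewrite (subsetP (index_p_comm p_pr pR nsYR nsJR sYJ iJY)) // mem_commg // mv.
- move=> y Yy; rewrite uR ?(subsetP sYQ) // -alZ imset_f //.
  rewrite (subsetP (index_p_comm p_pr pR nsZR nsYR sZY _)) ?mem_commg ?mv //.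
  by rewrite -divgS // oY oZ (expnS p 1) expn1 mulnK.
have [y Yy ncy] : exists2 y, y \in Y & [~ y, r] != 1.
  apply/exists_inP; rewrite -negb_forall_in; apply: contra ncYr => /forall_inP c.
  by apply/centP=> y Yy; apply/commute_sym/commgP; apply: c.
exists (al y); first exact: mvV.
rewrite uE ?(subsetP sYQ) ?mvV // permK (inj_eq perm_inj).
by apply: contra ncy => /eqP/conjg_fixP.
Qed.

(* [<[d]> <*> C] is the preimage of [Z0] under [q |-> [J, q]]; for [Z0 = Z] it is
   invariant under all of ['N_S(Q)]. *)
Lemma mover_normal_line d (Z0 : {group gT}) : d \in Q -> d \notin C ->
    Z0 \subset Y -> #|Z0| = p -> {in J, forall j, [~ j, d] \in Z0} ->
  (forall q, q \in Q -> {in J, forall j, [~ j, q] \in Z0} -> q \in <[d]> <*> C) /\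
  (exists2 a, a \in A & R \subset 'N(a @: (<[d]> <*> C))).
Proof.
move=> Qd nCd sZ0Y oZ0 dZ0; have [j Jj nYj] := mover_j0.
have ntjd : [~ j, d] != 1.
  apply: contra nCd => /commgP cjd; rewrite -(cent1J Jj nYj) inE Qd /=.
  exact/cent1P/commute_sym.
have inK q : q \in Q -> {in J, forall j, [~ j, q] \in Z0} -> q \in <[d]> <*> C.
  move=> Qq qZ0; have := qZ0 j Jj; rewrite (mover_gen_p oZ0 (dZ0 j Jj) ntjd).
  case/cycleP=> i jq.
  have cjd : commute d [~ j, d].
    by apply/commute_sym/(centP (subsetP (subset_trans sYZ (subsetIr _ _)) _ (RJ Jj Qd))).
  rewrite -commgX // in jq.
  suffices Cq : q * d ^- i \in C.
    rewrite -[q](mulgKV (d ^+ i)) groupM //; last by rewrite mem_gen // inE mem_cycle.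
    by rewrite mem_gen // inE Cq orbT.
  rewrite -(cent1J Jj nYj) inE groupM ?groupV ?groupX //=.
  apply/cent1P/commute_sym/commgP/conjg_fixP; rewrite conjgM.
  by rewrite -[j ^ q](mulKVg j) -commgEl jq commgEl mulKVg conjgK.
split=> //; have [a Aa aZ] := trans sZ0Y oZ0.
have Aa' : a^-1 \in A by rewrite groupV.
have Auta := subsetP sA a Aa; have Auta' := subsetP sA _ Aa'.
exists a^-1 => //; apply/subsetP=> r Rr; have [Sr nQr] := setIP Rr.
have sKQ : <[d]> <*> C \subset Q by rewrite join_subG cycle_subG Qd.
have KZ0 q : q \in <[d]> <*> C -> {in J, forall j, [~ j, q] \in Z0}.
  have cZ0Q : Q \subset 'C(Z0) by rewrite (subset_trans cYQ) ?centS.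
  have nZQ : Q \subset 'N(Z0) := subset_trans cZ0Q (cent_sub Z0).
  have nZJ := subset_trans sJQ nZQ; have nZK := subset_trans sKQ nZQ.
  suffices RK : [~: J, <[d]> <*> C] \subset Z0.
    by move=> Kq i Ji; rewrite (subsetP RK) ?mem_commg.
  rewrite commGC -quotient_cents2 // quotientY ?(subset_trans sCQ) //; last first.
    by rewrite cycle_subG (subsetP nZQ).
  rewrite join_subG [X in _ && X]quotient_cents ?subsetIr // andbT.
  rewrite quotient_cycle ?(subsetP nZQ) // cycle_subG.
  apply/centP=> _ /morphimP[i nZi Ji ->]; apply/commute_sym/commgP.
  by rewrite -morphR ?(subsetP nZQ d Qd) //; apply/eqP/coset_id/dZ0.
have nsJR := mover_normal_stable sJQ stJ.
rewrite inE; apply/subsetP=> _ /imsetP[_ /imsetP[q Kq ->] ->].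
have Qq := subsetP sKQ q Kq.
have Qa'q : a^-1 q \in Q by rewrite Aut_closed.
have Qq' : (a^-1 q) ^ r \in Q by rewrite memJ_norm.
apply/imsetP; exists (a ((a^-1 q) ^ r)); last by rewrite permK.
apply: inK; first by rewrite Aut_closed.
move=> i Ji; rewrite -(permKV a i).
have Ja'i : a^-1 i \in J := perm_astabsP _ _ (subsetP stJ _ Aa') i Ji.
rewrite -(autR Auta) ?(subsetP sJQ _ Ja'i) // -aZ imset_f //.
set i1 := a^-1 i in Ja'i *.
have Ji2 : i1 ^ r^-1 \in J by rewrite memJ_norm // groupV (subsetP (normal_norm nsJR)).
have -> : [~ i1, (a^-1 q) ^ r] = [~ i1 ^ r^-1, a^-1 q] ^ r.
  by rewrite conjRg conjgKV.
have Zz : [~ i1 ^ r^-1, a^-1 q] \in Z.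
  have Jai2 : a (i1 ^ r^-1) \in J := perm_astabsP _ _ (subsetP stJ a Aa) _ Ji2.
  have := KZ0 q Kq _ Jai2; rewrite -aZ => /imsetP[z Zz e].
  have : a [~ i1 ^ r^-1, a^-1 q] = a z.
    by rewrite (autR Auta) ?permKV // (subsetP sJQ _ Ji2).
  by move/perm_inj=> ->.
have cZr : commute [~ i1 ^ r^-1, a^-1 q] r.
  by have := subsetP (subset_trans (Ohm_sub 1 _) (subsetIr _ _)) _ Zz => /centP; apply.
by rewrite (_ : _ ^ r = [~ i1 ^ r^-1, a^-1 q]) //; apply/conjg_fixP/commgP.
Qed.

(** Otherwise [J] is central in [E] and the constant chain at [J] gives [C = E]; but [C] is
    [A]-invariant, hence normal in [R], so [R <= N <= Q]. *)
Lemma mover_not_sub_cent : ~~ (E \subset C).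
Proof.
apply/negP=> sEC; have [_ cEE _ _ _] := essE.
have sJE : J \subset E.
  by rewrite (subset_trans _ cEE) // subsetI (subset_trans sJQ) // centsC (subset_trans sEC) ?subsetIr.
have sJZ : J \subset 'Z(E).
  by rewrite subsetI sJE centsC (subset_trans sEC) ?subsetIr.
have [_ _ stJE faJ] := ess_rank3_center p_pr odd_p pS rkS essE abJ oJ sJZ.
have defC : C = E.
  apply: (nilpotent_sub_norm (pgroup_nil (pgroupS sCQ pQ)) sEC).
  apply/subsetP=> n /setIP[/setIP[Qn cJn] nEn].
  apply: (ess_chain pS satF essE (X1 := J) (X2 := J)) => //.
    by rewrite inE (subsetP sQS).
  move=> x Jx; suffices /commgP/eqP -> : commute x n by apply: group1.
  exact/commute_sym/(centP cJn).
have nER : R \subset 'N(E).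
  by rewrite /= -defC normal_norm // mover_normal_stable.
have [r [Rr /negP nQr _]] := moving; apply: nQr; apply: (subsetP sNQ).
by rewrite inE (subsetP sRS r Rr) (subsetP nER).
Qed.

Lemma mover_chain_plane n : autF F E \subset 'N(Y | 'P) -> n \in Q -> n \in N ->
  {in E, forall e, [~ e, n] \in Y} -> n \in E.
Proof.
move=> stYE Qn Nn cE; apply: (ess_chain pS satF essE sYE (subxx E)) => //.
- by apply/subsetP=> a /(subsetP (autF_sub F E)) Aa; apply/perm_astabsP=> x; apply: Aut_closed.
- exact: subsetP cYQ n Qn.
Qed.

Lemma mover_normal_plane c : c \in Q -> {in E, forall e, [~ e, c] \in Y} -> c \in N.
Proof.
move=> Qc cE; rewrite inE (subsetP sQS) //= inE; apply/subsetP=> _ /imsetP[e Ee ->].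
by rewrite conjg_mulR groupM // (subsetP sYE) // cE.
Qed.

Lemma mover_center_cases : autF F E \subset 'N(Y | 'P) \/
  [/\ #|'Ohm_1('Z(E))| = (p ^ 3)%N, p.-abelem 'Ohm_1('Z(E)) & Y \subset 'Ohm_1('Z(E))].
Proof.
have sYZE : Y \subset 'Z(E) := subset_trans sYZN (ess_center_normalizer essE).
have abV : p.-abelem 'Ohm_1('Z(E)).
  by rewrite Ohm1_abelem ?center_abelian // (pgroupS (center_sub E)).
have sYV : Y \subset 'Ohm_1('Z(E)) by rewrite -(Ohm1_id abY) OhmS.
have [defY | neqYV] := eqVneq (Y : {set gT}) 'Ohm_1('Z(E)).
  by left; rewrite defY autF_char_stable // (char_trans (Ohm_char 1 _)) ?center_char.
right; split=> //; apply/eqP; rewrite eqn_leq (abelem_card p_pr rkS) //=; last first.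
  by rewrite (subset_trans (Ohm_sub 1 _)) // (subset_trans (center_sub E)).
rewrite dvdn_leq // (pgroup_index_dvd p_pr (abelem_pgroup abV)) // -oY.
by rewrite proper_card // properEneq neqYV.
Qed.

(** [mover_normal_line] places [e] in [<[d]> <*> C], and both generators commute with [c] modulo
    [Y]. *)
Lemma mover_line_closed c d e (Z0 : {group gT}) : d \in Q -> d \notin C ->
    Z0 \subset Y -> #|Z0| = p -> {in J, forall j, [~ j, d] \in Z0} ->
    c \in Q -> [~ c, d] \in Y -> {in C, forall c', [~ c, c'] \in Y} ->
    e \in Q -> {in J, forall j, [~ j, e] \in Z0} ->
  [~ e, c] \in Y.
Proof.
move=> Qd nCd sZ0Y oZ0 dZ0 Qc Ycd YcC Qe eZ0.
have nYQ : Q \subset 'N('Ohm_1('Z(Q))%G) := subset_trans cYQ (cent_sub _).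
have nY := subsetP nYQ.
rewrite -groupV invg_comm (comm_mod_cent1 (W := 'Ohm_1('Z(Q))%G)) ?nY //.
have [/(_ e Qe eZ0) Ke _] := mover_normal_line Qd nCd sZ0Y oZ0 dZ0.
suffices /subsetP -> : (<[d]> <*> C) / Y \subset 'C[coset 'Ohm_1('Z(Q))%G c] => //.
  exact: mem_quotient.
rewrite quotientY ?cycle_subG ?nY ?(subset_trans sCQ) // join_subG.
rewrite quotient_cycle ?nY // cycle_subG -comm_mod_cent1 ?nY // Ycd /=.
apply/subsetP=> _ /morphimP[h nYh Ch ->].
by rewrite -comm_mod_cent1 ?nY ?(subsetP sCQ h Ch) //; apply: YcC.
Qed.

(** If [J <= E], the span [M] of the images of [J] satisfies [[M, E] <= M'], so [E] acts on [J] into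
    the single line [M']. For [J < C] the element of [plane_ext_pair] falls in [E] and yields rank
    four; for [J = C], [E] is the full preimage of that line and [R] normalizes one of its
    images. *)
Lemma mover_case_sub : ~~ (J \subset E).
Proof.
apply/negP=> sJE; have [j0 Jj0 nYj0] := mover_j0.
have /subsetPn[d Ed nCd] := mover_not_sub_cent; have Qd := subsetP sEQ d Ed.
have nsJE : J <| E := normalS sJE sEQ nsJQ.
have cYE : E \subset 'C(Y) := subset_trans sEQ cYQ.
have cYN : N \subset 'C(Y) := subset_trans sNQ cYQ.
(* Otherwise ['Ohm_1('Z(E))] would be ['Ohm_1(E)], which contains [J], and [d] would centralize
   [J]. *)
have stYE : autF F E \subset 'N(Y | 'P).
  have [// | [oV abV sYV]] := mover_center_cases.
  have [O1E _ _ _] := ess_rank3_center p_pr odd_p pS rkS essE abV oV (Ohm_sub 1 _).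
  case/negP: nCd; rewrite inE Qd; apply: (subsetP _ d Ed).
  rewrite centsC -(Ohm1_id abJ) (subset_trans (OhmS 1 sJE)) // O1E.
  by rewrite (subset_trans (Ohm_sub 1 _)) ?subsetIr.
have nsYN : Y <| N by rewrite /normal (subset_trans sYE sEN) cents_norm.
(* [N] centralizes [Y], so it would stabilize the chain [Y < J1] and lie in [E]. *)
have stable3 (J1 : {group gT}) : Y \subset J1 -> J1 \subset E -> p.-abelem J1 ->
    #|J1| = (p ^ 3)%N -> autF F E \subset 'N(J1 | 'P) -> False.
  move=> sYJ1 sJ1E abJ1 oJ1 stJ1; have [_ _ _ _ /subsetPn[n Nn /negP[]]] := essE.
  have nsJ1E : J1 <| E.
    rewrite /normal sJ1E; apply/subsetP=> x Ex.
    by apply: (autF_stable_conj fusF sES sJ1E stJ1); apply: subsetP sEN x Ex.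
  apply: (ess_chain_rank3 p_pr odd_p pS satF rkS essE sYJ1 nsJ1E abJ1 oJ1) => //.
    by rewrite -divgS // oJ1 oY (expnS p 2) mulnK // expn_gt0 p_gt0.
  exact: subsetP cYN n Nn.
have [M [[sJM sME stM expM RM] caseM]] :=
  orbit_span p_pr odd_p pS rkS sES sYE cYE oY sYJ nsJE abJ oJ (autF_sub F E) stYE.
case: caseM => [defM | [oM oM']].
  by apply: (stable3 J) => //; rewrite -defM.
have sYM := subset_trans sYJ sJM.
have ltYM : Y \proper M.
  by rewrite properEcard sYM oY oM ltn_exp2l.
have sM'Y : M^`(1) \subset Y := subset_trans (commgS M sME) RM.
have cYM := subset_trans sME cYE; have sMS := subset_trans sME sES.
have stZ0 : autF F E \subset 'N(M^`(1)%G | 'P).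
  apply/subsetP=> a Ga; apply: (Aut_char_astabs2 (der_char 1 M) sME).
    exact: subsetP (autF_sub F E) a Ga.
  exact: subsetP stM a Ga.
have nZE : E \subset 'N(M^`(1)%G).
  by rewrite (subset_trans _ (cent_sub _)) // (subset_trans cYE) ?centS.
have nZM := subset_trans sME nZE.
(* An element outside [Y] in [M0] makes [M0] either all of [M] or an invariant elementary abelian
   group of order p^3, which [stable3] excludes. *)
have ME : {in M & E, forall x e, [~ x, e] \in M^`(1)}.
  have [/subsetPn[x M0x nYx] | //] :=
    plane_centralizer_nt p_pr pS rkS sES sME expM ltYM cYE oY RM oM oM'.
  pose M0 := cent_mod M M^`(1)%G E.
  have sM0M : M0 \subset M := subsetIl _ _.
  have Mx := subsetP sM0M x M0x.
  have [defK oK] := plane_cent1 p_pr pS rkS sMS expM ltYM cYM oY (introT setDP (conj Mx nYx)).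
  have sYM0 : Y \subset M0.
    apply/subsetP=> y Yy; apply/cent_modP=> //; split; first exact: subsetP sYM y Yy.
    move=> e Ee; have /commgP/eqP -> : commute e y by apply: (centsP cYE).
    exact: group1.
  have sKM0 : Y <*> <[x]> \subset M0 by rewrite join_subG sYM0 cycle_subG.
  have [defM0 | neqM0] := eqVneq (M0 : {set gT}) M.
    move=> m e Mm Ee; rewrite -groupV invg_comm.
    have : m \in M0 by rewrite defM0.
    by case/cent_modP=> // _; apply.
  have pM0 := pgroupS sM0M (pgroupS sMS pS).
  have oM0 : #|M0| = (p ^ 3)%N.
    have [k ok] := p_natP pM0.
    have : #|M0| < p ^ 4 by rewrite -oM proper_card // properEneq neqM0.
    have : p ^ 3 <= #|M0| by rewrite -oK defK subset_leq_card.
    rewrite ok leq_exp2l // ltn_exp2l // ltnS => k3 k4.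
    by congr (p ^ _)%N; apply/eqP; rewrite eqn_leq k4.
  have defM0 : Y <*> <[x]> = M0 by apply/eqP; rewrite eqEcard sKM0 -defK oK oM0 leqnn.
  case: (stable3 M0) => //.
  - exact: subset_trans sM0M sME.
  - rewrite -[p.-abelem M0]/(p.-abelem (gval M0)) -defM0.
    apply: (abelem_join_cycle p_pr expM sYM (abelem_abelian abY) Mx).
    exact: subsetP cYM x Mx.
  apply/subsetP=> a Ga; have Auta := subsetP (autF_sub F E) a Ga.
  apply/perm_astabsP=> m /cent_modP[] // Mm cm; apply/cent_modP=> //; split.
    exact: perm_astabsP (subsetP stM a Ga) m Mm.
  move=> e Ee; have Ea'e : a^-1 e \in E by rewrite Aut_closed ?groupV.
  rewrite -(permKV a e) -(autR Auta) ?(subsetP sME m Mm) //.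
  by apply: (perm_astabsP _ _ (subsetP stZ0 a Ga)); apply: cm.
pose Z0 := M^`(1)%G.
have JZ0 e : e \in E -> {in J, forall j, [~ j, e] \in Z0}.
  by move=> Ee j Jj; apply: ME => //; apply: subsetP sJM j Jj.
have dZ0 := JZ0 d Ed.
have [defC | neqC] := eqVneq (J : {set gT}) C; last first.
  have ltJC : J \proper C by rewrite properEneq neqC.
  have [u [Au uZ uJ uY uy]] := mover_unipotent (Z0 := Z0) sM'Y oM'.
  have [c [Cc nJc cp Ycd YcC]] := plane_ext_pair p_pr odd_p pS rkS sQS sA oY stsub
    sYJ nsJQ abJ oJ stJ ltJC Au Qd sM'Y uZ uJ uY uy dZ0.
  have Qc := subsetP sCQ c Cc.
  have cE : {in E, forall e, [~ e, c] \in Y}.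
    move=> e Ee; apply: (mover_line_closed Qd nCd sM'Y oM' dZ0 Qc Ycd YcC).
      exact: subsetP sEQ e Ee.
    exact: JZ0.
  have Nc := mover_normal_plane Qc cE.
  have Ec := mover_chain_plane stYE Qc Nc cE.
  apply: (rank4_contra p_pr pS rkS sMS oM oM' expM _ (subsetP sQS c Qc) _ _ _ cp).
  - by rewrite centsC (subset_trans cYM) ?centS.
  - by apply: (subsetP _ c Qc); rewrite (subset_trans cYQ) ?centS.
  - have Mj0 := subsetP sJM j0 Jj0.
    have [defK _] := plane_cent1 p_pr pS rkS sMS expM ltYM cYM oY (introT setDP (conj Mj0 nYj0)).
    apply: contra nJc => Mc; rewrite (genJ Jj0 nYj0) -defK inE Mc /=.
    by apply/cent1P; case/setIP: Cc => _ /centP; apply.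
  by move=> m Mm; apply: ME.
have sEK : E \subset <[d]> <*> C.
  apply/subsetP=> e Ee.
  have [inK _] := mover_normal_line Qd nCd (Z0 := Z0) sM'Y oM' dZ0.
  by apply: inK; [apply: subsetP sEQ e Ee | apply: JZ0].
have defE : <[d]> <*> C = E.
  by apply/eqP; rewrite eqEsubset sEK andbT join_subG cycle_subG Ed -defC.
have [_ [a Aa nER]] := mover_normal_line Qd nCd (Z0 := Z0) sM'Y oM' dZ0.
have Auta := subsetP sA a Aa.
pose E1 := (autm Auta @* E)%G.
have defE1 : E1 :=: a @: E by rewrite /= morphimEsub.
have sNE1 := mover_conj_normalizer satF essE sNQ sQS Aa defE1.
have [r [Rr /negP nQr _]] := moving; apply: nQr; apply: (subsetP sNE1).
by rewrite inE (subsetP sRS r Rr) defE1 -defE (subsetP nER).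
Qed.

(** * The case where [J] is not contained in [E] *)

Section CaseNotSub.
Variable X : {group gT}.
Hypotheses (sZX : Z \subset X) (sXZN : X \subset 'Z(N)).
Hypothesis stX : autF F E \subset 'N(X | 'P).

Local Notation V := 'Ohm_1('Z(E)).

Lemma mover_exists_j0 : exists2 j, j \in J & j \notin E.
Proof. exact/subsetPn/mover_case_sub. Qed.

(** [J] lies in [N] and acts on [E] into [Y]; were [Y] invariant, [J] would stabilize the chain
    [Y <= E]. *)
Lemma mover_plane_not_stable : ~ autF F E \subset 'N(Y | 'P).
Proof.
move=> stYE; have [j Jj /negP[]] := mover_exists_j0.
apply: (mover_chain_plane stYE) => //; first exact: subsetP sJQ j Jj.
  exact: subsetP mover_J_normalizer j Jj.
by move=> e Ee; rewrite -groupV invg_comm RJ // (subsetP sEQ).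
Qed.

Lemma mover_V : [/\ #|V| = (p ^ 3)%N, p.-abelem V, Y \subset V, 'Ohm_1(E) = V
  & autF F E \subset 'N(V | 'P) /\ p'_faithful p E V].
Proof.
have [/mover_plane_not_stable // | [oV abV sYV]] := mover_center_cases.
have [O1E _ stV faV] := ess_rank3_center p_pr odd_p pS rkS essE abV oV (Ohm_sub 1 _).
by split.
Qed.

(** ['Ohm_1(X)] is invariant and lies between [Z] and the plane [Y = 'Ohm_1('Z(N))]. It is not [Y],
    so it is [Z]. *)
Lemma mover_Z_stable : autF F E \subset 'N(Z | 'P).
Proof.
have sXE : X \subset E.
  exact: subset_trans sXZN (subset_trans (ess_center_normalizer essE) (center_sub E)).
have pZN : p.-group 'Z(N) := pgroupS (subset_trans (center_sub _) (subsetIl _ _)) pS.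
have abZN : p.-abelem 'Ohm_1('Z(N)) by rewrite Ohm1_abelem ?center_abelian.
have leZN := ess_no_central_rank3 p_pr odd_p pS satF rkS essE abZN (Ohm_sub 1 _).
have defY : Y = 'Ohm_1('Z(N)).
  apply/eqP; rewrite eqEcard oY leZN andbT -(Ohm1_id abY); exact: OhmS.
have abZ : p.-abelem Z := abelemS sZY abY.
have sX1Y : 'Ohm_1(X) \subset Y by rewrite defY OhmS.
have stX1 : autF F E \subset 'N('Ohm_1(X) | 'P).
  apply/subsetP=> a Ga; apply: (Aut_char_astabs2 (Ohm_char 1 X) sXE).
    exact: subsetP (autF_sub F E) a Ga.
  exact: subsetP stX a Ga.
have sZX1 : Z \subset 'Ohm_1(X) by rewrite -(Ohm1_id abZ) OhmS.
have neqX1 : 'Ohm_1(X) != Y.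
  by apply/eqP=> eqX1; apply: mover_plane_not_stable; rewrite -eqX1.
have pX1 := pgroupS sX1Y (abelem_pgroup abY).
suffices /eqP -> : Z == 'Ohm_1(X) by [].
rewrite eqEcard sZX1 oZ leqNgt; apply/negP=> ltX1.
have : p ^ 2 <= #|'Ohm_1(X)|.
  by rewrite dvdn_leq // (pgroup_index_dvd p_pr pX1) // expn1.
by rewrite -oY leqNgt proper_card // properEneq neqX1.
Qed.

Lemma mover_chain_V n : n \in N -> {in V, forall v, [~ v, n] \in Z} -> n \in E.
Proof.
have [oV abV sYV _ [stV faV]] := mover_V => Nn cV.
have sVE : V \subset E := subset_trans (Ohm_sub 1 _) (center_sub E).
apply: (ess_chain pS satF essE (subset_trans sZY sYV) sVE) => //.
  exact: mover_Z_stable.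
by apply: (subsetP _ n (subsetP sNQ n Nn)); rewrite (subset_trans cYQ) ?centS.
Qed.

Lemma mover_gen_V v : v \in V -> v \notin Y -> V = Y <*> <[v]>.
Proof.
have [oV abV sYV _ _] := mover_V => Vv nYv.
have sK : Y <*> <[v]> \subset V by rewrite join_subG sYV cycle_subG.
apply/esym/eqP; rewrite eqEcard sK oV dvdn_leq //.
apply: (pgroup_index_dvd p_pr (pgroupS sK (abelem_pgroup abV))).
rewrite -oY proper_card // properE joing_subl.
by apply: contra nYv => /subsetP-> //; rewrite mem_gen // inE cycle_id orbT.
Qed.

Lemma mover_line_V v q (W : {group gT}) : v \in V -> v \notin Y -> q \in Q ->
  W \subset Y -> [~ v, q] \in W -> {in V, forall v', [~ v', q] \in W}.
Proof.
have [oV abV sYV _ _] := mover_V => Vv nYv Qq sWY Wvq v'.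
rewrite {1}(mover_gen_V Vv nYv) cent_joinEr; last first.
  by rewrite (centSS _ sYV (abelem_abelian abV)) // cycle_subG.
case/mulsgP=> y _ Yy /cycleP[i ->] ->.
have sVQ : V \subset Q by rewrite (subset_trans (Ohm_sub 1 _)) // (subset_trans (center_sub E)).
have cyq : [~ y, q] = 1 by apply/eqP/commgP/commute_sym/(centsP cYQ).
rewrite commMgJ cyq conj1g mul1g commXg ?groupX //.
by apply: (centsP cYQ); [apply: subsetP sVQ v Vv | apply: subsetP sWY _ Wvq].
Qed.

Lemma mover_V_data : exists v j, [/\ v \in V, v \notin C, j \in J, j \notin Y
  & j \notin E] /\ [~ v, j] \notin Z.
Proof.
have [j Jj nEj] := mover_exists_j0.
have nYj : j \notin Y by apply: contra nEj => /(subsetP sYE).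
have Nj := subsetP mover_J_normalizer j Jj.
have [v Vv nZ] : exists2 v, v \in V & [~ v, j] \notin Z.
  apply/exists_inP; rewrite -negb_forall_in; apply: contra nEj => /forall_inP h.
  exact: mover_chain_V.
exists v, j; split=> //; split=> //.
apply: contra nZ => /setIP[_ /centP/(_ j Jj)/commgP/eqP ->]; exact: group1.
Qed.

Let sVE : V \subset E := subset_trans (Ohm_sub 1 _) (center_sub E).
Let sVQ : V \subset Q := subset_trans sVE sEQ.
Let cVE : E \subset 'C(V).
Proof. by rewrite centsC (subset_trans (Ohm_sub 1 _)) ?subsetIr. Qed.
Let cQ y q : y \in Y -> q \in Q -> commute q y.
Proof. by move=> Yy Qq; apply: (centsP cYQ). Qed.

Lemma mover_comm_VN v n : v \in V -> n \in N -> [~ v, n] \in Y.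
Proof.
have [oV abV sYV _ [stV faV]] := mover_V => Vv Nn.
have nsYN : Y <| N.
  by rewrite /normal (subset_trans sYE sEN) (subset_trans sNQ) // cents_norm.
have nsVN : V <| N.
  rewrite /normal (subset_trans sVE sEN) /=.
  by apply/subsetP=> x; apply: (autF_stable_conj fusF sES sVE stV).
have pN : p.-group N := pgroupS (subsetIl _ _) pS.
apply: (subsetP (index_p_comm p_pr pN nsYN nsVN sYV _)); last exact: mem_commg.
by rewrite -divgS // oV oY (expnS p 2) mulnK // expn_gt0 p_gt0.
Qed.

(** The chain [Z <= V] gives ['C_S(V) = E], so whatever normalizes [V] normalizes [E]. *)
Lemma mover_normalizer_V q : q \in Q -> {in V, forall v, [~ v, q] \in Y} -> q \in N.
Proof.
have [oV abV sYV _ [stV faV]] := mover_V => Qq Vq.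
have Sq := subsetP sQS q Qq.
have defE : 'C_S(V) = E.
  apply: (nilpotent_sub_norm (pgroup_nil (pgroupS (subsetIl _ _) pS))).
    by rewrite subsetI sES.
  apply/subsetP=> n /setIP[/setIP[Sn cVn] nEn]; apply: mover_chain_V.
    by rewrite inE Sn.
  move=> v Vv; have /commgP/eqP -> : commute v n by apply/commute_sym/(centP cVn).
  exact: group1.
have nVq : q \in 'N(V).
  rewrite inE; apply/subsetP=> _ /imsetP[v Vv ->].
  by rewrite conjg_mulR groupM // (subsetP sYV) ?Vq.
have nCq : <[q]> \subset 'N('C_S(V)).
  by rewrite normsI ?cycle_subG ?(subsetP (normG S)) // (subsetP (cent_norm _) q nVq).
by rewrite inE Sq -defE -cycle_subG.
Qed.

Section Pair.
Variables v j0 : gT.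
Hypotheses (Vv : v \in V) (nCv : v \notin C) (Jj0 : j0 \in J) (nYj0 : j0 \notin Y).
Hypotheses (nEj0 : j0 \notin E) (nZr : [~ v, j0] \notin Z).

Let Qv : v \in Q := subsetP sVQ v Vv.
Let Qj0 : j0 \in Q := subsetP sJQ j0 Jj0.
Let nYv : v \notin Y.
Proof.
apply: contra nCv => Yv; rewrite inE Qv; apply/centP=> j Jj.
by apply/commute_sym/cQ; rewrite ?(subsetP sJQ).
Qed.
Let Nj0 : j0 \in N := subsetP mover_J_normalizer j0 Jj0.
Let j0p : j0 ^+ p = 1.
Proof. by case/abelemP: abJ => // _; apply. Qed.

(** [Y] is spanned by [Z] and [[~ v, j0]], so a power of [j0] corrects [n] to an element acting on
    [V] into [Z]. *)
Lemma mover_coset n : n \in N -> exists m, n * j0 ^+ m \in E.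
Proof.
move=> Nn; pose r0 := [~ v, j0]; have Yr0 : r0 \in Y := mover_comm_VN Vv Nj0.
have defY : Y = Z <*> <[r0]>.
  have sK : Z <*> <[r0]> \subset Y by rewrite join_subG sZY cycle_subG.
  apply/esym/eqP; rewrite eqEcard sK oY dvdn_leq //.
  apply: (pgroup_index_dvd p_pr (pgroupS sK (abelem_pgroup abY))).
  rewrite expn1 -oZ proper_card // properE joing_subl.
  by apply: contra nZr => /subsetP-> //; rewrite mem_gen // inE cycle_id orbT.
have : [~ v, n]^-1 \in Z <*> <[r0]> by rewrite -defY groupV mover_comm_VN.
rewrite cent_joinEr; last first.
  by rewrite (centSS _ sZY (abelem_abelian abY)) // cycle_subG.
case/mulsgP=> z _ Zz /cycleP[m ->] e; exists m.
have Nnm : n * j0 ^+ m \in N by rewrite groupM ?groupX.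
apply: mover_chain_V => //; apply: (mover_line_V Vv nYv) => //.
  exact: subsetP sNQ _ Nnm.
have cjr : commute j0 r0 by apply: cQ.
rewrite commgMJ commgX //; have -> : [~ v, n] ^ (j0 ^+ m) = [~ v, n].
  apply/conjg_fixP/commgP/commute_sym/cQ; first exact: mover_comm_VN.
  exact: groupX.
have -> : [~ v, n] = r0 ^- m * z^-1 by rewrite -invMg -e invgK.
by rewrite mulKVg groupV.
Qed.

Let M := (V <*> J)%G.
Let sMQ : M \subset Q.
Proof. by rewrite join_subG sVQ. Qed.
Let sMS : M \subset S := subset_trans sMQ sQS.

Lemma mover_join :
  [/\ exponent M %| p, #|M| = (p ^ 4)%N, #|M^`(1)| = p & M^`(1) \subset Y].
Proof.
have [oV abV sYV _ _] := mover_V.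
apply: (join_plane p_pr odd_p pS rkS _ (subset_trans sJQ sQS)) => //.
- exact: subset_trans sVQ sQS.
- by rewrite gen_subG; apply/subsetP=> _ /imset2P[x j Vx Jj ->];
    rewrite -groupV invg_comm RJ // (subsetP sVQ).
- by apply: contra nEj0 => /subsetP/(_ j0 Jj0) /(subsetP sVE).
Qed.

Let cent1M : 'C_M[j0] = J.
Proof.
have [expM oM oM' sM'Y] := mover_join.
have sYM : Y \subset M := subset_trans sYJ (joing_subr _ _).
have ltYM : Y \proper M by rewrite properEcard sYM oY oM ltn_exp2l.
have Mj0 : j0 \in M := subsetP (joing_subr _ _) j0 Jj0.
have [-> _] := plane_cent1 p_pr pS rkS sMS expM ltYM (subset_trans sMQ cYQ) oY
  (introT setDP (conj Mj0 nYj0)).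
by rewrite (genJ Jj0 nYj0).
Qed.

(** If [J < C], the element of [plane_ext_pair] for [d = v] lies in [N]. A power of [j0] moves it
    into [E], where it centralizes [V] and [J] and extends [M] to a section of rank four. *)
Lemma mover_cent_sub : C = J.
Proof.
have [expM oM oM' sM'Y] := mover_join; have [oV abV sYV _ _] := mover_V.
apply/eqP; rewrite eq_sym; apply/negPn/negP=> neqC.
have ltJC : J \proper C by rewrite properEneq neqC.
have [u [Au uZ uJ uY uy]] := mover_unipotent (Z0 := M^`(1)%G) sM'Y oM'.
have vZ0 : {in J, forall j, [~ j, v] \in M^`(1)%G}.
  move=> j Jj; apply: mem_commg; first exact: subsetP (joing_subr _ _) j Jj.
  exact: subsetP (joing_subl _ _) v Vv.
have [c [Cc nJc cp Ycv YcC]] := plane_ext_pair p_pr odd_p pS rkS sQS sA oY stsub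
  sYJ nsJQ abJ oJ stJ ltJC Au Qv sM'Y uZ uJ uY uy vZ0.
have Qc := subsetP sCQ c Cc; have cJc : c \in 'C(J) by case/setIP: Cc.
have Nc : c \in N.
  apply: mover_normalizer_V => //; apply: (mover_line_V Vv nYv) => //.
  by rewrite -groupV invg_comm.
have [m Ee] := mover_coset Nc; pose e := c * j0 ^+ m.
have cJe : e \in 'C(J).
  by rewrite groupM // groupX // (subsetP cJJ).
have cMe : e \in 'C(M) by rewrite centY inE (subsetP cVE).
apply: (rank4_contra p_pr pS rkS sMS oM oM' expM _ (subsetP sES e Ee)).
- by rewrite centsC (subset_trans (subset_trans sMQ cYQ)) ?centS.
- by apply: subsetP cMe; rewrite centS ?der_sub.
- apply: contra nJc => Me; rewrite -(mulgK (j0 ^+ m) c) groupM ?groupV ?groupX //.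
  by rewrite -cent1M inE Me; apply/cent1P/(centP cJe).
- move=> x Mx; have /commgP/eqP -> : commute x e by apply/commute_sym/(centP cMe).
  exact: group1.
rewrite expgMn; last exact/commuteX/(centP cJc).
by rewrite -expgM mulnC expgM j0p expg1n mulg1.
Qed.

Let oQ : #|Q| = (p ^ 5)%N.
Proof. by rewrite -(Lagrange sCQ) iC /= mover_cent_sub oJ -expnD. Qed.

Lemma mover_E_cap_J : E :&: J = Y.
Proof.
apply/eqP; rewrite eqEsubset [Y \subset _]subsetI sYE sYJ !andbT.
apply/subsetP=> j /setIP[Ej Jj]; apply: contraR mover_case_sub => nYj.
by rewrite (genJ Jj nYj) join_subG sYE cycle_subG.
Qed.

(** If [E = V] then [N <= M], so an element [q] of [Q] outside [a(M)] moves [v1] by some [t]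
    generating [J] over [Y]. A power of [q] then corrects [r] to an element normalizing [E1 = Y <*>
    <[v1]>], which forces [r] into [Q]. *)
Lemma mover_neq_V : E :!=: V.
Proof.
have [expM oM oM' sM'Y] := mover_join; have [oV abV sYV _ _] := mover_V.
apply/eqP=> defE.
have sNM : N \subset M.
  apply/subsetP=> n /mover_coset[m]; rewrite defE => Vn.
  rewrite -(mulgK (j0 ^+ m) n) groupM ?groupV ?groupX //.
    exact: subsetP (joing_subl _ _) _ Vn.
  exact: subsetP (joing_subr _ _) _ Jj0.
have [q0 Qq0 nMq0] : exists2 q, q \in Q & q \notin M.
  by apply/subsetPn/negP=> /subset_leq_card; rewrite oQ oM leqNgt ltn_exp2l.
have dZ0 : {in J, forall j, [~ j, v] \in M^`(1)%G}.
  move=> j Jj; apply: mem_commg; first exact: subsetP (joing_subr _ _) j Jj.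
  exact: subsetP (joing_subl _ _) v Vv.
have [_ [a Aa nM1R]] := mover_normal_line Qv nCv (Z0 := M^`(1)%G) sM'Y oM' dZ0.
have defM : <[v]> <*> C = M.
  by rewrite mover_cent_sub /= (mover_gen_V Vv nYv) -joingA (joingC Y) -joingA (joing_idPl sYJ).
rewrite defM in nM1R.
have Auta := subsetP sA a Aa.
pose M1 := (autm Auta @* M)%G; pose E1 := (autm Auta @* E)%G.
have defM1 : M1 :=: a @: M by rewrite /= morphimEsub.
have defE1 : E1 :=: a @: E by rewrite /= morphimEsub.
have sNE1 := mover_conj_normalizer satF essE sNQ sQS Aa defE1.
have aY y : y \in Y -> a y \in Y by apply: perm_astabsP (subsetP stY a Aa) y.
have sJM1 : J \subset M1.
  have /eqP <- : a @: J == J by rewrite perm_imset_astabs (subsetP stJ).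
  by rewrite defM1 imsetS // joing_subr.
have sYE1 : Y \subset E1.
  have /eqP <- : a @: Y == Y by rewrite perm_imset_astabs (subsetP stY).
  by rewrite defE1 imsetS.
pose v1 := a v; pose q := a q0; pose t := [~ v1, q].
have M1v1 : v1 \in M1 by rewrite defM1 imset_f // (subsetP (joing_subl _ _)).
have E1v1 : v1 \in E1 by rewrite defE1 imset_f // (subsetP sVE).
have sM1Q : M1 \subset Q.
  by rewrite defM1; apply/subsetP=> _ /imsetP[x Mx ->]; rewrite Aut_closed // (subsetP sMQ).
have Qq : q \in Q by rewrite Aut_closed.
have nsJR := mover_normal_stable sJQ stJ; have nsYR := mover_normal_stable sYQ stY.
have nYR := normal_norm nsYR.
have Jv1 r : r \in R -> [~ v1, r] \in J.
  move=> Rr; apply: (subsetP (index_p_comm p_pr pR nsJR _ sJM1 _)); last exact: mem_commg.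
    by rewrite /normal (subset_trans sM1Q) // defM1.
  by rewrite -divgS // defM1 card_imset ?oM ?oJ; [rewrite (expnS p 3) mulnK // expn_gt0 p_gt0 | apply: perm_inj].
have nYt : t \notin Y.
  apply: contra nMq0 => Yt; apply: (subsetP sNM); apply: mover_normalizer_V => //.
  apply: (mover_line_V Vv nYv) => //; rewrite -(permK a [~ v, q0]) (autR Auta) //.
  by apply: (perm_astabsP _ _ (subsetP stY _ _)) Yt; rewrite groupV.
have Jt : t \in J by rewrite Jv1 // (subsetP sQR).
have [r [Rr /negP nQr _]] := moving; apply: nQr.
have : [~ v1, r]^-1 \in Y <*> <[t]> by rewrite -(genJ Jt nYt) groupV Jv1.
rewrite cent_joinEr; last first.
  by rewrite cycle_subG (subsetP cYQ) // (subsetP sJQ).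
case/mulsgP=> y _ Yy /cycleP[m ->] e.
(* [m] is chosen so that [[~ v1, q ^+ m]] cancels [[~ v1, r]] modulo [Y]. *)
pose s := r * q ^+ m; have Rs : s \in R by rewrite groupM // groupX // (subsetP sQR).
have Yv1s : [~ v1, s] \in Y.
  have cvr : [~ v1, r] = t ^- m * y^-1 by rewrite -invMg -e invgK.
  pose Yg := 'Ohm_1('Z(Q))%G.
  have nY x : x \in Q -> x \in 'N(Yg) by apply: (subsetP (subset_trans cYQ (cent_sub _))).
  have Qv1 : v1 \in Q := subsetP sM1Q _ M1v1; have Qt : t \in Q := subsetP sJQ t Jt.
  have cqt : commute (coset Yg q) (coset Yg t).
    by apply/cent1P; rewrite -comm_mod_cent1 ?nY ?RJ.
  have -> : [~ v1, s] = [~ v1, q ^+ m] * t ^- m * (y^-1 * [~ [~ v1, r], q ^+ m]).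
    by rewrite commgMJ conjg_mulR {1}cvr !mulgA.
  rewrite groupM //; last by rewrite groupM ?groupV // RJ ?Jv1 ?groupX.
  have Qvq : [~ v1, q ^+ m] \in Q by rewrite groupR ?groupX.
  apply: (coset_idr (H := Yg)); first by rewrite nY // groupM ?groupV ?groupX.
  rewrite morphM ?morphV ?morphX ?groupV ?groupX ?nY // morphR ?groupX ?nY // morphX ?nY //.
  by rewrite -/(coset Yg) commgX -?morphR ?nY // mulgV.
suffices Ns : s \in 'N_S(E1).
  by rewrite -(mulgK (q ^+ m) r) groupM ?groupV ?groupX // (subsetP sNE1).
rewrite inE (subsetP sRS) // inE; apply/subsetP=> _ /imsetP[x E1x ->].
move: E1x; rewrite defE1 {1}defE => /imsetP[x0 Vx0 ->].
rewrite (mover_gen_V Vv nYv) cent_joinEr in Vx0; last first.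
  by rewrite cycle_subG (subsetP cYQ).
case/mulsgP: Vx0 => y0 _ Yy0 /cycleP[i ->] ->.
have [Qy0 Qvi] : y0 \in Q /\ v ^+ i \in Q by rewrite groupX // (subsetP sYQ).
rewrite (autM Auta Qy0 Qvi) (autX i Auta Qv) conjMg conjXg -defE1.
rewrite groupM ?groupX //; first by rewrite (subsetP sYE1) // memJ_norm ?aY // (subsetP nYR).
by rewrite conjg_mulR groupM // (subsetP sYE1).
Qed.

(** Orders force [Q = E * J] with [E = V <*> <[e]>] abelian, so every p-th power in [Q] is a power
    of [e ^+ p], which is not 1 because [e] is outside [V = 'Ohm_1(E)]. *)
Lemma mover_contra_pair : False.
Proof.
have [expM oM oM' sM'Y] := mover_join; have [oV abV sYV O1E _] := mover_V.
have /subsetPn[e Ee nVe] : ~~ (E \subset V).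
  by apply: contra mover_neq_V => sEV; rewrite eqEsubset sEV.
have Qe := subsetP sEQ e Ee.
have sKE : V <*> <[e]> \subset E by rewrite join_subG sVE cycle_subG.
have leK : p ^ 4 <= #|V <*> <[e]>|.
  rewrite dvdn_leq // (pgroup_index_dvd p_pr (pgroupS sKE pE)) // -oV.
  rewrite proper_card // properE joing_subl.
  by apply: contra nVe => /subsetP-> //; rewrite mem_gen // inE cycle_id orbT.
have sEJQ : E * J \subset Q by rewrite mul_subG.
have := mul_cardG E J; rewrite mover_E_cap_J oY oJ => oEJ.
have leE : #|E| <= p ^ 4.
  rewrite -(@leq_pmul2r (p ^ 3)) ?expn_gt0 ?p_gt0 // -expnD (expnD p 5 2) oEJ.
  by rewrite leq_mul2r -oQ subset_leq_card ?orbT.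
have oE : #|E| = (p ^ 4)%N.
  by apply/eqP; rewrite eqn_leq leE (leq_trans leK) // subset_leq_card.
have defE : V <*> <[e]> = E by apply/eqP; rewrite eqEcard sKE oE.
have defQ : E * J = Q.
  apply/eqP; rewrite eqEcard sEJQ oQ -(@leq_pmul2r (p ^ 2)) ?expn_gt0 ?p_gt0 //.
  by rewrite -oEJ oE -!expnD leq_exp2l.
have cVe : <[e]> \subset 'C(V) by rewrite cycle_subG (subsetP cVE).
have abelE : abelian E.
  by rewrite -defE abelianY (abelem_abelian abV) cycle_abelian cVe.
have expQ q : q \in Q -> q ^+ p \in <[e ^+ p]>.
  rewrite -defQ => /mulsgP[x j Ex Jj ->].
  have Qx := subsetP sEQ x Ex; have Qj := subsetP sJQ j Jj.
  have Yjx := RJ Jj Qx.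
  rewrite (expMg_Rmul _ (cQ Yjx Qj) (cQ Yjx Qx)).
  have Yp : {in Y, forall y, y ^+ p = 1} by case/abelemP: abY.
  have Jp : {in J, forall y, y ^+ p = 1} by case/abelemP: abJ.
  rewrite bin2odd // expgM (Yp _ Yjx) expg1n mulg1 (Jp j Jj) mulg1.
  move: Ex; rewrite -defE cent_joinEr // => /mulsgP[w _ Vw /cycleP[i ->] ->].
  have Vp : {in V, forall y, y ^+ p = 1} by case/abelemP: abV.
  rewrite expgMn; last by apply/commuteX/commute_sym/(centP (subsetP cVE e Ee)).
  by rewrite (Vp w Vw) mul1g expgAC mem_cycle.
(* [e ^+ p] centralizes [J], since each [[~ j, e]] is central of order dividing p; so it lies in
   [E :&: C = E :&: J]. *)
have Yep : e ^+ p \in Y.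
  rewrite -mover_E_cap_J inE groupX //= -mover_cent_sub inE groupX //=.
  apply/centP=> j Jj; apply/commute_sym/commgP; rewrite commgX; last by apply: cQ; rewrite ?RJ.
  by case/abelemP: abY => // _ ->; rewrite ?RJ.
have ntep : e ^+ p != 1.
  apply: contra nVe => /eqP ep1; rewrite -O1E.
  by rewrite (OhmE 1 pE) mem_gen //; apply/LdivP; rewrite expn1 ep1.
have oep : #|<[e ^+ p]>| = p.
  have : #[e ^+ p] %| p by rewrite order_dvdn; case/abelemP: abY => // _ ->.
  by rewrite -orderE; case/primeP: p_pr => _ /[apply]; rewrite order_eq1 (negPf ntep) => /eqP.
apply: (irr (X := <[e ^+ p]>%G)) => //; first by rewrite cycle_subG.
apply/subsetP=> a Aa; have Auta := subsetP sA a Aa.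
apply/perm_astabsP=> _ /cycleP[i ->].
have Qep : e ^+ p \in Q by rewrite groupX.
by rewrite (autX i Auta Qep) (autX p Auta Qe) groupX // expQ // Aut_closed.
Qed.
End Pair.

Lemma mover_contra : False.
Proof.
have [v [j [[Vv nCv Jj nYj nEj] nZr]]] := mover_V_data.
exact: mover_contra_pair Vv nCv Jj nYj nEj nZr.
Qed.

End CaseNotSub.

End MoverCases.

(** * The subgroup [ZE] and the core *)

Section Final.
Variables (gT : finGroupType) (p : nat) (S : {group gT}) (F : fsys gT).
Hypotheses (p_pr : prime p) (odd_p : odd p) (pS : p.-group S) (satF : saturated F S p).
Hypothesis rkS : forall Q : {group gT}, Q \subset S -> 'm(Q) <= 3.
Implicit Types (P X K : {group gT}) (f : {ffun gT -> gT}).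

Local Notation Z := 'Ohm_1('Z(S)).
Let fusF : is_fusion_system S F := satF.1.

Theorem ess_stable_center E X : essential_like p F S E ->
    Z \subset X -> X \subset 'Z('N_S(E)) -> autF F E \subset 'N(X | 'P) ->
  autF F 'N_S(E) \subset 'N(Z | 'P).
Proof.
move=> essE sZX sXZN stX; apply/negPn/negP=> mvN.
have [E' [X' [Q [[essE' sZX' sXZN' stX'] [sNQ sQS fnQ mvQ maxQ]]]]] :=
  maximal_mover pS satF essE sZX sXZN stX mvN.
have [J [sYJ nsJQ abJ oJ stJ]] :=
  mover_J p_pr odd_p pS satF rkS essE' sNQ sQS fnQ mvQ maxQ.
exact: (mover_contra p_pr odd_p pS satF rkS essE' sNQ sQS fnQ mvQ maxQ
  sYJ nsJQ abJ oJ stJ sZX' sXZN' stX').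
Qed.

Variable E : {group gT}.
Hypothesis essE : essential_like p F S E.
Local Notation N := 'N_S(E).
Let sES : E \subset S := ess_sub essE.
Let sEN : E \subset N := ess_sub_normalizer essE.
Let sNS : N \subset S := subsetIl _ _.
Let pE : p.-group E := pgroupS sES pS.
Let pN : p.-group N := pgroupS sNS pS.

Let sZZS : Z \subset 'Z(S) := Ohm_sub 1 _.

Lemma ess_Ohm1_center_normalizer : Z \subset 'Z(N).
Proof.
have [_ cEE _ _ _] := essE.
have cZS : Z \subset 'C(S) := subset_trans sZZS (subsetIr _ _).
have sZE : Z \subset E.
  apply: subset_trans cEE; rewrite subsetI (subset_trans sZZS (center_sub S)).
  exact: subset_trans cZS (centS sES).
by rewrite subsetI (subset_trans sZE sEN) (subset_trans cZS) ?centS.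
Qed.
Let sZZN := ess_Ohm1_center_normalizer.
Let sZZE : Z \subset 'Z(E) := subset_trans sZZN (ess_center_normalizer essE).

Lemma ess_Ohm1_center_nt : Z != 1.
Proof.
have [_ _ _ _ nNE] := essE; apply: contra nNE; rewrite Ohm1_eq1 => /eqP Z1.
by rewrite (subset_trans sNS) // (trivg_center_pgroup pS Z1) sub1G.
Qed.

Definition ZE_group := generated_group (\bigcup_(f : {ffun gT -> gT} | F E f && (f @: E \subset E)) (f @: Z)).
Local Notation U := ZE_group.

Lemma ZE_min K : Z \subset K -> autF F E \subset 'N(K | 'P) -> U \subset K.
Proof.
move=> sZK stK; rewrite gen_subG; apply/bigcupsP=> f /andP[Ff sfE].
have [a Ga af] := autF_hom fusF Ff sfE.
apply/subsetP=> _ /imsetP[x Zx ->].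
rewrite -af ?(subsetP (center_sub E)) ?(subsetP sZZE) //.
by apply: (perm_astabsP _ _ (subsetP stK a Ga)); apply: subsetP sZK x Zx.
Qed.

Lemma ZE_sup a x : a \in autF F E -> x \in Z -> a x \in U.
Proof.
rewrite (mem_autF fusF) // => /andP[Aa Fa] Zx; rewrite mem_gen //.
apply/bigcupP; exists [ffun x => a x].
  by rewrite Fa; apply/subsetP=> _ /imsetP[y Ey ->]; rewrite ffunE Aut_closed.
by apply/imsetP; exists x; rewrite ?ffunE.
Qed.

Lemma sub_ZE : Z \subset U.
Proof. by apply/subsetP=> x Zx; have := ZE_sup (group1 _) Zx; rewrite perm1. Qed.

Lemma ZE_sub_Ohm1 : U \subset 'Ohm_1('Z(E)).
Proof.
apply: ZE_min; last first.
  by rewrite autF_char_stable // (char_trans (Ohm_char 1 _)) ?center_char.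
have abZ : p.-abelem Z by rewrite Ohm1_abelem ?center_abelian // (pgroupS (center_sub S)).
by rewrite -(Ohm1_id abZ) OhmS.
Qed.
Let sUZE : U \subset 'Z(E) := subset_trans ZE_sub_Ohm1 (Ohm_sub 1 _).
Let sUE : U \subset E := subset_trans sUZE (center_sub E).

Lemma ZE_abelem : p.-abelem U.
Proof.
by apply: abelemS ZE_sub_Ohm1 _; rewrite Ohm1_abelem ?center_abelian // (pgroupS (center_sub E)).
Qed.

Lemma ZE_stable : autF F E \subset 'N(U | 'P).
Proof.
pose B := \bigcup_(a in autF F E) (a @: Z); pose U1 := <<B>>%G.
have sU1E : U1 \subset E.
  rewrite gen_subG; apply/bigcupsP=> a /(subsetP (autF_sub F E)) Aa.
  apply/subsetP=> _ /imsetP[x Zx ->].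
  by rewrite Aut_closed // (subsetP (center_sub E)) // (subsetP sZZE).
have stU1 : autF F E \subset 'N(U1 | 'P).
  apply/subsetP=> a Ga; have Aa := subsetP (autF_sub F E) a Ga.
  have sBE : B \subset E by rewrite -gen_subG.
  apply: (Aut_astabs_gen Aa sBE).
  apply/perm_astabsP=> x /bigcupP[b Gb /imsetP[z Zz ->]].
  apply/bigcupP; exists (b * a); first exact: groupM.
  by apply/imsetP; exists z; rewrite ?permM.
suffices -> : U = U1 by [].
apply/group_inj/eqP; rewrite eqEsubset ZE_min //=; last first.
  apply/subsetP=> x Zx; rewrite mem_gen //; apply/bigcupP; exists 1; first exact: group1.
  by apply/imsetP; exists x; rewrite ?perm1.
by rewrite gen_subG; apply/bigcupsP=> a Ga; apply/subsetP=> _ /imsetP[x Zx ->]; apply: ZE_sup.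
Qed.

Lemma ZE_eq : (Z == U) = (autF F E \subset 'N(Z | 'P)).
Proof.
apply/eqP/idP=> [-> | stZ]; first exact: ZE_stable.
by apply/eqP; rewrite eqEsubset sub_ZE ZE_min.
Qed.

Section Core.
Variable T : {group gT}.
Hypothesis coreT : is_Fcore F S E T.

Lemma core_stable : [/\ T \subset E, autF F E \subset 'N(T | 'P) & autF F N \subset 'N(T | 'P)].
Proof.
have [[sTE nTE nTN] _] := coreT; split=> //.
  exact/(stable_normalized fusF).
by apply/(stable_normalized fusF sNS (subset_trans sTE sEN)).
Qed.

Lemma core_max K : K \subset E -> autF F E \subset 'N(K | 'P) ->
  autF F N \subset 'N(K | 'P) -> K \subset T.
Proof.
move=> sKE stE stN; apply: coreT.2; split=> //.
  exact/(stable_normalized fusF).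
by apply/(stable_normalized fusF sNS (subset_trans sKE sEN)).
Qed.

Lemma ZE_eq_sub_core : Z = U :> {set gT} -> Z \subset T.
Proof.
move/eqP; rewrite ZE_eq => stZ.
apply: (core_max (K := 'Ohm_1('Z(S))%G) (subset_trans sZZE (center_sub E)) stZ).
exact: (ess_stable_center (X := 'Ohm_1('Z(S))%G) essE).
Qed.

(** ['N_S(N)] acts on [N] through its automizer, so it would normalize [E]; then [N] is
    self-normalizing in [S]. *)
Lemma ess_not_normal : ~ F_characteristic F S E -> ~ autF F N \subset 'N(E | 'P).
Proof.
move=> nchE stE.
have [defN | neqN] := eqVneq N S.
  apply: nchE => f Ff; have [_ _ _ sfS] := fsys_hom fusF Ff.
  have stES : autF F S \subset 'N(E | 'P) by rewrite -[S](group_inj (defN : N%G :=: S)).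
  by apply: (proj2 (stable_normalized fusF (subxx S) sES) stES).
case/negP: neqN; rewrite eq_sym; apply/eqP.
apply: (nilpotent_sub_norm (pgroup_nil pS) sNS).
apply/subsetP=> g NNg; have [Sg nNg] := setIP NNg.
rewrite inE Sg /=.
exact: (autF_stable_conj fusF sNS sEN stE).
Qed.

Lemma ess_not_mover : Z != U -> ~~ (N \subset 'C(U)).
Proof.
rewrite ZE_eq; apply: contra => cNU; have [_ _ fnE _ _] := essE.
have defN : 'C_N(U)%G = N%G by apply: group_inj; apply/setIidPl.
have sUZN : U \subset 'Z(N) by rewrite subsetI (subset_trans sUE sEN) centsC.
have stZN := ess_stable_center essE sub_ZE sUZN ZE_stable.
apply: (frattini_stable satF sES fnE sUE ZE_stable sub_ZE) => a f Ga.
rewrite defN => Ff fa; have Aa := subsetP (autF_sub F E) a Ga.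
have fEE : f @: E = E.
  apply/eqP; rewrite eqEcard (fsys_card fusF Ff sEN) leqnn andbT.
  by apply/subsetP=> _ /imsetP[x Ex ->]; rewrite fa ?Aut_closed.
have [_ fM _ sfS] := fsys_hom fusF Ff.
(* [f] maps [E] onto itself, so it preserves ['N_S(E)]. *)
have sfN : f @: N \subset N.
  apply/subsetP=> _ /imsetP[n Nn ->]; rewrite inE (subsetP sfS) ?imset_f //=.
  rewrite inE; apply/subsetP=> _ /imsetP[y Ey ->].
  have [x Ex ->] : exists2 x, x \in E & y = f x.
    by move: Ey; rewrite -{1}fEE => /imsetP[x]; exists x.
  have Nx := subsetP sEN x Ex.
  rewrite -!(fsys_morphismE fusF Ff) -morphJ // (fsys_morphismE fusF Ff).
  by rewrite -fEE imset_f // memJ_norm //; case/setIP: Nn.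
have [b Gb bf] := autF_hom fusF Ff sfN.
have sZN : Z \subset N := subset_trans sZZN (center_sub N).
have /eqP := etrans (perm_imset_astabs b Z) (subsetP stZN b Gb).
move=> {2}<-; apply: eq_in_imset => x Zx; rewrite bf //; exact: subsetP sZN x Zx.
Qed.

(** An invariant line is normal, hence central, in [N]. As ['C_U(N)] is proper in [U], it has order
    p and contains both this line and [Z]; they coincide, but [Z] is not invariant. *)
Lemma ZE_irr X : Z != U -> #|U| = (p ^ 2)%N -> X \subset U -> #|X| = p ->
  ~ autF F E \subset 'N(X | 'P).
Proof.
move=> neqZU oU sXU oX stX; have ncU := ess_not_mover neqZU.
pose D := 'C_U(N)%G.
have sZD : Z \subset D.
  by rewrite subsetI sub_ZE (subset_trans sZZN) ?subsetIr.
have sXD : X \subset D.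
  rewrite subsetI sXU (subset_trans (order_p_central p_pr pN _ oX)) ?subsetIr //.
  have sXE := subset_trans sXU sUE; rewrite /normal (subset_trans sXE) //.
  by apply/subsetP=> x; apply: (autF_stable_conj fusF sES sXE stX).
have pD : p.-group D := pgroupS (subsetIl _ _) (abelem_pgroup ZE_abelem).
have leD : #|D| <= p.
  rewrite leqNgt; apply/negP=> ltD; case/negP: ncU.
  have /eqP defD : D == U :> {set gT}.
    rewrite eqEcard subsetIl oU dvdn_leq // (pgroup_index_dvd p_pr pD) //.
  by rewrite centsC -defD subsetIr.
have eqD (K : {group gT}) : K \subset D -> K != 1 :> {set gT} -> K :=: D.
  move=> sKD ntK; apply/eqP; rewrite eqEcard sKD (leq_trans leD) // dvdn_leq //.
  have pK := pgroupS sKD pD; have [k ok] := p_natP pK; move: ntK.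
  by rewrite -cardG_gt1 ok; case: k {ok} => // k _; rewrite expnS dvdn_mulr.
case/negP: neqZU; rewrite ZE_eq (eqD ('Ohm_1('Z(S))%G)) ?ess_Ohm1_center_nt //.
by rewrite -(eqD X) // -cardG_gt1 oX prime_gt1.
Qed.

(** If [U] has order p^2 it is an irreducible plane; if it has order p^3 it is ['Ohm_1(E)], and the
    constant chain at [U] applies. *)
Lemma ZE_cent : Z != U -> 'C_N(U) = E.
Proof.
move=> neqZU; have pU := abelem_pgroup ZE_abelem.
have ltZU : #|Z| < #|U| by rewrite proper_card // properEneq neqZU sub_ZE.
have sUS := subset_trans sUE sES.
have [oU | neqU] := eqVneq #|U| (p ^ 2)%N.
  apply: (ess_irr_plane p_pr odd_p pS satF rkS essE sUZE ZE_abelem oU ZE_stable).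
  by move=> X; apply: ZE_irr.
have oU : #|U| = (p ^ 3)%N.
  have := abelem_card p_pr rkS sUS ZE_abelem.
  have [k ok] := p_natP pU; move: neqU ltZU; rewrite ok leq_exp2l ?prime_gt1 //.
  have : 1 < #|Z| by rewrite cardG_gt1 ess_Ohm1_center_nt.
  have [l ol] := p_natP (pgroupS sub_ZE pU); rewrite ol.
  case: l {ol} => // l _.
  rewrite ltn_exp2l ?prime_gt1 // eqn_exp2l ?prime_gt1 //.
  by case: k {ok} => [|[|[|[|k]]]].
have [_ _ stU faU] := ess_rank3_center p_pr odd_p pS rkS essE ZE_abelem oU sUZE.
apply/eqP; rewrite eqEsubset [E \subset _]subsetI sEN centsC.
rewrite (subset_trans sUZE) ?subsetIr // !andbT.
apply/subsetP=> n /setIP[Nn cUn]; apply: (ess_chain pS satF essE (subxx U)) => //.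
move=> x Ux; have /commgP/eqP -> : commute x n by apply/commute_sym/(centP cUn).
exact: group1.
Qed.

Lemma sub_core_ZE_eq : ~ F_characteristic F S E -> Z \subset T -> Z = U :> {set gT}.
Proof.
move=> /ess_not_normal nstE sZT; apply/eqP/negPn/negP=> neqZU; apply: nstE.
have [sTE stTE stTN] := core_stable.
have sUT : U \subset T := ZE_min sZT stTE.
have sTN := subset_trans sTE sEN; have defE := ZE_cent neqZU.
pose W := 'Ohm_1('Z(T))%G.
have chW : W \char T by rewrite (char_trans (Ohm_char 1 _)) ?center_char.
have sWT : W \subset T := char_sub chW.
have sWE := subset_trans sWT sTE; have sWN := subset_trans sWT sTN.
have stWE : autF F E \subset 'N(W | 'P).
  apply/subsetP=> a Ga; apply: Aut_char_astabs2 chW sTE (subsetP (autF_sub F E) a Ga) _.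
  exact: subsetP stTE a Ga.
have stWN : autF F N \subset 'N(W | 'P).
  apply/subsetP=> a Ga; apply: Aut_char_astabs2 chW sTN (subsetP (autF_sub F _) a Ga) _.
  exact: subsetP stTN a Ga.
have sUW : U \subset W.
  rewrite -(Ohm1_id ZE_abelem) OhmS // subsetI sUT centsC (subset_trans sTE) //.
  by rewrite centsC (subset_trans sUZE) ?subsetIr.
have sKE : 'C_N(W) \subset E by rewrite -{2}defE setIS ?centS.
have stKN : autF F N \subset 'N('C_N(W) | 'P).
  apply/subsetP=> a Ga.
  by apply: Aut_cent_astabs (subsetP (autF_sub F _) a Ga) sWN (subsetP stWN a Ga).
have defK : 'C_N(W) = 'C_E(W).
  by apply/eqP; rewrite eqEsubset subsetI sKE subsetIr setSI.
have sKT : 'C_N(W) \subset T.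
  apply: (core_max (K := 'C_N(W)%G)) => //; rewrite /= defK; apply/subsetP=> a Ga.
  by apply: Aut_cent_astabs (subsetP (autF_sub F E) a Ga) sWE (subsetP stWE a Ga).
(* If [E] centralizes [W], then [E = 'C_N(W)], whose invariance is known. *)
have [RWE1 | ntR] := eqVneq [~: W, E] 1.
  suffices defE' : 'C_N(W) = E by move: stKN; rewrite defE'.
  apply/eqP; rewrite eqEsubset sKE [E \subset _]subsetI sEN centsC /=.
  by apply/commG1P.
have pU := abelem_pgroup ZE_abelem; have sWS := subset_trans sWE sES.
have pW : p.-group W := pgroupS sWS pS.
have abW : p.-abelem W by rewrite Ohm1_abelem ?center_abelian // (pgroupS (center_sub T)) ?(pgroupS sTE).
have oW : #|W| <= p ^ 3 := abelem_card p_pr rkS sWS abW.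
have neqUW : U != W :> {set gT}.
  apply: contraNneq ntR => <-; apply/eqP/commG1P.
  by rewrite (subset_trans sUZE) ?subsetIr.
have ltUW : #|U| < #|W| by rewrite proper_card // properEneq neqUW.
have ltZU : #|Z| < #|U| by rewrite proper_card // properEneq neqZU sub_ZE.
(* [1 < Z < U < W] and [#|W| <= p ^ 3] determine the orders. *)
have [oU iUW] : #|U| = (p ^ 2)%N /\ #|W : U| = p.
  have [k ok] := p_natP pU; have [m om] := p_natP pW.
  have [l ol] := p_natP (pgroupS sub_ZE pU).
  have l_gt0 : 0 < l by have := ess_Ohm1_center_nt; rewrite -cardG_gt1 ol; case: (l).
  have l_lt_k : l < k by move: ltZU; rewrite ok ol ltn_exp2l // prime_gt1.
  have k_lt_m : k < m by move: ltUW; rewrite ok om ltn_exp2l // prime_gt1.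
  have m_le3 : m <= 3 by move: oW; rewrite om leq_exp2l // prime_gt1.
  have k2 : k = 2.
    by apply/eqP; rewrite eqn_leq (leq_ltn_trans l_gt0 l_lt_k) -ltnS (leq_trans k_lt_m m_le3).
  have m3 : m = 3 by apply/eqP; rewrite eqn_leq m_le3 -k2.
  by rewrite -divgS // ok om k2 m3 (expnS p 2) mulnK // expn_gt0 prime_gt0.
have nsN (K : {group gT}) : K \subset E -> autF F E \subset 'N(K | 'P) -> K <| N.
  move=> sKE' stK; rewrite /normal (subset_trans sKE') //.
  by apply/subsetP=> x; apply: (autF_stable_conj fusF sES sKE' stK).
have RWN : [~: W, N] \subset U.
  exact: (index_p_comm p_pr pN (nsN U sUE ZE_stable) (nsN W sWE stWE) sUW iUW).
pose D := [~: W, E]%G.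
have sDU : D \subset U := subset_trans (commgS W sEN) RWN.
have stEE : autF F E \subset 'N(E | 'P) by rewrite autF_char_stable ?char_refl.
have stNN : autF F N \subset 'N(N | 'P) by rewrite autF_char_stable ?char_refl.
have stD : autF F E \subset 'N(D | 'P).
  apply/subsetP=> a Ga; apply: Aut_comm_astabs (subsetP (autF_sub F E) a Ga) sWE _ _ _ => //.
    exact: subsetP stWE a Ga.
  exact: subsetP stEE a Ga.
(* [D] is a nontrivial invariant subgroup of the plane [U], and [ZE_irr] excludes a line. *)
have defU : D = U :> {set gT}.
  have pD := pgroupS sDU pU; have [k ok] := p_natP pD.
  apply/eqP; rewrite eqEcard sDU oU.
  have : #|D| != p by apply/eqP=> oD; apply: (ZE_irr neqZU oU sDU oD stD).
  move: ntR; rewrite -cardG_gt1 -/D ok; case: k {ok} => [|[|k]] //.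
    by rewrite expn1 eqxx.
  by rewrite leq_exp2l // prime_gt1.
have defR : [~: W, N] = U.
  by apply/eqP; rewrite eqEsubset RWN -defU commgS.
have stUN : autF F N \subset 'N(U | 'P).
  rewrite -defR; apply/subsetP=> a Ga.
  apply: Aut_comm_astabs (subsetP (autF_sub F _) a Ga) sWN _ _ _ => //.
    exact: subsetP stWN a Ga.
  exact: subsetP stNN a Ga.
suffices : autF F N \subset 'N('C_N(U) | 'P) by rewrite defE.
apply/subsetP=> a Ga.
apply: Aut_cent_astabs (subsetP (autF_sub F _) a Ga) _ (subsetP stUN a Ga).
exact: subset_trans sUE sEN.
Qed.

End Core.
End Final.

Theorem theorem5p5 (gT : finGroupType) (p : nat) (S : {group gT}) (F : fsys gT)
    (E T : {group gT}) :
  prime p -> odd p -> p.-group S -> sectional_rank S 3 ->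
  saturated F S p ->
  F_essential p F S E -> ~ F_characteristic F S E ->
  is_Fcore F S E T ->
  ('Ohm_1('Z(S)) = ZE F E 'Ohm_1('Z(S)) <-> 'Ohm_1('Z(S)) \subset T).
Proof.
move=> p_pr odd_p pS [rk _] satF essE nchE coreT.
have rkS (Q : {group gT}) : Q \subset S -> 'm(Q) <= 3.
  by move=> /rk[X [leX <-]]; apply: leq_trans (grank_min X) leX.
have essE' : essential_like p F S E.
  have [sES cEE fnE _] := essE; split=> //.
    by move=> K; apply: (essential_Op_inner p_pr satF essE).
  exact: (essential_normalizer p_pr satF essE).
split; last exact: (sub_core_ZE_eq p_pr odd_p pS satF rkS essE' coreT nchE).
exact: (ZE_eq_sub_core p_pr odd_p pS satF rkS essE' coreT).
Qed.
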